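(* Let $n\in\mathbb Z_{\ge1}$. Modulo terms of order $\hbar^2$ there is, up to rescaling, exactly one state $\tilde\varsigma_{2n-1}\in\widetilde{\mathcal V}_{2n}^{\mathfrak{sl}_2}$ such that, for all $x\in\mathfrak{sl}_2$ and all $m\in\mathbb Z_{\ge0}$, with $\tilde x:=\hbar x$, $$\Delta\tilde x_m\,\tilde\varsigma_{2n-1}\in\hbar^2D^{(2n-1)}_z\mathcal V_{2n-m,2n-1}+\hbar^3\mathcal V_{2n-m,2n}.$$ Explicitly, modulo terms in $\hbar^2\mathcal V_{2n}$, $$\tilde\varsigma_{2n-1}(z)=t_{i_1,\dots,i_{2n}}\tilde I^{i_1}_{-1}(z)\tilde I^{i_2}_{-1}(z)\cdots\tilde I^{i_{2n}}_{-1}(z)|0\rangle+\hbar\,\frac{n(2n+1)(2n-2)}{2n-1}\,t_{i_1,\dots,i_{2n-4}}f^{abc}\,\tilde I^a_{-2}(z)\tilde I^{b\prime}_{-1}(z)\tilde I^{(c}_{-1}(z)\tilde I^{i_1}_{-1}(z)\cdots\tilde I^{i_{2n-4})}_{-1}(z)|0\rangle .$$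
   Context: Basis of $\mathfrak{sl}_2$: $\{I^a\}_{a=1}^3$ is a basis of $\mathfrak{sl}_2(\mathbb C)$ orthonormal for $(x|y)=\mathrm{Tr}(xy)$ (trace in the defining representation), with $[I^a,I^b]=f^{abc}I^c$, $f^{abc}=i\sqrt2\,\epsilon^{abc}$. Repeated Lie algebra indices are summed. Round brackets on indices denote symmetrization with weight one ($\frac1{r!}$ times the sum over permutations of the $r$ bracketed indices). $t_{i_1,\dots,i_{2r}}=\delta_{(i_1i_2}\delta_{i_3i_4}\cdots\delta_{i_{2r-1}i_{2r})}$, with $t=1$ for $r=0$. For $n=1$ the second term of $\tilde\varsigma_{2n-1}$ is absent (its coefficient is $0$). Rescaled algebra: $\hbar$ is a formal parameter and everything is over $\mathbb C[[\hbar]]$. Rescaled generators are $\tilde I^a=\hbar I^a$, $\tilde{\mathsf k}=\mathsf k$: consider the Lie algebra with basis the formal symbols $\tilde I^{a[p]}_n(z)$, $\tilde{\mathsf k}^{[p]}(z)$ ($n\in\mathbb Z$, $p\in\mathbb Z_{\ge0}$, $a=1,2,3$), with $\tilde{\mathsf k}^{[p]}(z)$ central and $$[\tilde I^{a[p]}_m(z),\tilde I^{b[q]}_r(z)]=-\frac{p!\,q!}{(p+q+1)!}\Big(\hbar f^{abc}\tilde I^{c[p+q+1]}_{m+r}(z)-\hbar^2\,r\,\delta^{ab}\delta_{m+r,0}\tilde{\mathsf k}^{[p+q+1]}(z)\Big).$$ A prime denotes $[p]=[1]$, no mark $[p]=[0]$. $\mathcal V$ is the module over this Lie algebra induced from the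 trivial module spanned by $|0\rangle$ over the subalgebra generated by $\tilde I^{a[p]}_r(z)$, $r\ge0$. It is bigraded, $\mathcal V=\bigoplus\mathcal V_{r,p}$, by giving $\tilde I^{a[p]}_{-r}(z)$ weight $(r,p+1)$, $\tilde{\mathsf k}^{[p]}(z)$ weight $(0,p+1)$, and $\hbar$ and $|0\rangle$ weight $(0,0)$; $\mathcal V_r:=\mathcal V_{r,r}$. There is a further gradation in which each $\tilde I^a$ and $\hbar$ have grade $1$ and $\tilde{\mathsf k}$ has grade $0$; $\widetilde{\mathcal V}_r\subset\mathcal V_r$ is the subspace of states of grade $r$ in this gradation (sums of terms with exactly $r$ factors of $\tilde I$ or $\hbar$). $\widetilde{\mathcal V}_r^{\mathfrak{sl}_2}$ is the subspace annihilated by the diagonal action of zero modes. Diagonal action: for $m\ge0$, $\Delta\tilde I^a_m|0\rangle=0$, $[\Delta\tilde I^a_m,\tilde{\mathsf k}^{[p]}(z)]=0$, and $[\Delta\tilde I^a_m,\tilde I^{b[p]}_r(z)]=\hbar f^{abc}\tilde I^{c[p]}_{m+r}(z)-\hbar^2r\,\delta^{ab}\delta_{m+r,0}\tilde{\mathsf k}^{[p]}(z)$, extended linearly to $\Delta\tilde x_m$, $x\in\mathfrak{sl}_2$. Twisted derivative: $D^{(j)}_z=\partial_z-\frac j2\tilde{\mathsf k}(z)$, with $\partial_z$ the derivation sending $\tilde I^{a[p]}_r(z)\mapsto\tilde I^{a[p+1]}_r(z)$, $\tilde{\mathsf k}^{[p]}(z)\mapsto\tilde{\mathsf k}^{[p+1]}(z)$,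 $|0\rangle\mapsto0$. *)

(* Defs.v *)
From HB Require Import structures.
From mathcomp Require Import all_boot all_order all_algebra all_fingroup.
From mathcomp Require Import generic_quotient ring_quotient.
From mathcomp Require Import finmap ring.
From mathcomp.classical Require Import boolp.
From mathcomp Require Import monalg.

Set Implicit Arguments.
Unset Strict Implicit.
Unset Printing Implicit Defensive.

Import Order.TTheory GRing.Theory Num.Theory.
Local Open Scope ring_scope.
Local Open Scope quotient_scope.

Definition fps (F : fieldType) := nat -> F.

(** The ring [F[[hbar]]]. The operations are locked so that conversion does not
    compare power series coefficientwise; [fpsC c] is the constant series [c]. *)
HB.lock Definition fpsC (F : fieldType) (c : F) : fps F :=
  fun n => if n is 0%N then c else 0.
HB.lock Definition hbar (F : fieldType) : fps F := fun n => (n == 1%N)%:R.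
HB.lock Definition fps_add (F : fieldType) (f g : fps F) : fps F :=
  fun n => f n + g n.
HB.lock Definition fps_opp (F : fieldType) (f : fps F) : fps F :=
  fun n => - f n.
HB.lock Definition fps_mul (F : fieldType) (f g : fps F) : fps F :=
  fun n => \sum_(j < n.+1) f j * g (n - j)%N.

Section FormalPowerSeries.
Variable F : fieldType.
Implicit Types f g h : fps F.
Local Notation fps_add := (@fps_add F).
Local Notation fps_mul := (@fps_mul F).
Local Notation fpsC := (@fpsC F).

HB.instance Definition _ := Choice.copy (fps F) (nat -> F).

Lemma fpsCE c n : fpsC c n = if n is 0%N then c else 0.
Proof. by rewrite fpsC.unlock. Qed.
Lemma hbarE n : hbar F n = (n == 1%N)%:R. Proof. by rewrite hbar.unlock. Qed.

Fact fps_addA : associative fps_add.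
Proof. by move=> f g h; apply/funext => n; rewrite fps_add.unlock addrA. Qed.
Fact fps_addC : commutative fps_add.
Proof. by move=> f g; apply/funext => n; rewrite fps_add.unlock addrC. Qed.
Fact fps_add0 : left_id (fpsC 0) fps_add.
Proof. by move=> f; apply/funext => -[|n]; rewrite fps_add.unlock fpsCE add0r. Qed.
Fact fps_addN : left_inverse (fpsC 0) (@fps_opp F) fps_add.
Proof. by move=> f; apply/funext => -[|n]; rewrite fps_add.unlock fps_opp.unlock fpsCE addNr. Qed.

HB.instance Definition _ :=
  GRing.isZmodule.Build (fps F) fps_addA fps_addC fps_add0 fps_addN.

Definition fps_trunc n f : {poly F} := \poly_(j < n.+1) f j.

Fact fps_mulE n f g k : (k <= n)%N ->
  fps_mul f g k = (fps_trunc n f * fps_trunc n g)`_k.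
Proof.
move=> le_kn; rewrite fps_mul.unlock coefM; apply: eq_bigr => -[j /=]; rewrite ltnS => le_jk _.
rewrite !coef_poly !ltnS (leq_trans le_jk le_kn).
by rewrite (leq_trans (leq_subr _ _) le_kn).
Qed.

Fact fps_mulC : commutative fps_mul.
Proof. by move=> f g; apply/funext => n; rewrite !(fps_mulE _ _ (leqnn n)) mulrC. Qed.

Fact fps_mul_def f g n : fps_mul f g n = \sum_(j < n.+1) f j * g (n - j)%N.
Proof. by rewrite fps_mul.unlock. Qed.

Fact fps_mulA : associative fps_mul.
Proof.
move=> f g h; apply/funext => n; have nn := leqnn n.
transitivity ((fps_trunc n f * fps_trunc n g * fps_trunc n h)`_n).
- rewrite -mulrA coefM fps_mul_def; apply: eq_bigr => -[j /=]; rewrite ltnS => le_jn _.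
  by rewrite coef_poly ltnS le_jn (fps_mulE _ _ (leq_subr j n)).
- rewrite coefM fps_mul_def; apply: eq_bigr => -[j /=]; rewrite ltnS => le_jn _.
  by rewrite (fps_mulE _ _ le_jn) coef_poly ltnS leq_subr.
Qed.

Fact fpsCM c f n : fps_mul (fpsC c) f n = c * f n.
Proof.
rewrite fps_mul.unlock big_ord_recl subn0 big1 ?addr0 ?fpsCE // => j _.
by rewrite fpsCE mul0r.
Qed.

Fact fps_mul1 : left_id (fpsC 1) fps_mul.
Proof. by move=> f; apply/funext => n; rewrite fpsCM mul1r. Qed.

Fact fps_mulDl : left_distributive fps_mul fps_add.
Proof.
move=> f g h; apply/funext => n; rewrite fps_add.unlock fps_mul.unlock -big_split /=.
by apply: eq_bigr => j _; rewrite mulrDl.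
Qed.

Fact fps_1neq0 : fpsC 1 != 0 :> fps F.
Proof.
apply/eqP => /(congr1 (fun f : fps F => f 0%N)).
by rewrite -[0]/(fpsC 0) !fpsCE => /eqP; rewrite oner_eq0.
Qed.

HB.instance Definition _ := GRing.Zmodule_isComNzRing.Build (fps F)
  fps_mulA fps_mulC fps_mul1 fps_mulDl fps_1neq0.

Lemma coef_fpsD f g n : (f + g) n = f n + g n.
Proof. by rewrite /GRing.add /= fps_add.unlock. Qed.
Lemma coef_fpsN f n : (- f) n = - f n.
Proof. by rewrite /GRing.opp /= fps_opp.unlock. Qed.
Lemma coef_fpsM f g n : (f * g) n = \sum_(j < n.+1) f j * g (n - j)%N.
Proof. by rewrite /GRing.mul /= fps_mul.unlock. Qed.

Fact fpsC_zmod : zmod_morphism fpsC.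
Proof.
by move=> a b; apply/funext => n; rewrite coef_fpsD coef_fpsN !fpsCE; case: n => //; rewrite subr0.
Qed.
HB.instance Definition _ := GRing.isZmodMorphism.Build F (fps F) fpsC fpsC_zmod.

Fact fpsC_monoid : monoid_morphism fpsC.
Proof.
split=> // a b; apply/funext => n; rewrite [RHS](fpsCM a) !fpsCE.
by case: n => // n; rewrite mulr0.
Qed.
HB.instance Definition _ := GRing.isMonoidMorphism.Build F (fps F) fpsC fpsC_monoid.

End FormalPowerSeries.

Arguments hbar {F}.
Arguments fpsC {F} c.

Section Sl2.
Variable F : numClosedFieldType.

(** The additions take place in ['I_3], i.e. modulo 3. *)
Definition levi_civita (a b c : 'I_3) : F :=
  if (b == a + 1) && (c == a + 2) then 1
  else if (b == a + 2) && (c == a + 1) then -1 else 0.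

Definition fstr (a b c : 'I_3) : F := 'i * sqrtC 2 * levi_civita a b c.

Definition sl2 : {vspace 'M[F]_2} := lker (linfun (mxtrace : 'M[F]_2 -> F^o)).

Lemma sl2E (x : 'M[F]_2) : (x \in sl2) = (\tr x == 0).
Proof. by rewrite memv_ker lfunE. Qed.

Definition orthonormal_sl2_basis (B : 3.-tuple 'M[F]_2) : Prop :=
  [/\ basis_of sl2 B,
      forall a b : 'I_3, \tr (tnth B a *m tnth B b) = (a == b)%:R
    & forall a b : 'I_3, tnth B a *m tnth B b - tnth B b *m tnth B a
                         = \sum_c fstr a b c *: tnth B c].

Lemma fstrC a b c : fstr b a c = - fstr a b c.
Proof.
rewrite /fstr -mulrN /levi_civita; congr (_ * _).
by case: a b c => -[|[|[|//]]] ? [[|[|[|//]]] ?] [[|[|[|//]]] ?];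
   rewrite /= ?oppr0 ?opprK.
Qed.

Lemma fstr_rot a b c : fstr b c a = fstr a b c.
Proof.
rewrite /fstr /levi_civita; congr (_ * _).
by case: a b c => -[|[|[|//]]] ? [[|[|[|//]]] ?] [[|[|[|//]]] ?].
Qed.

Lemma fstr_jacobi a b e d :
  \sum_c (fstr e a c * fstr c b d + fstr e b c * fstr a c d)
  = \sum_c fstr a b c * fstr e c d.
Proof.
rewrite !big_ord_recl !big_ord0 /fstr /levi_civita.
by case: a b e d => -[|[|[|//]]] ? [[|[|[|//]]] ?] [[|[|[|//]]] ?]
   [[|[|[|//]]] ?]; rewrite /=; ring.
Qed.

End Sl2.

Section MalgScale.
Variables (K : monomType) (R : comNzRingType).
Lemma malg_scaleAr (c : R) (u v : {malg R[K]}) : c *: (u * v) = u * (c *: v).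
Proof.
rewrite (malgMEw (fsubset_refl _) (fsubset_refl _)).
rewrite (malgMEw (fsubset_refl _) (msuppZ_le c v)).
rewrite scaler_sumr; apply: eq_bigr => k _; rewrite scaler_sumr.
apply: eq_bigr => l _.
rewrite mcoeffZ; apply/malgP => j; rewrite mcoeffZ !mcoeffU.
by case: eqP; rewrite ?mulr0 // !mulr1n mulrCA.
Qed.
End MalgScale.

(** [Igen a p m] is [I^{a[p]}_m(z)] and [kgen p] is [k^{[p]}(z)]. *)
Inductive lgen : predArgType := Igen of 'I_3 & nat & int | kgen of nat.

Definition lgen_code (x : lgen) : 'I_3 * nat * int + nat :=
  match x with Igen a p m => inl (a, p, m) | kgen p => inr p end.
Definition lgen_decode (y : 'I_3 * nat * int + nat) : lgen :=
  match y with inl (a, p, m) => Igen a p m | inr p => kgen p end.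
Fact lgen_codeK : cancel lgen_code lgen_decode. Proof. by case. Qed.
HB.instance Definition _ := Choice.copy lgen (can_type lgen_codeK).

(** The free associative algebra on the generators, i.e. the tensor algebra of
    the free [F[[hbar]]]-module with basis [lgen]. The operations are those of
    [malg], locked to keep conversion from unfolding them. *)
Section FreeAlgebra.
Variable F : fieldType.
Local Notation S := (fps F).

Definition tens : Type := {malg S[{fmonom lgen}]}.
HB.instance Definition _ := GRing.Zmodule.on tens.
End FreeAlgebra.

HB.lock Definition tens_mul (F : fieldType) (u v : tens F) : tens F :=
  (u : {malg (fps F)[{fmonom lgen}]}) * v.
HB.lock Definition tens_scale (F : fieldType) (c : fps F) (u : tens F) : tens F :=
  c *: (u : {malg (fps F)[{fmonom lgen}]}).
HB.lock Definition word (F : fieldType) (s : seq lgen) : tens F :=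
  mkmalgU (FMonom s) 1.

Section FreeAlgebraTheory.
Variable F : fieldType.
Local Notation S := (fps F).
Local Notation tens := (tens F).
Local Notation word := (@word F).
Local Notation tens_mul := (@tens_mul F).
Local Notation tens_scale := (@tens_scale F).

Fact word_nil1 : word [::] = (1 : {malg S[{fmonom lgen}]}).
Proof. by rewrite word.unlock -fmoneE. Qed.
Fact tens_mulA : associative tens_mul.
Proof. by move=> u v w; rewrite tens_mul.unlock mulrA. Qed.
Fact tens_mul1l : left_id (word [::]) tens_mul.
Proof. by move=> u; rewrite tens_mul.unlock word_nil1 mul1r. Qed.
Fact tens_mul1r : right_id (word [::]) tens_mul.
Proof. by move=> u; rewrite tens_mul.unlock word_nil1 mulr1. Qed.
Fact tens_mulDl : left_distributive tens_mul +%R.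
Proof. by move=> u v w; rewrite tens_mul.unlock; exact: mulrDl. Qed.
Fact tens_mulDr : right_distributive tens_mul +%R.
Proof. by move=> u v w; rewrite tens_mul.unlock; exact: mulrDr. Qed.
Fact tens_1neq0 : word [::] != 0.
Proof. by rewrite word_nil1; exact: oner_neq0. Qed.
HB.instance Definition _ := GRing.Zmodule_isNzRing.Build tens
  tens_mulA tens_mul1l tens_mul1r tens_mulDl tens_mulDr tens_1neq0.

Fact tens_scaleA a b u : tens_scale a (tens_scale b u) = tens_scale (a * b) u.
Proof. by rewrite tens_scale.unlock; exact: scalerA. Qed.
Fact tens_scale1 : left_id 1 tens_scale.
Proof. by move=> u; rewrite tens_scale.unlock; exact: scale1r. Qed.
Fact tens_scaleDr : right_distributive tens_scale +%R.
Proof. by move=> c u v; rewrite tens_scale.unlock; exact: scalerDr. Qed.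
Fact tens_scaleDl u : {morph tens_scale^~ u : a b / a + b}.
Proof. by move=> a b; rewrite tens_scale.unlock; exact: scalerDl. Qed.
HB.instance Definition _ := GRing.Zmodule_isLmodule.Build S tens
  tens_scaleA tens_scale1 tens_scaleDr tens_scaleDl.

Fact tens_scaleAl (c : S) (u v : tens) : c *: (u * v) = c *: u * v.
Proof.
rewrite /GRing.scale /= tens_scale.unlock /GRing.mul /= tens_mul.unlock.
exact: scalerAl.
Qed.
HB.instance Definition _ := GRing.Lmodule_isLalgebra.Build S tens tens_scaleAl.
Fact tens_scaleAr (c : S) (u v : tens) : c *: (u * v) = u * (c *: v).
Proof.
rewrite /GRing.scale /= tens_scale.unlock /GRing.mul /= tens_mul.unlock.
exact: malg_scaleAr.
Qed.
HB.instance Definition _ := GRing.Lalgebra_isAlgebra.Build S tens tens_scaleAr.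

Definition tcoef (w : seq lgen) (u : tens) : S :=
  mcoeff (FMonom w) (u : {malg S[{fmonom lgen}]}).
Definition tsupp (u : tens) : seq (seq lgen) :=
  [seq fmonom_val w | w <- msupp (u : {malg S[{fmonom lgen}]})].

Lemma word_nil : word [::] = 1.
Proof. by []. Qed.

Lemma word_cat s t : word (s ++ t) = word s * word t.
Proof.
rewrite /GRing.mul /= tens_mul.unlock word.unlock.
rewrite [RHS]malgM_def fgmulUU mulr1; congr mkmalgU.
by rewrite /mmul /= fmmulE.
Qed.

Fact tcoef_is_linear w : linear_for *%R (tcoef w).
Proof.
move=> c u v; rewrite /tcoef {1}/GRing.scale /= tens_scale.unlock.
by rewrite mcoeffD mcoeffZ.
Qed.
HB.instance Definition _ w :=
  GRing.isLinear.Build S tens S *%R (tcoef w) (tcoef_is_linear w).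

Lemma tcoef_word w s : tcoef w (word s) = (s == w)%:R.
Proof. by rewrite /tcoef word.unlock mcoeffU1. Qed.

Lemma tsupp_word s : tsupp (word s) = [:: s].
Proof.
rewrite /tsupp word.unlock msuppU1.
have := cardfs1 (FMonom s).
have : FMonom s \in enum_fset [fset FMonom s]%fset by rewrite -[_ \in _]/(_ \in [fset FMonom s]%fset) fset11.
by case: (enum_fset _) => [|x [|? ?]] //; rewrite inE => /eqP <-.
Qed.

Lemma tensE (u : tens) : u = \sum_(w <- tsupp u) tcoef w u *: word w.
Proof.
rewrite [LHS]monalgE /tsupp big_map; apply: eq_bigr => -[w] _.
apply/malgP => k; rewrite word.unlock /GRing.scale /= tens_scale.unlock.
by rewrite mcoeffZ !mcoeffU /tcoef; case: eqP; rewrite ?mulr1 ?mulr0.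
Qed.
End FreeAlgebraTheory.

Section Vacuum.
Variable F : numClosedFieldType.
Local Notation S := (fps F).
Local Notation tens := (tens F).
Local Notation word := (@word F).

Definition gen (x : lgen) : tens := word [:: x].

Lemma word_cons x s : word (x :: s) = gen x * word s.
Proof. by rewrite -word_cat. Qed.

Definition Iop a p m : tens := gen (Igen a p m).
Definition kop p : tens := gen (kgen p).

(** [hbar f^{abc} I^{c[p]}_{m+r} - hbar^2 r delta^{ab} delta_{m+r,0} k^{[p]}] *)
Definition affine (a : 'I_3) (m : int) (b : 'I_3) (r : int) (p : nat) : tens :=
  hbar *: (\sum_c fpsC (fstr F a b c) *: Iop c p (m + r))
  - (hbar ^+ 2 * fpsC (r%:~R * (a == b)%:R * (m + r == 0)%:R)) *: kop p.

Definition bracket (x y : lgen) : tens :=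
  match x, y with
  | Igen a p m, Igen b q r =>
      fpsC (- ((p`! * q`!)%:R / (p + q).+1`!%:R)) *: affine a m b r (p + q).+1
  | _, _ => 0
  end.

(** [vac_ideal] is the sum of the two-sided ideal generated by the
    [x y - y x - [x, y]] and of the left ideal generated by the [I^{a[p]}_r],
    [r >= 0]. The quotient of [tens] by it is
    [U(g) / U(g) g_+ = U(g) (x)_{U(g_+)} F[[hbar]]|0>]. *)
Inductive vac_ideal : tens -> Prop :=
| vac_ideal0 : vac_ideal 0
| vac_idealP (c : S) u v : vac_ideal u -> vac_ideal v -> vac_ideal (c *: u + v)
| vac_ideal_comm u x y v :
    vac_ideal (u * (gen x * gen y - gen y * gen x - bracket x y) * v)
| vac_ideal_ann u a p (r : int) : 0 <= r -> vac_ideal (u * Iop a p r).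

Lemma vac_idealZ c u : vac_ideal u -> vac_ideal (c *: u).
Proof. by move=> ?; rewrite -[_ *: _]addr0; apply: vac_idealP => //; exact: vac_ideal0. Qed.
Lemma vac_idealD u v : vac_ideal u -> vac_ideal v -> vac_ideal (u + v).
Proof. by move=> ? ?; rewrite -[u]scale1r; apply: vac_idealP. Qed.
Lemma vac_idealB u v : vac_ideal u -> vac_ideal v -> vac_ideal (u - v).
Proof. by move=> ? ?; rewrite addrC -scaleN1r; apply: vac_idealP. Qed.
Lemma vac_ideal_sum (T : Type) (s : seq T) (f : T -> tens) :
  (forall i, vac_ideal (f i)) -> vac_ideal (\sum_(i <- s) f i).
Proof.
by move=> h; elim/big_rec: _ => [|i x _]; [exact: vac_ideal0|exact: vac_idealD].
Qed.

Lemma vac_idealMl w u : vac_ideal u -> vac_ideal (w * u).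
Proof.
elim=> [|c x y _ hx _ hy|x y z v|x a p r r0].
- by rewrite mulr0; exact: vac_ideal0.
- by rewrite mulrDr -tens_scaleAr; apply: vac_idealP.
- by rewrite !mulrA; apply: vac_ideal_comm.
- by rewrite mulrA; apply: vac_ideal_ann.
Qed.

Fixpoint deriv_word (d : lgen -> tens) (s : seq lgen) : tens :=
  if s is x :: s' then d x * word s' + gen x * deriv_word d s' else 0.

Definition deriv (d : lgen -> tens) (u : tens) : tens :=
  \sum_(w <- tsupp u) tcoef w u *: deriv_word d w.

Lemma tens_ind (P : tens -> Prop) :
  P 0 -> (forall c s u, P u -> P (c *: word s + u)) -> forall u, P u.
Proof.
by move=> P0 PD u; rewrite [u]tensE; elim/big_rec: _ => // w x _; exact: PD.
Qed.

Lemma deriv_is_linear d : linear (deriv d).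
Proof.
move=> c u v; rewrite /deriv /tsupp !big_map /=.
pose D := (msupp u `|` msupp v `|` msupp (c *: u + v))%fset.
have W (x : tens) : (msupp x `<=` D)%fset ->
    \sum_(w <- msupp x) tcoef w x *: deriv_word d w
    = \sum_(w <- D) tcoef w x *: deriv_word d w.
  move=> le; rewrite [LHS](big_fset_incl _ le) => //= -[w] _ /mcoeff_outdom.
  by rewrite -[_@_ _]/(tcoef w x) => ->; rewrite scale0r.
rewrite !W; first last.
- exact: fsubsetUr.
- by rewrite /D; apply: fsubset_trans (fsubsetUl _ _); apply: fsubsetUl.
- by rewrite /D; apply: fsubset_trans (fsubsetUl _ _); apply: fsubsetUr.
rewrite scaler_sumr -big_split /=; apply: eq_bigr => w _.
by rewrite linearP scalerDl scalerA.
Qed.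
HB.instance Definition _ d :=
  GRing.isLinear.Build S tens tens *:%R (deriv d) (deriv_is_linear d).

Lemma derivW d s : deriv d (word s) = deriv_word d s.
Proof.
by rewrite /deriv tsupp_word big_seq1 tcoef_word eqxx scale1r.
Qed.

Lemma deriv_word_cat d s t :
  deriv_word d (s ++ t) = deriv_word d s * word t + word s * deriv_word d t.
Proof.
elim: s => [|x s ih] /=; first by rewrite mul0r add0r word_nil mul1r.
rewrite ih word_cat word_cons.
by rewrite mulrDl mulrDr !mulrA addrA.
Qed.

Lemma derivM d u v : deriv d (u * v) = deriv d u * v + u * deriv d v.
Proof.
elim/tens_ind: u => [|c s u ih]; first by rewrite !mul0r !linear0 mul0r addr0.
rewrite mulrDl !linearD /= ih mulrDl -scalerAl !linearZ /=.
have -> : deriv d (word s * v) = deriv d (word s) * v + word s * deriv d v.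
  elim/tens_ind: v {ih} => [|c' t v ih]; first by rewrite !mulr0 !linear0 mulr0 addr0.
  rewrite mulrDr !linearD /= ih -tens_scaleAr !linearZ /=.
  rewrite -word_cat !derivW deriv_word_cat mulrDr mulrDr -!tens_scaleAr scalerDr.
  by rewrite addrACA.
by rewrite scalerDr mulrDl -!scalerAl addrACA.
Qed.

Lemma deriv1 d : deriv d 1 = 0.
Proof. by have := derivW d [::]; rewrite word_nil. Qed.

Lemma deriv_gen d x : deriv d (gen x) = d x.
Proof.
by rewrite derivW /= word_nil mulr1 mulr0 addr0.
Qed.

Definition lcomm (u v : tens) : tens := u * v - v * u.

(** [z = 0] in the enveloping algebra implies [lie_rel z]. *)
Definition lie_rel (z : tens) := forall u v, vac_ideal (u * z * v).

Lemma lie_rel0 : lie_rel 0.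
Proof. by move=> u v; rewrite mulr0 mul0r; exact: vac_ideal0. Qed.
Lemma lie_relD y z : lie_rel y -> lie_rel z -> lie_rel (y + z).
Proof. by move=> hy hz u v; rewrite mulrDr mulrDl; apply: vac_idealD. Qed.
Lemma lie_relZ c z : lie_rel z -> lie_rel (c *: z).
Proof. by move=> hz u v; rewrite -scalerAr -scalerAl; apply: vac_idealZ. Qed.
Lemma lie_relB y z : lie_rel y -> lie_rel z -> lie_rel (y - z).
Proof. by move=> hy hz; rewrite -scaleN1r; apply/lie_relD/lie_relZ. Qed.
Lemma lie_rel_sum (T : Type) (s : seq T) (f : T -> tens) :
  (forall i, lie_rel (f i)) -> lie_rel (\sum_(i <- s) f i).
Proof.
by move=> h; elim/big_rec: _ => [|i x _]; [exact: lie_rel0|exact: lie_relD].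
Qed.
Lemma lie_rel_comm x y : lie_rel (lcomm (gen x) (gen y) - bracket x y).
Proof. by move=> u v; apply: vac_ideal_comm. Qed.

(** A derivation of the Lie algebra that preserves the annihilator of the
    vacuum acts on the vacuum module. *)
Lemma deriv_vac_ideal d :
  (forall x y, lie_rel
     (lcomm (d x) (gen y) + lcomm (gen x) (d y) - deriv d (bracket x y))) ->
  (forall a p (r : int), 0 <= r -> vac_ideal (d (Igen a p r))) ->
  forall u, vac_ideal u -> vac_ideal (deriv d u).
Proof.
move=> dcomm dann u; elim=> [|c x y _ hx _ hy|x y z v|x a p r r0].
- by rewrite linear0; exact: vac_ideal0.
- by rewrite linearD linearZ; apply: vac_idealP.
- rewrite !derivM; apply: vac_idealD; last exact: vac_ideal_comm.
  rewrite mulrDl; apply: vac_idealD; first exact: vac_ideal_comm.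
  rewrite !linearB /= !derivM !deriv_gen.
  have -> : d y * gen z + gen y * d z - (d z * gen y + gen z * d y)
            = lcomm (d y) (gen z) + lcomm (gen y) (d z).
    by rewrite /lcomm opprD [- _ - _]addrC addrACA.
  exact: dcomm.
- rewrite derivM deriv_gen; apply: vac_idealD; first exact: vac_ideal_ann.
  exact/vac_idealMl/dann.
Qed.

Definition dDelta (a : 'I_3) (m : nat) (x : lgen) : tens :=
  match x with Igen b p r => affine a m b r p | kgen _ => 0 end.

Definition dpartial (x : lgen) : tens :=
  match x with Igen b p r => Iop b p.+1 r | kgen p => kop p.+1 end.

Lemma lcommC u v : lcomm v u = - lcomm u v.
Proof. by rewrite /lcomm opprB. Qed.
Lemma lcomm0 u : lcomm 0 u = 0.
Proof. by rewrite /lcomm mul0r mulr0 subrr. Qed.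
Lemma lcommB u v w : lcomm (u - v) w = lcomm u w - lcomm v w.
Proof. by rewrite /lcomm mulrBl mulrBr !opprD !opprK addrACA. Qed.
Lemma lcommZ c u w : lcomm (c *: u) w = c *: lcomm u w.
Proof. by rewrite /lcomm -scalerAl -scalerAr scalerBr. Qed.
Lemma lcomm_sum (T : Type) (s : seq T) (f : T -> tens) w :
  lcomm (\sum_(i <- s) f i) w = \sum_(i <- s) lcomm (f i) w.
Proof. by rewrite /lcomm mulr_suml mulr_sumr -sumrB. Qed.

Lemma bracket_k p y : bracket (kgen p) y = 0. Proof. by []. Qed.
Lemma bracketC x y : bracket y x = - bracket x y.
Proof.
case: x y => [a p m|p] [b q r|q]; rewrite ?oppr0 //=.
rewrite mulnC [(q + p)%N]addnC -scalerN; congr (_ *: _).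
rewrite /affine opprB [RHS]addrC; congr (_ + _).
  rewrite -scalerN; congr (_ *: _); rewrite -sumrN; apply: eq_bigr => c _.
  by rewrite fstrC rmorphN /= scaleNr [r + m]addrC.
rewrite -scaleNr [r + m]addrC [b == a]eq_sym -mulrN -rmorphN /=.
congr ((_ * fpsC _) *: _); have [mr|_] := eqVneq (m + r) 0; last by rewrite !mulr0 oppr0.
have -> : m = - r by apply/eqP; rewrite -addr_eq0 mr.
by rewrite rmorphN /= !mulNr opprK.
Qed.

Lemma lcomm_affine a m b r p y :
  lie_rel (lcomm (affine a m b r p) (gen y)
           - hbar *: \sum_c fpsC (fstr F a b c) *: bracket (Igen c p (m + r)) y).
Proof.
rewrite lcommB !lcommZ lcomm_sum addrAC; apply: lie_relB; last first.
  by apply: lie_relZ; rewrite -[X in lie_rel X]subr0 -(bracket_k p y); exact: lie_rel_comm.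
rewrite -scalerBr -sumrB; apply/lie_relZ/lie_rel_sum => c.
by rewrite lcommZ -scalerBr; apply/lie_relZ/lie_rel_comm.
Qed.

Lemma affine_sum (g : 'I_3 -> F) x m y r p M : (forall c, m c + r c = M) ->
  \sum_c fpsC (g c) *: affine (x c) (m c) (y c) (r c) p
  = hbar *: (\sum_d fpsC (\sum_c g c * fstr F (x c) (y c) d) *: Iop d p M)
    - (hbar ^+ 2 * fpsC (\sum_c g c * ((r c)%:~R * (x c == y c)%:R * (M == 0)%:R)))
      *: kop p.
Proof.
move=> hM; under eq_bigr => c _ do rewrite /affine hM scalerBr.
rewrite sumrB; congr (_ - _).
  under eq_bigr => c _ do rewrite scalerA mulrC -scalerA.
  rewrite -scaler_sumr; congr (_ *: _).
  under eq_bigr => c _ do rewrite scaler_sumr.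
  rewrite exchange_big; apply: eq_bigr => d _ /=.
  rewrite rmorph_sum scaler_suml; apply: eq_bigr => c _.
  by rewrite scalerA -rmorphM.
rewrite rmorph_sum mulr_sumr scaler_suml; apply: eq_bigr => c _.
by rewrite scalerA [in RHS]rmorphM mulrCA.
Qed.

Lemma affine_jacobi e s a m b r p :
  \sum_c fpsC (fstr F e a c) *: affine c (s + m) b r p
  + \sum_c fpsC (fstr F e b c) *: affine a m c (s + r) p
  = \sum_c fpsC (fstr F a b c) *: affine e s c (m + r) p.
Proof.
rewrite !(@affine_sum _ _ _ _ _ _ (s + m + r)) => [|c|c|c]; first 1 last.
- by rewrite addrA.
- by rewrite addrCA addrA.
- by [].
rewrite addrACA -opprD -scalerDr -big_split /= -scalerDl -mulrDr -rmorphD /=.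
congr (hbar *: _ - (_ * fpsC _) *: _).
  apply: eq_bigr => d _; rewrite -scalerDl -rmorphD -big_split /=.
  by congr (fpsC _ *: _); exact: fstr_jacobi.
have delta (g : 'I_3 -> F) (z : int) (x : 'I_3) (k : F) :
    \sum_c g c * (z%:~R * (x == c)%:R * k) = g x * z%:~R * k.
  rewrite (bigD1 x) //= eqxx mulr1 mulrA big1 ?addr0 // => c.
  by rewrite eq_sym => /negbTE ->; rewrite mulr0 mul0r mulr0.
under eq_bigr => c _ do rewrite eq_sym.
rewrite !delta; case: eqP => [smr|_]; last by rewrite !mulr0 addr0.
rewrite !mulr1 -[fstr F e a b]fstr_rot [fstr F e b a]fstrC.
rewrite [fstr F b e a]fstr_rot.
have -> : m = - (s + r) by apply/eqP; rewrite -addr_eq0 addrA [m + s]addrC smr.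
by rewrite !(rmorphD, rmorphN) /=; ring.
Qed.

Lemma deriv_affine d a m b r p :
  deriv d (affine a m b r p)
  = hbar *: (\sum_c fpsC (fstr F a b c) *: d (Igen c p (m + r)))
    - (hbar ^+ 2 * fpsC (r%:~R * (a == b)%:R * (m + r == 0)%:R)) *: d (kgen p).
Proof.
rewrite /affine linearB !linearZ linear_sum /= deriv_gen.
by under eq_bigr => c _ do rewrite linearZ /= deriv_gen.
Qed.

Lemma dDelta_vac_ideal a m u : vac_ideal u -> vac_ideal (deriv (dDelta a m) u).
Proof.
apply: deriv_vac_ideal => [x y|b p r r0]; last first.
  rewrite /dDelta /affine; apply: vac_idealB.
    apply: vac_idealZ; apply: vac_ideal_sum => c; apply: vac_idealZ.
    by rewrite -[Iop _ _ _]mul1r; apply: vac_ideal_ann; rewrite addr_ge0.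
  have -> : r%:~R * (a == b)%:R * (m%:Z + r == 0)%:R = 0 :> F.
    have [mr|_] := eqVneq (m%:Z + r) 0; last by rewrite mulr0.
    have -> : r = 0 by apply/eqP; rewrite eq_le r0 andbT -mr lerDr.
    by rewrite !mul0r.
  by rewrite rmorph0 mulr0 scale0r; exact: vac_ideal0.
have swapZ (k l : S) (v : tens) : k *: (l *: v) = l *: (k *: v).
  by rewrite !scalerA mulrC.
pose dbr (x y : lgen) := if x is Igen b p r
  then hbar *: \sum_c fpsC (fstr F a b c) *: bracket (Igen c p (m%:Z + r)) y else 0.
have dbrP x' y' : lie_rel (lcomm (dDelta a m x') (gen y') - dbr x' y').
  case: x' => [b p r|p]; first exact: lcomm_affine.
  by rewrite lcomm0 subr0; exact: lie_rel0.
have -> : lcomm (dDelta a m x) (gen y) + lcomm (gen x) (dDelta a m y)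
          - deriv (dDelta a m) (bracket x y)
        = (lcomm (dDelta a m x) (gen y) - dbr x y)
          - (lcomm (dDelta a m y) (gen x) - dbr y x).
  have -> : deriv (dDelta a m) (bracket x y) = dbr x y - dbr y x.
    case: x y => [b p r|p] [c q s|q]; rewrite /= ?linear0 ?subr0 ?sub0r //.
    - rewrite linearZ /= deriv_affine scaler0 subr0 /= -affine_jacobi.
      rewrite scalerA mulrC -scalerA -scalerBr; congr (_ *: _). rewrite scalerDr.
      rewrite !scaler_sumr -sumrN; congr (_ + _); apply: eq_bigr => d _.
        exact: swapZ.
      rewrite -scalerN -[- (fpsC _ *: _)]/(- bracket (Igen d q (m%:Z + s)) (Igen b p r)).
      by rewrite -bracketC /=; exact: swapZ.
    - by rewrite big1 ?scaler0 ?addr0 // => d _; rewrite scaler0.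
    - by rewrite big1 ?scaler0 ?oppr0 // => d _; rewrite scaler0.
    - by rewrite addr0.
  rewrite (lcommC (gen x)) [lcomm (gen x) _]lcommC !opprD !opprK.
  by rewrite addrACA.
exact/lie_relB.
Qed.

Lemma dpartial_vac_ideal u : vac_ideal u -> vac_ideal (deriv dpartial u).
Proof.
apply: deriv_vac_ideal => [x y|b p r r0]; last first.
  by rewrite -[dpartial _]mul1r; exact: vac_ideal_ann.
pose sh x := match x with Igen b p r => Igen b p.+1 r | kgen p => kgen p.+1 end.
have dE z : dpartial z = gen (sh z) by case: z.
have -> : deriv dpartial (bracket x y) = bracket (sh x) y + bracket x (sh y).
  case: x y => [b p r|p] [c q s|q]; rewrite /= ?linear0 ?addr0 //.
  rewrite linearZ /= deriv_affine /= addSn addnS -scalerDl; congr (_ *: _).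
  rewrite -rmorphD /=; congr fpsC; rewrite -opprD; congr (- _).
  rewrite -mulrDl -natrD; apply/eqP.
  rewrite eqr_div ?pnatr_eq0 -?lt0n ?fact_gt0 // -!natrM eqr_nat; apply/eqP.
  by rewrite !factS; ring.
rewrite !dE opprD addrACA; apply: lie_relD; exact: lie_rel_comm.
Qed.
End Vacuum.

Section VacuumModule.
Variable F : numClosedFieldType.
Local Notation S := (fps F).
Local Notation tens := (tens F).

Definition vac_pred : {pred tens} := fun u => `[< vac_ideal u >].

Lemma vac_predP u : reflect (vac_ideal u) (u \in vac_pred).
Proof. exact: asboolP. Qed.

Fact vac_pred_zmod_closed : zmod_closed vac_pred.
Proof.
split=> [|u v /vac_predP hu /vac_predP hv]; apply/vac_predP.
  exact: vac_ideal0.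
exact: vac_idealB.
Qed.
HB.instance Definition _ :=
  GRing.isZmodClosed.Build tens vac_pred vac_pred_zmod_closed.

Definition vmod : Type := Quotient.quot vac_pred.
HB.instance Definition _ := GRing.Zmodule.on vmod.

Definition state (u : tens) : vmod := \pi_(Quotient.quot vac_pred) u.
Definition rep (v : vmod) : tens := repr (v : Quotient.quot vac_pred).

Lemma stateK v : state (rep v) = v. Proof. exact: reprK. Qed.

Lemma state_eq u v : (state u = state v) <-> vac_ideal (u - v).
Proof.
split=> [/eqP|uv]; last apply/eqP.
  by rewrite /state -Quotient.idealrBE => /vac_predP.
by rewrite /state -Quotient.idealrBE; apply/vac_predP.
Qed.

Fact state_zmod : zmod_morphism state.
Proof. by move=> u v; exact: (raddfB \pi_(Quotient.quot vac_pred)). Qed.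
HB.instance Definition _ := GRing.isZmodMorphism.Build tens vmod state state_zmod.

Lemma state_eq0 u : (state u = 0) <-> vac_ideal u.
Proof. by rewrite -[0](raddf0 state) state_eq subr0. Qed.

Definition lift (phi : tens -> tens) (v : vmod) : vmod := state (phi (rep v)).

Lemma liftE (phi : {additive tens -> tens}) u :
  (forall w, vac_ideal w -> vac_ideal (phi w)) ->
  lift phi (state u) = state (phi u).
Proof.
move=> hphi; apply/state_eq; rewrite -raddfB; apply: hphi.
by apply/state_eq; rewrite stateK.
Qed.

Definition vscale (c : S) : vmod -> vmod := lift (fun u => c *: u).

Fact vscaleE c u : vscale c (state u) = state (c *: u).
Proof. by apply: (@liftE (GRing.scale c)) => w; exact: vac_idealZ. Qed.
Fact vscaleA a b v : vscale a (vscale b v) = vscale (a * b) v.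
Proof. by rewrite -[v]stateK !vscaleE scalerA. Qed.
Fact vscale1 : left_id 1 vscale.
Proof. by move=> v; rewrite -[v]stateK vscaleE scale1r. Qed.
Fact vscaleDr : right_distributive vscale +%R.
Proof.
by move=> c u v; rewrite -[u]stateK -[v]stateK -raddfD !vscaleE scalerDr raddfD.
Qed.
Fact vscaleDl v : {morph vscale^~ v : a b / a + b}.
Proof. by move=> a b; rewrite -[v]stateK !vscaleE scalerDl raddfD. Qed.
HB.instance Definition _ := GRing.Zmodule_isLmodule.Build S vmod
  vscaleA vscale1 vscaleDr vscaleDl.

Lemma stateZ c u : state (c *: u) = c *: state u.
Proof. by rewrite -vscaleE. Qed.

Fact state_linear : linear state.
Proof. by move=> c u v; rewrite raddfD /= stateZ. Qed.
HB.instance Definition _ := GRing.isLinear.Build S tens vmod *:%R state state_linear.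

Fact lift_is_linear (phi : {linear tens -> tens}) :
  (forall w, vac_ideal w -> vac_ideal (phi w)) -> linear (lift phi).
Proof.
move=> hphi c u v; rewrite -[u]stateK -[v]stateK -linearP !liftE //.
by rewrite -[RHS]linearP; congr state; exact: (linearP phi).
Qed.

Definition vac : vmod := state 1.
Definition lmult (x u : tens) : tens := x * u.
Fact lmult_is_linear x : linear (lmult x).
Proof. by move=> c u v; rewrite /lmult mulrDr scalerAr. Qed.
HB.instance Definition _ x :=
  GRing.isLinear.Build S tens tens *:%R (lmult x) (lmult_is_linear x).

Definition act (x : tens) : vmod -> vmod := lift (lmult x).

Lemma act_state x u : act x (state u) = state (x * u).
Proof. by apply: liftE => w; exact: vac_idealMl. Qed.

Fact act_is_linear x : linear (act x).
Proof. by apply: lift_is_linear => w; exact: vac_idealMl. Qed.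
HB.instance Definition _ x :=
  GRing.isLinear.Build S vmod vmod *:%R (act x) (act_is_linear x).

Lemma actM x y v : act (x * y) v = act x (act y v).
Proof. by rewrite -[v]stateK !act_state mulrA. Qed.

Lemma act_lin c x y v : act (c *: x + y) v = c *: act x v + act y v.
Proof. by rewrite -[v]stateK !act_state mulrDl -scalerAl linearP. Qed.

Lemma act_vac x : act x vac = state x.
Proof. by rewrite act_state mulr1. Qed.

Lemma act_commutator x y v :
  act (gen F x) (act (gen F y) v) - act (gen F y) (act (gen F x) v)
  = act (bracket F x y) v.
Proof.
rewrite -[v]stateK -!actM !act_state -!linearB -!mulrBl /=.
apply/state_eq; rewrite -mulrBl -[_ * _]mul1r mulrA.
exact: vac_ideal_comm.
Qed.

Lemma act_ann a p (r : int) : 0 <= r -> act (Iop F a p r) vac = 0.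
Proof.
by move=> r0; rewrite act_vac; apply/state_eq0; rewrite -[Iop _ _ _ _]mul1r;
  exact: vac_ideal_ann.
Qed.

Definition Delta (a : 'I_3) (m : nat) : vmod -> vmod := lift (deriv (dDelta F a m)).

Fact Delta_is_linear a m : linear (Delta a m).
Proof. by apply: lift_is_linear => w; exact: dDelta_vac_ideal. Qed.
HB.instance Definition _ a m :=
  GRing.isLinear.Build S vmod vmod *:%R (Delta a m) (Delta_is_linear a m).

Lemma Delta_state a m u : Delta a m (state u) = state (deriv (dDelta F a m) u).
Proof. by apply: liftE => w; exact: dDelta_vac_ideal. Qed.

Lemma Delta_vac a m : Delta a m vac = 0.
Proof. by rewrite Delta_state deriv1 linear0. Qed.

Lemma Delta_gen a m x v : Delta a m (act (gen F x) v)
  = act (dDelta F a m x) v + act (gen F x) (Delta a m v).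
Proof.
rewrite -[v]stateK !(act_state, Delta_state) derivM deriv_gen.
by rewrite linearD.
Qed.

Definition partial : vmod -> vmod := lift (deriv (@dpartial F)).

Fact partial_is_linear : linear partial.
Proof. by apply: lift_is_linear => w; exact: dpartial_vac_ideal. Qed.
HB.instance Definition _ :=
  GRing.isLinear.Build S vmod vmod *:%R partial partial_is_linear.

Lemma partial_state u : partial (state u) = state (deriv (@dpartial F) u).
Proof. by apply: liftE => w; exact: dpartial_vac_ideal. Qed.

Lemma partial_vac : partial vac = 0.
Proof. by rewrite partial_state deriv1 linear0. Qed.

Lemma partial_gen x v : partial (act (gen F x) v)
  = act (dpartial F x) v + act (gen F x) (partial v).
Proof.
rewrite -[v]stateK !(act_state, partial_state) derivM deriv_gen.
by rewrite linearD.
Qed.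

Definition twisted_partial (j : nat) (v : vmod) : vmod :=
  partial v - fpsC (j%:R / 2) *: act (kop F 0) v.

(** [Delta (hbar x)_m] for [x = \sum_a x^a B_a]; [Delta a m] stands for
    [Delta (hbar B_a)_m]. *)
Definition Delta_sl2 (B : 3.-tuple 'M[F]_2) (x : 'M[F]_2) (m : nat) (v : vmod) :
  vmod := \sum_(a < 3) fpsC (coord B a x) *: Delta a m v.

Definition wt1 (w : seq lgen) : int :=
  \sum_(x <- w) (if x is Igen _ _ m then - m else 0).
Definition wt2 (w : seq lgen) : nat :=
  (\sum_(x <- w) (match x with Igen _ p _ => p | kgen p => p end).+1)%N.
Definition nbI (w : seq lgen) : nat :=
  count (fun x => if x is Igen _ _ _ then true else false) w.

(** [V_{r,p}]: [wt1] and [wt2] are the two components of the weight, for which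
    [I^{a[p]}_{-r}] has weight [(r, p + 1)] and [k^{[p]}] weight [(0, p + 1)]. *)
Definition Vbi (r : int) (p : nat) (v : vmod) : Prop :=
  exists2 u : tens, forall w, tcoef w u != 0 -> wt1 w = r /\ wt2 w = p
                  & v = state u.

(** [Vtilde_r]: each monomial [hbar^j w] occurring in the state has
    [j + nbI w = r]. *)
Definition Vtilde (r : nat) (v : vmod) : Prop :=
  exists2 u : tens,
    forall w j, tcoef w u j != 0 ->
      [/\ wt1 w = r%:Z, wt2 w = r & (j + nbI w)%N = r]
  & v = state u.

Definition Vtilde_sl2 (r : nat) (v : vmod) : Prop :=
  Vtilde r v /\ forall a, Delta a 0 v = 0.

(** [v] and [v'] agree modulo [hbar^2 V_r]. *)
Definition eq_mod_hbar2 (r : nat) (v v' : vmod) : Prop :=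
  exists2 w, Vbi r%:Z r w & v - v' = hbar ^+ 2 *: w.

Definition tperm_tuple m (s : 'S_m) (i : m.-tuple 'I_3) : m.-tuple 'I_3 :=
  [tuple tnth i (s l) | l < m].

(** Weight one symmetrization of a family indexed by [m] Lie algebra indices. *)
Definition symmetrize (W : lmodType S) m (f : m.-tuple 'I_3 -> W)
    (i : m.-tuple 'I_3) : W :=
  fpsC (m`!%:R^-1) *: \sum_(s : 'S_m) f (tperm_tuple s i).

Definition tinv r : (r.*2).-tuple 'I_3 -> S :=
  @symmetrize S^o r.*2 (fun i =>
    \prod_(l < r) (nth ord0 i l.*2 == nth ord0 i l.*2.+1)%:R).

(** [I^{i_1}_{-1} ... I^{i_m}_{-1}] *)
Definition Iprod m (i : m.-tuple 'I_3) : tens :=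
  word F [seq Igen a 0 (-1) | a <- i].

Definition varsigma_coef (n : nat) : F :=
  n%:R * (2 * n%:R + 1) * (2 * n%:R - 2) / (2 * n%:R - 1).

(** For [n = 1] the truncated [(n - 2).*2] is [0], and the coefficient of the
    second term vanishes. *)
Definition varsigma (n : nat) : vmod :=
  \sum_(i : (n.*2).-tuple 'I_3) tinv i *: act (Iprod i) vac
  + (hbar * fpsC (varsigma_coef n)) *:
    \sum_(i : ((n - 2).*2).-tuple 'I_3) \sum_(a < 3) \sum_(b < 3) \sum_(c < 3)
      (tinv i * fpsC (fstr F a b c)) *:
        act (Iop F a 0 (-2) * Iop F b 1 (-1) * symmetrize (@Iprod _) (cons_tuple c i)) vac.

End VacuumModule.

(* Main.v *)
Require Import Defs.
From HB Require Import structures.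
From mathcomp Require Import all_boot all_order all_algebra all_fingroup.
From mathcomp Require Import finmap monalg.
From mathcomp Require Import reals.
From mathcomp Require Import complex.
From mathcomp Require Import ring zify.

Set Implicit Arguments.
Unset Strict Implicit.
Unset Printing Implicit Defensive.

Import Order.TTheory GRing.Theory Num.Theory.
Local Open Scope ring_scope.

(** Write [I] for the letters [Igen], and let [n] be the integer of the theorem.

    Everything rests on two tools. The symbol [chi] of a tensor is its value at
    [hbar = 0], a polynomial in the commuting values [e] of the letters. It is
    complete: a homogeneous tensor whose symbol vanishes is [hbar] times another
    one, up to the relations ([completeness]), because at [hbar = 0] letters commute
    and monomials are independent. Conversely states are bounded below by the
    functional [Phi], defined on words by a Wick formula ([wick]) and compatible with
    all the relations ([Phi_vac_ideal]). It takes values in power series, so a power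
    of [hbar] can be cancelled in it; its constant term is [chi], and its next
    coefficient sees one contraction. The formula is exact since letters with two
    derivatives are set to zero, which makes the Lie algebra two-step nilpotent
    and loses nothing for the words of the weights considered.

    Existence. The state is [varsigma] itself. It is exactly invariant, as a
    contraction of invariant tensors. Write [x], [y] and [z] for the values of the
    letters of mode [-1] without and with one derivative, and of the central letter,
    and [q = x . x]. The symbol of the leading term is [q ^ n]. A positive mode turns
    one letter into an annihilating one, which is then contracted once. The first
    coefficient of [Phi] is thus a second-order differential operator applied to
    [q ^ n], plus the contribution of the second term of [varsigma]; for the mode one
    it is a combination of [z x_a q ^ (n - 1)], [y_a q ^ (n - 1)] and
    [x_a (x . y) q ^ (n - 2)], and for higher modes it is zero. The twisted
    derivative of [x_a q ^ (n - 1)] has the same shape, and the stated coefficient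
    makes the two proportional ([chi_compensator]). Completeness
    then produces the remainder of order [hbar ^+ 3] ([varsigma_solution]).

    Uniqueness. Subtract from a solution the multiple of [varsigma] with the same
    symbol at a base point. The symbol of the difference is a polynomial in [x],
    invariant under rotations and zero at a non-isotropic vector. On a line through
    this vector it satisfies [q g' = d (q' / 2) g], hence it vanishes
    ([invariant_regular]), and the difference is [hbar] times a tensor of grade
    [2 n - 1]. By weights the symbol of that tensor is a sum of three blocks
    ([G_split]), which also involve the letters of mode [-2]. Two facts kill them: an
    invariant of odd degree vanishes, by the same differential equation started at
    an isotropic vector ([invariant_odd]), and a rotation about [x] moves only the
    remaining vectors. The block that pairs modes [-2] with derivatives may survive
    on invariance alone; it is killed by the equation of the first mode, whose
    twisted derivative is found to act on zero ([U_eq0], [mixed_block]). So a second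
    factor [hbar] comes out ([first_modes_rigid]). *)

(** * Power series and linear extension from words *)

Section Series.
Variable F : fieldType.
Implicit Types f : fps F.

Lemma coef_fps0 n : (0 : fps F) n = 0.
Proof. by rewrite -[0]/(fpsC 0) fpsCE; case: n. Qed.

Lemma coef_fpsCM c f n : (fpsC c * f) n = c * f n.
Proof. exact: fpsCM. Qed.

Lemma coef_hbarM0 f : (hbar * f) 0%N = 0.
Proof. by rewrite coef_fpsM big_ord1 hbarE mul0r. Qed.

Lemma coef_hbarMS f n : (hbar * f) n.+1 = f n.
Proof.
rewrite coef_fpsM !big_ord_recl big1 => [|i _]; last by rewrite hbarE mul0r.
by rewrite !hbarE mul0r add0r mul1r addr0 subSS subn0.
Qed.

Lemma coef_fpsM0 f g : (f * g) 0%N = f 0%N * g 0%N.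
Proof. by rewrite coef_fpsM big_ord1. Qed.

Lemma coef_hbarX k n : (hbar ^+ k : fps F) n = (n == k)%:R.
Proof.
elim: k n => [|k IH] [|n]; rewrite ?expr0 ?exprS ?coef_hbarM0 ?coef_hbarMS ?IH //.
all: by rewrite -[1]/(fpsC 1) fpsCE.
Qed.

Lemma hbar_inj : injective ( *%R (hbar : fps F)).
Proof.
by move=> f g fg; apply/boolp.funext => n; rewrite -!(coef_hbarMS _ n) fg.
Qed.

Lemma coef_fps_sum (T : Type) (r : seq T) (P : pred T) (f : T -> fps F) n :
  (\sum_(i <- r | P i) f i) n = \sum_(i <- r | P i) f i n.
Proof.
by apply: (big_morph (fun g : fps F => g n)) => [g h|]; rewrite (coef_fpsD, coef_fps0).
Qed.

Definition cst_coef (f : fps F) : F := f 0%N.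
Fact cst_coef_zmod : zmod_morphism cst_coef.
Proof. by move=> f g; rewrite /cst_coef coef_fpsD coef_fpsN. Qed.
HB.instance Definition _ :=
  GRing.isZmodMorphism.Build (fps F) F cst_coef cst_coef_zmod.
Fact cst_coef_monoid : monoid_morphism cst_coef.
Proof.
by split=> [|f g]; rewrite /cst_coef ?coef_fpsM0 // -[1]/(fpsC 1) fpsCE.
Qed.
HB.instance Definition _ :=
  GRing.isMonoidMorphism.Build (fps F) F cst_coef cst_coef_monoid.
End Series.

Section Extension.
Variables (F : fieldType) (K : comNzRingType) (j : {rmorphism fps F -> K}).
Variable f : seq lgen -> K.

(** Every functional below is prescribed on words. The coefficients go through
    a ring morphism, so that the same extension serves for series and for their
    constant terms. *)
Definition lin (u : tens F) : K := \sum_(w <- tsupp u) j (tcoef w u) * f w.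

Fact lin_semilinear c u v : lin (c *: u + v) = j c * lin u + lin v.
Proof.
rewrite /lin /tsupp !big_map /=.
pose m (x : tens F) := msupp (x : {malg (fps F)[{fmonom lgen}]}).
pose D := (m u `|` m v `|` m (c *: u + v)%R)%fset.
have W (x : tens F) : (m x `<=` D)%fset ->
    \sum_(w <- m x) j (tcoef w x) * f w = \sum_(w <- D) j (tcoef w x) * f w.
  move=> le; rewrite [LHS](big_fset_incl _ le) => //= -[w] _ /mcoeff_outdom.
  by rewrite -[mcoeff _ _]/(tcoef w x) => ->; rewrite rmorph0 mul0r.
rewrite !W; first last.
- exact: fsubsetUr.
- by rewrite /D; apply: fsubset_trans (fsubsetUl _ _); apply: fsubsetUl.
- by rewrite /D; apply: fsubset_trans (fsubsetUl _ _); apply: fsubsetUr.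
rewrite mulr_sumr -big_split /=; apply: eq_bigr => w _.
by rewrite linearP /= rmorphD rmorphM mulrDl mulrA.
Qed.

Fact lin_zmod : zmod_morphism lin.
Proof.
by move=> u v; rewrite addrC -scaleN1r lin_semilinear rmorphN1 mulN1r addrC.
Qed.
HB.instance Definition _ := GRing.isZmodMorphism.Build (tens F) K lin lin_zmod.

Lemma linZ c u : lin (c *: u) = j c * lin u.
Proof. by rewrite -[_ *: _]addr0 lin_semilinear raddf0 addr0. Qed.

Lemma lin_word w : lin (word F w) = f w.
Proof. by rewrite /lin tsupp_word big_seq1 tcoef_word eqxx rmorph1 mul1r. Qed.
End Extension.

(** * Symbols and their directional derivatives *)

Section Symbol.
Variables (F : numClosedFieldType) (A : comNzRingType) (iota : {rmorphism F -> A}).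
Implicit Types (e h : lgen -> A) (u v : tens F) (w : seq lgen).

(** The symbol: at [hbar = 0] the generators commute, and [e] assigns values to
    them. Values in [{poly F}] are needed to move along lines. *)
Definition chi e : tens F -> A :=
  lin (iota \o @cst_coef F) (fun w => \prod_(x <- w) e x).

HB.instance Definition _ e := GRing.Additive.on (chi e).

Lemma chiZ e c u : chi e (c *: u) = iota (c 0%N) * chi e u.
Proof. exact: linZ. Qed.

Lemma chi_word e w : chi e (word F w) = \prod_(x <- w) e x.
Proof. exact: lin_word. Qed.

Lemma chi_gen e x : chi e (gen F x) = e x.
Proof. by rewrite chi_word big_seq1. Qed.

Fact chi_monoid e : monoid_morphism (chi e).
Proof.
split=> [|u v]; first by rewrite -word_nil chi_word big_nil.
elim/tens_ind: u => [|c w u IH]; first by rewrite !(raddf0, mul0r).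
rewrite mulrDl !raddfD /= IH mulrDl; congr (_ + _).
rewrite -scalerAl !chiZ -mulrA; congr (_ * _).
elim/tens_ind: v {IH} => [|c' w' v IH]; first by rewrite !(raddf0, mulr0).
rewrite mulrDr !raddfD /= IH mulrDr; congr (_ + _).
by rewrite -scalerAr !chiZ -word_cat !chi_word big_cat mulrCA.
Qed.
HB.instance Definition _ e := GRing.isMonoidMorphism.Build (tens F) A (chi e) (chi_monoid e).

Fixpoint dd_word e h w : A :=
  if w is x :: w' then h x * (\prod_(y <- w') e y) + e x * dd_word e h w' else 0.

(** The derivative of the symbol at [e] in the direction [h], written on words
    so that no polynomial ring in infinitely many variables is needed. *)
Definition dd e h : tens F -> A := lin (iota \o @cst_coef F) (dd_word e h).

HB.instance Definition _ e h := GRing.Additive.on (dd e h).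

Lemma ddZ e h c u : dd e h (c *: u) = iota (c 0%N) * dd e h u.
Proof. exact: linZ. Qed.

Lemma dd_wordE e h w : dd e h (word F w) = dd_word e h w.
Proof. exact: lin_word. Qed.

Lemma dd_gen e h x : dd e h (gen F x) = h x.
Proof. by rewrite dd_wordE /= big_nil mulr1 mulr0 addr0. Qed.

Lemma dd_word_cat e h s t : dd_word e h (s ++ t)
  = dd_word e h s * (\prod_(y <- t) e y) + (\prod_(y <- s) e y) * dd_word e h t.
Proof.
elim: s => [|x s IH] /=; first by rewrite mul0r add0r big_nil mul1r.
by rewrite IH big_cat big_cons /=; ring.
Qed.

Lemma ddM e h u v : dd e h (u * v) = dd e h u * chi e v + chi e u * dd e h v.
Proof.
elim/tens_ind: u => [|c w u IH]; first by rewrite !(raddf0, mul0r, addr0).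
have -> : (c *: word F w + u) * v = c *: (word F w * v) + u * v.
  by rewrite mulrDl scalerAl.
rewrite !raddfD /= IH !ddZ !chiZ.
suff -> : dd e h (word F w * v)
    = dd e h (word F w) * chi e v + chi e (word F w) * dd e h v by ring.
elim/tens_ind: v {IH} => [|c' w' v IH]; first by rewrite !(raddf0, mulr0, addr0).
have -> : word F w * (c' *: word F w' + v) = c' *: word F (w ++ w') + word F w * v.
  by rewrite mulrDr -scalerAr word_cat.
rewrite !raddfD /= IH !ddZ !chiZ !dd_wordE !chi_word dd_word_cat.
by ring.
Qed.

(** A derivation of the tensor algebra acts on symbols as a vector field. *)
Lemma chi_deriv e d u : chi e (Defs.deriv d u) = dd e (fun x => chi e (d x)) u.
Proof.
elim/tens_ind: u => [|c w u IH]; first by rewrite !raddf0.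
rewrite !raddfD /= IH linearZ /= chiZ ddZ derivW dd_wordE; congr (_ * _ + _).
elim: w => [|x w IHw] /=; first by rewrite raddf0.
by rewrite raddfD /= !rmorphM /= IHw chi_word chi_gen.
Qed.

Lemma eq_chi e e' u : e =1 e' -> chi e u = chi e' u.
Proof.
by move=> ee'; apply: eq_bigr => w _; congr (_ * _); apply: eq_bigr => x _.
Qed.

Lemma eq_dd_word e e' h h' w : {in w, e =1 e'} -> {in w, h =1 h'} ->
  dd_word e h w = dd_word e' h' w.
Proof.
elim: w => //= x w IH ee' hh'.
have sub y : y \in w -> y \in x :: w by rewrite inE orbC => ->.
rewrite IH => [||y yw]; [|by move=> y yw; apply: ee'; exact: sub|by apply: hh'; exact: sub].
rewrite ee' ?hh' ?mem_head //; congr (_ * _ + _).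
by rewrite !big_seq; apply: eq_bigr => y /sub/ee'.
Qed.

Lemma eq_dd e e' h h' u : e =1 e' -> h =1 h' -> dd e h u = dd e' h' u.
Proof.
move=> ee' hh'; apply: eq_bigr => w _; congr (_ * _).
by apply: eq_dd_word => x _.
Qed.

Lemma dd_linear e c h h' u :
  dd e (fun x => c * h x + h' x) u = c * dd e h u + dd e h' u.
Proof.
elim/tens_ind: u => [|k w u IH]; first by rewrite !raddf0 mulr0 addr0.
rewrite !raddfD /= IH !ddZ !dd_wordE.
suff -> : dd_word e (fun x => c * h x + h' x) w
  = c * dd_word e h w + dd_word e h' w by ring.
by elim: w => [|x w IHw] /=; rewrite ?mulr0 ?addr0 // IHw; ring.
Qed.

Lemma dd_0 e u : dd e (fun=> 0) u = 0.
Proof.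
have := dd_linear e 1 (fun=> 0) (fun=> 0) u.
have -> : dd e (fun x : lgen => 1 * 0 + 0) u = dd e (fun=> 0) u.
  by apply: eq_dd => // x; rewrite mulr0 addr0.
by rewrite mul1r => /eqP; rewrite -subr_eq subrr => /eqP.
Qed.

Lemma dd_sum e (I : finType) (c : I -> A) (h : I -> lgen -> A) u :
  dd e (fun x => \sum_i c i * h i x) u = \sum_i c i * dd e (h i) u.
Proof.
elim: (index_enum I) => [|i s IH].
  by rewrite big_nil -[RHS](dd_0 e u); apply: eq_dd => // x; rewrite big_nil.
rewrite big_cons -IH -dd_linear; apply: eq_dd => // x.
by rewrite big_cons.
Qed.
End Symbol.

Section SymbolPoly.
Variables (F : numClosedFieldType) (A : comNzRingType) (iota : {rmorphism F -> A}).
Local Notation iotaP := (polyC \o iota).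

(** The chain rule along a polynomial path of points. *)
Lemma chi_deriv_poly (e : lgen -> {poly A}) u :
  (chi iotaP e u)^`() = dd iotaP e (fun x => (e x)^`()) u.
Proof.
elim/tens_ind: u => [|c w u IH]; first by rewrite !raddf0.
rewrite !raddfD /= IH chiZ ddZ derivM derivC mul0r add0r chi_word dd_wordE.
congr (_ * _ + _); elim: w => [|x w IHw] /=; first by rewrite big_nil derivC.
by rewrite big_cons derivM IHw.
Qed.

Lemma horner_chi (e : lgen -> {poly A}) u t :
  (chi iotaP e u).[t] = chi iota (fun x => (e x).[t]) u.
Proof.
elim/tens_ind: u => [|c w u IH]; first by rewrite !raddf0 horner0.
rewrite !raddfD /= hornerD IH !chiZ !chi_word hornerM hornerC horner_prod.
by [].
Qed.

Lemma horner_dd (e h : lgen -> {poly A}) u t :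
  (dd iotaP e h u).[t] = dd iota (fun x => (e x).[t]) (fun x => (h x).[t]) u.
Proof.
elim/tens_ind: u => [|c w u IH]; first by rewrite !raddf0 horner0.
rewrite !raddfD /= hornerD IH !ddZ !dd_wordE hornerM hornerC; congr (_ * _ + _).
by elim: w => [|x w IHw] /=; rewrite ?horner0 // hornerD !hornerM IHw horner_prod.
Qed.
End SymbolPoly.

(** * Linear independence of monomials as functions *)

Section Separation.

Lemma poly_fun0 (F : numDomainType) (p : {poly F}) : (forall t, p.[t] = 0) -> p = 0.
Proof.
move=> p0; apply/eqP; apply: contraT => pn0.
have u : uniq [seq i%:R : F | i <- iota 0 (size p)].
  by rewrite map_inj_uniq ?iota_uniq // => i j /eqP; rewrite eqr_nat => /eqP.
have := max_poly_roots pn0 _ u.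
rewrite size_map size_iota ltnn => -> //.
by apply/allP => t _; apply/rootP.
Qed.

Variables (F : numDomainType) (T : eqType) (I : Type).
Variables (c : I -> F) (w : I -> seq T).

(** Two words define the same function exactly when they are permutations of
    each other. The letters are separated one at a time: putting [e x = t] turns
    the vanishing sum into a polynomial in [t], whose coefficient at the
    multiplicity of [x] in [w0] vanishes because the field is infinite. *)
Lemma monomial_separation (ws : seq I) :
  (forall e : T -> F, \sum_(i <- ws) c i * \prod_(x <- w i) e x = 0) ->
  forall w0, \sum_(i <- ws | perm_eq (w i) w0) c i = 0.
Proof.
move=> h w0.
pose same (M : seq T) i := all (fun x => count_mem x (w i) == count_mem x w0) M.
have claim M (e : T -> F) :
    \sum_(i <- ws | same M i) c i * \prod_(x <- w i | x \notin M) e x = 0.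
  elim: M e => [|x M IH] e.
    by rewrite -[RHS](h e); apply: eq_bigr => i _; congr (_ * _); apply: eq_bigl.
  have [xM|xM] := boolP (x \in M).
    rewrite -[RHS](IH e); apply: eq_big => i; first last.
      move=> _; congr (_ * _); apply: eq_bigl => y.
      by rewrite inE; case: eqP => // ->; rewrite xM.
    rewrite /same /=; case sM: (all _ M); rewrite ?andbF // andbT.
    by move/allP: sM => /(_ x xM).
  pose p : {poly F} := \sum_(i <- ws | same M i)
    (c i * \prod_(y <- w i | y \notin x :: M) e y) *: 'X^(count_mem x (w i)).
  have p0 : p = 0.
    apply: poly_fun0 => t; rewrite -[RHS](IH (fun y => if y == x then t else e y)).
    rewrite horner_sum; apply: eq_bigr => i _; rewrite hornerZ hornerXn -mulrA.
    congr (_ * _); rewrite [RHS](bigID (fun y => y == x)) /= mulrC; congr (_ * _).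
      transitivity (\prod_(y <- w i | y == x) t).
        by rewrite big_const_seq iter_mulr_1.
      apply: eq_big => [y|y /eqP->]; last by rewrite eqxx.
      by case: eqP => [->|]; rewrite ?andbF ?andbT ?xM.
    apply: eq_big => y; first by rewrite inE negb_or andbC.
    by rewrite inE negb_or => /andP[/negbTE-> _].
  have := congr1 (fun q : {poly F} => q`_(count_mem x w0)) p0.
  rewrite coef0 coef_sum => p_coef; rewrite -[RHS]p_coef big_mkcond [RHS]big_mkcond /=.
  apply: eq_bigr => i _; rewrite coefZ coefXn [in LHS]/same /= -/(same M i).
  rewrite [_ == count_mem x (w i)]eq_sym.
  by case: (same M i); case: (_ == _); rewrite ?mulr1 ?mulr0.
(* All letters occurring anywhere: no product is left, and equal multiplicities
   on them mean equal words up to permutation. *)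
pose L := undup (w0 ++ flatten [seq w i | i <- ws]).
have subL : all (fun i => all [in L] (w i)) ws.
  have : {subset flatten [seq w i | i <- ws] <= L}.
    by move=> y yw; rewrite mem_undup mem_cat yw orbT.
  elim: (ws) => //= i s IH sub; apply/andP; split.
    by apply/allP => y yi; apply: sub; rewrite mem_cat yi.
  by apply: IH => y ys; apply: sub; rewrite mem_cat ys orbT.
rewrite -[RHS](claim L (fun=> 1)).
elim: (ws) subL => [|i s IH] /=; first by rewrite !big_nil.
case/andP=> hi /IH e; rewrite !big_cons e.
have -> : perm_eq (w i) w0 = same L i.
  apply/idP/allP => [/seq.permP pe y _|hL]; first by apply/eqP/pe.
  apply/allP => y; rewrite mem_cat => /orP[yi|y0]; apply: hL.
    by move/allP: hi; apply.
  by rewrite mem_undup mem_cat y0.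
by rewrite big1_eq mulr1.
Qed.
End Separation.

(** * Homogeneous tensors, and reordering up to hbar *)

Section Homogeneous.
Variable F : numClosedFieldType.
Local Notation tens := (tens F).
Implicit Types (u v : tens) (w s t : seq lgen) (x y : lgen).

(** [r] and [p] are the two weights and [g] the gradation in which [hbar] and
    every [I] count for one; at [g = r = p] this is the condition in [Vtilde]. *)
Definition homog (r : int) (p g : nat) (u : tens) : Prop :=
  forall w j, tcoef w u j != 0 -> [/\ wt1 w = r, wt2 w = p & (j + nbI w)%N = g].

Lemma wt1_cat s t : wt1 (s ++ t) = wt1 s + wt1 t.
Proof. by rewrite /wt1 big_cat. Qed.
Lemma wt2_cat s t : wt2 (s ++ t) = (wt2 s + wt2 t)%N.
Proof. by rewrite /wt2 big_cat. Qed.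
Lemma nbI_cat s t : nbI (s ++ t) = (nbI s + nbI t)%N.
Proof. exact: count_cat. Qed.
Lemma wt1_cons x s : wt1 (x :: s) = wt1 [:: x] + wt1 s.
Proof. by rewrite -wt1_cat. Qed.
Lemma wt2_cons x s : wt2 (x :: s) = (wt2 [:: x] + wt2 s)%N.
Proof. by rewrite -wt2_cat. Qed.
Lemma nbI_cons x s : nbI (x :: s) = (nbI [:: x] + nbI s)%N.
Proof. by rewrite -nbI_cat. Qed.

Lemma wt1_gen x : wt1 [:: x] = if x is Igen _ _ m then - m else 0.
Proof. by rewrite /wt1 big_seq1. Qed.
Lemma wt2_gen x : wt2 [:: x] = (match x with Igen _ p _ => p | kgen p => p end).+1.
Proof. by rewrite /wt2 big_seq1. Qed.

Lemma wt1_perm s t : perm_eq s t -> wt1 s = wt1 t.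
Proof. exact: perm_big. Qed.
Lemma wt2_perm s t : perm_eq s t -> wt2 s = wt2 t.
Proof. exact: perm_big. Qed.
Lemma nbI_perm s t : perm_eq s t -> nbI s = nbI t.
Proof. by move/seq.permP; apply. Qed.

Lemma homog0 r p g : homog r p g 0.
Proof. by move=> w j; rewrite raddf0 coef_fps0 eqxx. Qed.

Lemma homogD r p g u v : homog r p g u -> homog r p g v -> homog r p g (u + v).
Proof.
move=> hu hv w j; rewrite raddfD /= coef_fpsD => /eqP nz.
have [u0|] := eqVneq (tcoef w u j) 0; last exact: hu.
by apply: hv; apply/eqP => v0; apply: nz; rewrite u0 v0 addr0.
Qed.

Lemma homogZ r p g c u : homog r p g u -> homog r p g (fpsC c *: u).
Proof.
move=> hu w j; rewrite linearZ /= coef_fpsCM => nz; apply: hu.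
by apply: contraNneq nz => ->; rewrite mulr0.
Qed.

Lemma homogN r p g u : homog r p g u -> homog r p g (- u).
Proof. by move=> hu; rewrite -scaleN1r -(rmorphN1 (@fpsC F)); apply: homogZ. Qed.

Lemma homogB r p g u v : homog r p g u -> homog r p g v -> homog r p g (u - v).
Proof. by move=> hu hv; apply: homogD => //; apply: homogN. Qed.

Lemma homog_sum (I : Type) (s : seq I) (P : pred I) f r p g :
  (forall i, P i -> homog r p g (f i)) -> homog r p g (\sum_(i <- s | P i) f i).
Proof. by move=> h; elim/big_ind: _ => //; [exact: homog0|exact: homogD]. Qed.

Lemma homog_hbar r p g u : homog r p g u -> homog r p g.+1 (hbar *: u).
Proof.
move=> hu w [|j]; rewrite linearZ /= ?coef_hbarM0 ?eqxx // coef_hbarMS.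
by case/hu => -> -> <-.
Qed.

Lemma homog_word w : homog (wt1 w) (wt2 w) (nbI w) (word F w).
Proof.
move=> s j; rewrite tcoef_word; case: (w =P s) => [<-|_]; last by rewrite mulr0n coef_fps0 eqxx.
by case: j => // j; rewrite -[1%:R]/(1 : fps F) -[1]/(fpsC 1) fpsCE eqxx.
Qed.

(** In a homogeneous tensor the coefficient of a word is a single power of
    [hbar], whose exponent is forced by the number of [I] in the word. *)
Lemma homog_ind r p g (P : tens -> Prop) :
  P 0 -> (forall u v, P u -> P v -> P (u + v)) ->
  (forall c w, wt1 w = r -> wt2 w = p -> (nbI w <= g)%N ->
     P ((fpsC c * hbar ^+ (g - nbI w)) *: word F w)) ->
  forall u, homog r p g u -> P u.
Proof.
move=> P0 PD Pw u hu; rewrite [u]tensE; elim/big_ind: _ => // w _.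
have [none|/boolp.existsNP[j /eqP nz]] := boolp.pselect (forall j, tcoef w u j = 0).
  suff -> : tcoef w u = 0 by rewrite scale0r.
  by apply/boolp.funext => j; rewrite coef_fps0.
have [w1 w2 wg] := hu _ _ nz.
have -> : tcoef w u = fpsC (tcoef w u (g - nbI w)%N) * hbar ^+ (g - nbI w).
  apply/boolp.funext => k; rewrite coef_fpsCM coef_hbarX.
  case: eqP => [->|kg]; first by rewrite mulr1.
  rewrite mulr0; apply/eqP; apply: contraT => /hu[_ _ kg'].
  by case: kg; rewrite -kg' addnK.
by apply: Pw => //; rewrite -wg leq_addl.
Qed.

Lemma homogM r p g r' p' g' u v :
  homog r p g u -> homog r' p' g' v -> homog (r + r') (p + p') (g + g') (u * v).
Proof.
move=> hu hv; elim/homog_ind: u / hu => [|u1 u2 h1 h2|c w w1 w2 wg].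
- by rewrite mul0r; exact: homog0.
- by rewrite mulrDl; exact: homogD.
elim/homog_ind: v / hv => [|v1 v2 h1 h2|c' w' w1' w2' wg'].
- by rewrite mulr0; exact: homog0.
- by rewrite mulrDr; exact: homogD.
rewrite -scalerAl -scalerAr scalerA -word_cat -mulrA -scalerA.
apply: homogZ; rewrite mulrCA -scalerA; apply: homogZ; rewrite -exprD.
have -> : (g + g' = (g - nbI w + (g' - nbI w')) + nbI (w ++ w'))%N.
  by rewrite nbI_cat; lia.
rewrite -w1 -w1' -w2 -w2' -wt1_cat -wt2_cat.
elim: (g - nbI w + (g' - nbI w'))%N => [|n IH]; first by rewrite expr0 scale1r; exact: homog_word.
by rewrite exprS -scalerA; apply: homog_hbar.
Qed.

Lemma homog1 : homog 0 0 0 1.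
Proof.
by have := @homog_word [::]; rewrite word_nil /wt1 /wt2 !big_nil.
Qed.

Lemma homog_Iop a p m : homog (- m) p.+1 1 (Iop F a p m).
Proof. by have := @homog_word [:: Igen a p m]; rewrite wt1_gen wt2_gen. Qed.
Lemma homog_kop p : homog 0 p.+1 0 (kop F p).
Proof. by have := @homog_word [:: kgen p]; rewrite wt1_gen wt2_gen. Qed.

Lemma homog_deriv d (r' : int) (p' : nat) :
  (forall x, homog (wt1 [:: x] - r') (wt2 [:: x] + p') (nbI [:: x]) (d x)) ->
  forall r p g u, homog r p g u -> homog (r - r') (p + p') g (Defs.deriv d u).
Proof.
move=> hd r p g u; elim/homog_ind => [|u1 u2 h1 h2|c w w1 w2 wg].
- by rewrite raddf0; exact: homog0.
- by rewrite raddfD; exact: homogD.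
rewrite linearZ /= derivW -scalerA; apply: homogZ.
have -> : g = (g - nbI w + nbI w)%N by rewrite subnK.
have hw : homog (r - r') (p + p') (nbI w) (deriv_word d w).
  rewrite -w1 -w2; elim: w {w1 w2 wg} => [|x w IH]; first exact: homog0.
  rewrite wt1_cons wt2_cons nbI_cons; apply: homogD.
    by rewrite addrAC addnAC; apply: homogM => //; exact: homog_word.
  by rewrite -addrA -addnA; apply: homogM => //; exact: homog_word.
rewrite addnK; elim: (g - nbI w)%N => [|n IH]; first by rewrite expr0 scale1r.
by rewrite exprS -scalerA; apply: homog_hbar.
Qed.

Lemma homog_Vbi r p g u : homog r p g u -> Vbi r p (state u).
Proof.
move=> hu; exists u => // w /eqP nz.
have /boolp.existsNP[j /eqP/hu[]//] : ~ (forall j, tcoef w u j = 0).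
by move=> z; apply: nz; apply/boolp.funext => j; rewrite coef_fps0.
Qed.

(** The quotient by [hbar] lowers the grade by one and keeps both weights; it
    is this bookkeeping that bounds the words which can occur at first order. *)
Definition small r p g (u : tens) :=
  exists2 u', homog r p g u' & state u = hbar *: state u'.

Lemma small_state r p g u v : state u = state v -> small r p g v -> small r p g u.
Proof. by move=> uv [u' hu' e]; exists u' => //; rewrite uv. Qed.

Lemma small0 r p g : small r p g 0.
Proof. by exists 0; [exact: homog0|rewrite !raddf0]. Qed.

Lemma smallD r p g u v : small r p g u -> small r p g v -> small r p g (u + v).
Proof.
move=> [u' hu' eu] [v' hv' ev]; exists (u' + v'); first exact: homogD.
by rewrite !raddfD /= eu ev.
Qed.

Lemma smallZ r p g c u : small r p g u -> small r p g (fpsC c *: u).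
Proof.
move=> [u' hu' eu]; exists (fpsC c *: u'); first exact: homogZ.
by rewrite !linearZ /= eu !scalerA mulrC.
Qed.

Lemma small_hbar r p g u : homog r p g u -> small r p g (hbar *: u).
Proof. by move=> hu; exists u => //; rewrite linearZ. Qed.

Lemma small_sum (I : eqType) (s : seq I) (P : pred I) f r p g :
  (forall i, i \in s -> P i -> small r p g (f i)) -> small r p g (\sum_(i <- s | P i) f i).
Proof.
by move=> h; rewrite big_seq_cond; elim/big_ind: _ => [|u v|i /andP[]];
  [exact: small0|exact: smallD|exact: h].
Qed.

(** A bracket preserves both weights. It trades two [I] for [hbar] and one [I],
    or for [hbar ^+ 2] and a central letter, so the grade is preserved too. *)
Lemma small_swap s x y t g : nbI (s ++ [:: x, y & t]) = g.+1 ->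
  small (wt1 (s ++ [:: x, y & t])) (wt2 (s ++ [:: x, y & t])) g
    (word F (s ++ [:: x, y & t]) - word F (s ++ [:: y, x & t])).
Proof.
move=> hg; apply: (@small_state _ _ _ _ (word F s * bracket F x y * word F t)).
  apply/state_eq; rewrite !word_cat !(word_cons F x) !(word_cons F y) !(word_cons F x) !mulrA -!mulrBl.
  have -> : word F s * gen F x * gen F y - word F s * gen F y * gen F x
      - word F s * bracket F x y
    = word F s * (gen F x * gen F y - gen F y * gen F x - bracket F x y).
    by rewrite !mulrBr !mulrA.
  exact: vac_ideal_comm.
case: x y hg => [a p m|p] [b q r|q] hg; rewrite /= ?mulr0 ?mul0r; try exact: small0.
rewrite -scalerAr -scalerAl; apply: smallZ.
have -> : affine F a m b r (p + q).+1 = hbar *: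
    (\sum_c fpsC (fstr F a b c) *: Iop F c (p + q).+1 (m + r)
     - hbar *: (fpsC (r%:~R * (a == b)%:R * (m + r == 0)%:R) *: kop F (p + q).+1)).
  by rewrite /affine scalerBr !scalerA expr2 mulrA.
rewrite -scalerAr -scalerAl; apply: small_hbar.
rewrite !wt1_cat !(wt1_cons _ (_ :: _)) !(wt1_cons _ t) !wt1_gen.
rewrite !wt2_cat !(wt2_cons _ (_ :: _)) !(wt2_cons _ t) !wt2_gen.
have -> : wt1 s + (- m + (- r + wt1 t)) = (wt1 s + - (m + r)) + wt1 t by ring.
have -> : (wt2 s + (p.+1 + (q.+1 + wt2 t)) = (wt2 s + (p + q).+2) + wt2 t)%N by lia.
have -> : (g = (nbI s + 1) + nbI t)%N.
  by move: hg; rewrite !nbI_cat !(nbI_cons _ (_ :: _)) !(nbI_cons _ t) /nbI /=; lia.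
apply: homogM; last exact: homog_word.
apply: homogM; first exact: homog_word.
apply: homogB.
  by apply: homog_sum => c _; apply: homogZ; exact: homog_Iop.
apply: homog_hbar; have [->|_] := eqVneq (m + r) 0.
  by rewrite oppr0; apply: homogZ; exact: homog_kop.
by rewrite mulr0 rmorph0 scale0r; exact: homog0.
Qed.

(** The permutation is built by moving one letter at a time past its
    neighbours; [s] is the prefix that has already been put in place. *)
Lemma small_perm s w w' g : perm_eq w w' -> nbI (s ++ w) = g.+1 ->
  small (wt1 (s ++ w)) (wt2 (s ++ w)) g (word F (s ++ w) - word F (s ++ w')).
Proof.
have trans w1 w2 w3 r p : small r p g (word F w1 - word F w2) ->
    small r p g (word F w2 - word F w3) -> small r p g (word F w1 - word F w3).
  by move=> h h'; have := smallD h h'; rewrite addrA subrK.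
have mv (x : lgen) t1 t2 s' : nbI (s' ++ x :: t1 ++ t2) = g.+1 ->
    small (wt1 (s' ++ x :: t1 ++ t2)) (wt2 (s' ++ x :: t1 ++ t2)) g
      (word F (s' ++ x :: t1 ++ t2) - word F (s' ++ t1 ++ x :: t2)).
  elim: t1 s' => [|y t1 IH] s' hs /=; first by rewrite subrr; exact: small0.
  apply: (trans _ (s' ++ y :: x :: t1 ++ t2)); first exact: small_swap.
  have pe : perm_eq (s' ++ x :: (y :: t1) ++ t2) (rcons s' y ++ x :: t1 ++ t2).
    by rewrite cat_rcons perm_cat2l (perm_catCA [:: x] [:: y]).
  rewrite (wt1_perm pe) (wt2_perm pe).
  have := IH (rcons s' y); rewrite -(nbI_perm pe) !cat_rcons; exact.
elim: w w' s => [|x w IH] w' s pe hg.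
  by move: pe; rewrite perm_sym => /perm_nilP->; rewrite subrr; exact: small0.
have xw' : x \in w' by rewrite -(perm_mem pe) mem_head.
case/splitPr: xw' pe => t1 t2 pe.
have pe' : perm_eq w (t1 ++ t2).
  by rewrite -(perm_cons x) (perm_trans pe) // perm_sym -cat1s perm_catCA.
apply: (trans _ (s ++ x :: t1 ++ t2)).
  by have := IH _ (rcons s x) pe'; rewrite !cat_rcons; apply.
have pe2 : perm_eq (s ++ x :: w) (s ++ x :: t1 ++ t2) by rewrite perm_cat2l perm_cons.
rewrite (wt1_perm pe2) (wt2_perm pe2); apply: mv.
by rewrite -(nbI_perm pe2).
Qed.
End Homogeneous.

(** * Symbols detect divisibility by hbar *)

Section Completeness.
Variable F : numClosedFieldType.
Local Notation tens := (tens F).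
Implicit Types (u v : tens) (w s t : seq lgen) (x y : lgen).

(** The letters that can occur, at order zero in [hbar], in normally ordered
    words of the weights of the theorem. *)
Definition normal_gen x :=
  match x with Igen _ p r => (r < 0) && (p <= 1)%N | kgen p => p == 0%N end.

(** Killing the letters with two derivatives makes the Lie algebra two-step
    nilpotent, which is what gives the Wick functional its closed form. *)
Definition admissible (A : nzRingType) (e : lgen -> A) :=
  forall x, ~~ normal_gen x -> e x = 0.

Lemma homogE r p g u : homog r p g u -> exists2 s : seq (F * seq lgen),
  all (fun cw => [&& wt1 cw.2 == r, wt2 cw.2 == p & (nbI cw.2 <= g)%N]) s
  & u = \sum_(cw <- s) (fpsC cw.1 * hbar ^+ (g - nbI cw.2)) *: word F cw.2.
Proof.
elim/homog_ind => [|u1 u2 [s1 h1 ->] [s2 h2 ->]|c w w1 w2 wg].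
- by exists [::]; rewrite ?big_nil.
- by exists (s1 ++ s2); rewrite ?all_cat ?h1 // big_cat.
- by exists [:: (c, w)]; rewrite ?big_seq1 //= w1 w2 wg !eqxx.
Qed.

Lemma nbI_gen x : nbI [:: x] = if x is Igen _ _ _ then 1%N else 0%N.
Proof. by case: x. Qed.

Lemma leq_nbI_wt2 w : (nbI w <= wt2 w)%N.
Proof.
by elim: w => [|x w IH]; rewrite // wt2_cons nbI_cons leq_add // wt2_gen nbI_gen; case: x.
Qed.

(** A letter of non-negative mode can be moved next to the vacuum, where it
    vanishes. *)
Lemma small_nonneg w a q (m : int) g : 0 <= m -> Igen a q m \in w -> nbI w = g.+1 ->
  small (wt1 w) (wt2 w) g (word F w).
Proof.
move=> m0 xw wg; pose w' := rcons (rem (Igen a q m) w) (Igen a q m).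
have pe : perm_eq w w' by rewrite (perm_trans (perm_to_rem xw)) // perm_sym perm_rcons.
have := @small_perm F [::] w w' g pe wg.
apply: small_state; rewrite /= raddfB /=.
have -> : state (word F w') = 0; last by rewrite subr0.
by apply/state_eq0; rewrite /w' -cats1 word_cat; exact: vac_ideal_ann.
Qed.

Lemma class_sum0 (V : lmodType (fps F)) (I : Type) (c : I -> F) (w : I -> seq lgen)
    (f : seq lgen -> V) (s : seq I) :
  (forall w w', perm_eq w w' -> f w = f w') ->
  (forall w0, \sum_(i <- s | perm_eq (w i) w0) c i = 0) ->
  \sum_(i <- s) fpsC (c i) *: f (w i) = 0.
Proof.
move=> fP; have [n] := ubnP (size s); elim: n s => // n IH [|i s] /= hs h.
  by rewrite big_nil.
rewrite (bigID (fun j => perm_eq (w j) (w i))) /=.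
rewrite (eq_bigr (fun j => fpsC (c j) *: f (w i))) => [|j /fP-> //].
rewrite -scaler_suml -rmorph_sum h rmorph0 scale0r add0r big_cons perm_refl /= -big_filter IH //.
  by rewrite size_filter (leq_ltn_trans (count_size _ _)).
move=> w0; rewrite big_filter_cond /=.
have [iw|iw] := boolP (perm_eq (w i) w0).
  apply: big1 => j /andP[/negP nji jw]; case: nji.
  by rewrite (perm_trans jw) // perm_sym.
rewrite -[RHS](h w0) big_cons (negbTE iw); apply: eq_bigl => j.
case jw: (perm_eq (w j) w0); rewrite ?andbF // andbT; apply/negP => ji.
by case/negP: iw; rewrite perm_sym (perm_trans _ ji) // perm_sym.
Qed.

Lemma chi_sum e g (s : seq (F * seq lgen)) :
  chi idfun e (\sum_(cw <- s) (fpsC cw.1 * hbar ^+ (g - nbI cw.2)) *: word F cw.2)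
  = \sum_(cw <- s | (g <= nbI cw.2)%N) cw.1 * \prod_(x <- cw.2) e x.
Proof.
rewrite raddf_sum [RHS]big_mkcond /=; apply: eq_bigr => -[c w] _ /=.
rewrite chiZ chi_word coef_fpsCM coef_hbarX /= [0%N == _]eq_sym subn_eq0.
by case: ifP; rewrite (mulr0, mulr1) ?mul0r.
Qed.

(** Modulo [hbar] the words commute and those with a non-negative mode vanish,
    so only the classes of normal words up to permutation remain, and the symbol
    separates them. The bound [p <= g.+2] is what excludes letters with two
    derivatives from the words without [hbar], which have [g.+1] factors [I]. *)
Lemma completeness r p g u : homog r p g.+1 u -> (p <= g.+2)%N ->
  (forall e : lgen -> F, admissible e -> chi idfun e u = 0) -> small r p g u.
Proof.
move=> /homogE[s hs ->] pg chi0; move/allP: hs => hs.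
pose ok (cw : F * seq lgen) := (g < nbI cw.2)%N && all normal_gen cw.2.
have split_ok cw : cw \in s -> ~~ ok cw ->
    small r p g ((fpsC cw.1 * hbar ^+ (g.+1 - nbI cw.2)) *: word F cw.2).
  case: cw => c w /hs/and3P[/= /eqP <- /eqP w2 wg]; rewrite negb_and -scalerA => nok.
  apply: smallZ; move: nok; rewrite -leqNgt; case: leqP => /= [wg' _|wg' wok].
    rewrite subSn // exprS -scalerA; apply: small_hbar; rewrite -w2.
    have -> : g = (g - nbI w + nbI w)%N by rewrite subnK.
    rewrite addnK; elim: (g - nbI w)%N => [|k IH].
      by rewrite expr0 scale1r; exact: homog_word.
    by rewrite exprS -scalerA; apply: homog_hbar.
  have wgE : nbI w = g.+1 by apply/eqP; rewrite eqn_leq wg wg'.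
  have [x xw xn] := allPn wok.
  have := perm_to_rem xw => pe.
  have := wt2_perm pe; have := nbI_perm pe; have := leq_nbI_wt2 (rem x w).
  rewrite wgE w2 wt2_cons nbI_cons wt2_gen nbI_gen.
  case: x xw xn {pe} => [a q m|q] xw xn le1 e1 e2; last first.
    by move: xn => /=; lia.
  rewrite ?wgE subnn expr0 scale1r -w2.
  apply: (@small_nonneg _ a q m) => //.
  by move: xn => /=; rewrite negb_and -leNgt => /orP[//|]; lia.
(* The words that are not small for a trivial reason are grouped into classes
   under permutation; [rep] picks a representative of each class. *)
rewrite (bigID ok) /=; apply: smallD; last first.
  by apply: small_sum => cw cws; exact: split_ok.
have sep w0 : \sum_(cw <- [seq cw <- s | ok cw] | perm_eq cw.2 w0) cw.1 = 0.
  apply: (@monomial_separation F lgen _ fst snd) => e.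
  pose e' x := if normal_gen x then e x else 0.
  have e'P : admissible e' by move=> x /negbTE nx; rewrite /e' nx.
  rewrite -[RHS](chi0 e' e'P) chi_sum big_filter (bigID ok [fun cw => (g < nbI cw.2)%N]) /=.
  rewrite [X in _ + X]big1 ?addr0 => [|[c w] /andP[/= wg]]; last first.
    rewrite negb_and wg /= => /allPn[x xw xn].
    by rewrite (big_rem x) //= e'P // mul0r mulr0.
  apply: eq_big => [[c w]|[c w] /andP[_ /allP wn]] /=; first by rewrite /ok /= andbA andbb.
  by congr (_ * _); apply: eq_big_seq => x /wn nx; rewrite /e' nx.
pose W := [seq cw.2 | cw <- s & ok cw].
pose rep w := nth [::] W (find (perm_eq w) W).
have repP w w' : perm_eq w w' -> rep w = rep w'.
  by move=> ww'; rewrite /rep; congr nth; apply: eq_find; apply/permPl.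
have repK w : w \in W -> perm_eq w (rep w).
  by move=> wW; apply: (nth_find [::] (a := perm_eq w)); apply/hasP; exists w.
have hom cw : cw \in s -> ok cw ->
    [/\ nbI cw.2 = g.+1, wt1 cw.2 = r & wt2 cw.2 = p].
  move=> /hs/and3P[/eqP-> /eqP-> wg] /andP[wg' _]; split=> //.
  by apply/eqP; rewrite eqn_leq wg wg'.
have -> : \sum_(cw <- s | ok cw) (fpsC cw.1 * hbar ^+ (g.+1 - nbI cw.2)) *: word F cw.2
   = \sum_(cw <- s | ok cw) fpsC cw.1 *: (word F cw.2 - word F (rep cw.2))
     + \sum_(cw <- s | ok cw) fpsC cw.1 *: word F (rep cw.2).
  rewrite -big_split /= big_seq_cond [RHS]big_seq_cond; apply: eq_bigr => cw /andP[cws cwok].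
  by have [-> _ _] := hom _ cws cwok; rewrite subnn expr0 mulr1 -scalerDr subrK.
have -> : \sum_(cw <- s | ok cw) fpsC cw.1 *: word F (rep cw.2) = 0.
  rewrite -big_filter; apply: (@class_sum0 tens _ fst snd (fun w => word F (rep w))).
    by move=> w w' /repP->.
  exact: sep.
rewrite addr0; apply: small_sum => cw cws cwok; apply: smallZ.
have [cg <- <-] := hom _ cws cwok.
apply: (@small_perm F [::]) => //; apply: repK.
by apply/mapP; exists cw; rewrite // mem_filter cwok.
Qed.
End Completeness.

(** * The Wick recursion *)

Section WickRecursion.
Variables (S : comNzRingType) (T : eqType) (xi : T -> S) (kappa : T -> T -> S).
Implicit Types (s t pending : seq T) (x y z : T).

(** The value of the word [s] on the vacuum when the commutators of the letters
    are scalars: each letter takes its own value or is contracted with an earlier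
    one. [pending] lists the letters already read that still await a partner, so
    the recursion is structural; at the end none may be left. *)
Fixpoint wick s pending : S :=
  if s is x :: s' then
    xi x * wick s' pending
    + \sum_(y <- pending) kappa y x * wick s' (rem y pending)
    + wick s' (x :: pending)
  else (nilp pending)%:R.

Lemma perm_rem x s t : perm_eq s t -> perm_eq (rem x s) (rem x t).
Proof.
move=> pe; have [xs|xs] := boolP (x \in s); last first.
  by rewrite !rem_id // -(perm_mem pe).
rewrite -(perm_cons x) -(permPl (perm_to_rem xs)) (permPl pe).
by apply: perm_to_rem; rewrite -(perm_mem pe).
Qed.

Lemma rem_swap x y s : perm_eq (rem x (rem y s)) (rem y (rem x s)).
Proof.
wlog xs : x y / x \in s => [wl|].
  have [/wl//|xs] := boolP (x \in s); have [ys|ys] := boolP (y \in s).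
    by rewrite perm_sym wl.
  by rewrite (rem_id xs) !(rem_id ys) rem_id.
have [->//|xy] := eqVneq x y.
have [ys|ys] := boolP (y \in s); last first.
  by rewrite (rem_id ys) [rem y (rem x s)]rem_id //; apply: contraNN ys; exact: mem_rem.
have yx : y \in rem x s.
  by move: ys; rewrite (perm_mem (perm_to_rem xs)) inE eq_sym (negbTE xy).
apply: perm_trans (perm_rem x (perm_rem y (perm_to_rem xs))) _ => /=.
by rewrite (negbTE xy) /= eqxx.
Qed.

Lemma wick_perm s p p' : perm_eq p p' -> wick s p = wick s p'.
Proof.
elim: s p p' => [|x s IH] p p' pe /=.
  by congr (_%:R); congr (nat_of_bool _); rewrite /nilp (perm_size pe).
rewrite (IH _ _ pe) (IH (x :: p) (x :: p')) ?perm_cons //.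
congr (_ + _ + _); rewrite (perm_big _ pe) /=; apply: eq_bigr => y _.
by rewrite (IH _ _ (perm_rem y pe)).
Qed.

(** Ordered pairs of distinct occurrences: both sides are the full double sum
    minus its diagonal. *)
Lemma sum_rem_swap (G : T -> T -> S) s :
  \sum_(a <- s) \sum_(b <- rem a s) G a b = \sum_(a <- s) \sum_(b <- rem a s) G b a.
Proof.
have E (H : T -> T -> S) :
    \sum_(a <- s) \sum_(b <- rem a s) H a b
    = \sum_(a <- s) \sum_(b <- s) H a b - \sum_(a <- s) H a a.
  rewrite -sumrB; apply: eq_big_seq => a /perm_to_rem/(perm_big _) -> /=.
  by rewrite big_cons [X in X - _]addrC addrK.
by rewrite !E exchange_big.
Qed.

(** In the two expansions the terms in which [x] and [y] are not contracted
    with each other agree, because the order of the pending letters is irrelevant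
    and the double contractions are symmetric. *)
Lemma wick_swap s x y t p :
  wick (s ++ [:: x, y & t]) p - wick (s ++ [:: y, x & t]) p
  = (kappa x y - kappa y x) * wick (s ++ t) p.
Proof.
elim: s p => [|c s IH] p; last first.
  rewrite /= !opprD addrACA [X in X + _ = _]addrACA -mulrBr !IH.
  rewrite -sumrB (eq_bigr (fun d => (kappa x y - kappa y x)
    * (kappa d c * wick (s ++ t) (rem d p)))) => [|d _].
    by rewrite -mulr_sumr; ring.
  by rewrite -mulrBr IH; ring.
pose N x y := xi x * \sum_(d <- p) kappa d y * wick t (rem d p).
pose C x y := \sum_(d <- p) kappa d x * wick t (y :: rem d p).
pose D x y := \sum_(d <- p) \sum_(d' <- rem d p)
  kappa d x * kappa d' y * wick t (rem d' (rem d p)).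
have E a b : wick [:: a, b & t] p =
    xi a * xi b * wick t p + wick t [:: b, a & p] + N a b + N b a
    + xi a * wick t (b :: p) + xi b * wick t (a :: p)
    + D a b + C a b + C b a + kappa a b * wick t p.
  rewrite -[wick _ _]/(xi a * wick (b :: t) p
    + \sum_(d <- p) kappa d a * wick (b :: t) (rem d p) + wick (b :: t) (a :: p)).
  have -> : \sum_(d <- p) kappa d a * wick (b :: t) (rem d p) = N b a + D a b + C a b.
    rewrite /N /D /C mulr_sumr -!big_split /=; apply: eq_bigr => d _.
    rewrite !mulrDr mulr_sumr mulrCA; congr (_ + _ + _).
    by apply: eq_bigr => d' _; rewrite mulrA.
  rewrite /= big_cons eqxx.
  have -> : \sum_(d <- p) kappa d b * wick t (if a == d then p else a :: rem d p) = C b a.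
    apply: eq_big_seq => d dp; congr (_ * _); apply: wick_perm.
    by case: eqP => // ->; exact: perm_to_rem.
  by rewrite /N; ring.
have DC : D x y = D y x.
  rewrite /D sum_rem_swap; apply: eq_bigr => d _; apply: eq_bigr => d' _.
  by rewrite [_ * kappa d y]mulrC (wick_perm t (rem_swap d d' p)).
rewrite !cat0s !E DC (wick_perm t (p := [:: x, y & p]) (p' := [:: y, x & p])); first by ring.
by rewrite (perm_catCA [:: x] [:: y]).
Qed.

(** A last letter has nothing to its right, so it would have to be contracted
    with an earlier one. *)
Lemma wick_null s z : xi z = 0 -> (forall y, kappa y z = 0) ->
  forall p, wick (rcons s z) p = 0.
Proof.
move=> xz kz; elim: s => [|x s IH] p /=.
  by rewrite xz mul0r add0r big1 ?add0r // => y _; rewrite kz mul0r.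
by rewrite !IH mulr0 addr0 add0r big1 // => y _; rewrite IH mulr0.
Qed.

Lemma wick_pending z : (forall y, kappa z y = 0) ->
  forall t p, z \in p -> wick t p = 0.
Proof.
move=> zk; elim=> [|x t IH] p zp /=; first by case: p zp.
rewrite !IH ?inE ?zp ?orbT // mulr0 addr0 add0r big1 // => y _.
have [->|yz] := eqVneq y z; first by rewrite zk mul0r.
have [yp|yp] := boolP (y \in p); last by rewrite rem_id // IH // mulr0.
rewrite IH ?mulr0 //; move: zp; rewrite (perm_mem (perm_to_rem yp)) inE.
by rewrite eq_sym (negbTE yz).
Qed.

Lemma wick_central s z t : (forall y, kappa z y = 0) -> (forall y, kappa y z = 0) ->
  forall p, wick (s ++ z :: t) p = xi z * wick (s ++ t) p.
Proof.
move=> zk kz; elim: s => [|x s IH] p /=.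
  rewrite (wick_pending zk t (mem_head z p)) addr0 big1 ?addr0 // => y _.
  by rewrite kz mul0r.
rewrite !IH (eq_bigr (fun y => xi z * (kappa y x * wick (s ++ t) (rem y p)))) => [|y _].
  by rewrite -mulr_sumr; ring.
by rewrite IH mulrCA.
Qed.
End WickRecursion.

(** * The Wick functional on the vacuum module *)

Section WickFunctional.
Variables (F : numClosedFieldType) (e : lgen -> F).
Hypothesis e_adm : admissible e.
Local Notation tens := (tens F).
Implicit Types (u v : tens) (w s t p : seq lgen) (x y z : lgen).

(** Half the bracket between two creating letters, the whole bracket when an
    annihilating letter stands on the left, and zero when it stands on the right:
    the antisymmetric part is the bracket and the vacuum is annihilated. The value
    omits a factor [hbar]. *)
Definition contraction x y : F :=
  match x, y with
  | Igen a 0 m, Igen b 0 r =>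
      - (if 0 <= r then 0 else if 0 <= m then 1 else 2^-1)
      * \sum_c fstr F a b c * e (Igen c 1 (m + r))
  | _, _ => 0
  end.

(** With [p] empty this is a functional on the vacuum module which is exact to
    all orders in [hbar]. A non-empty [p] records letters on the left that are
    still to be contracted. *)
Definition Phi p : tens -> fps F :=
  lin idfun (fun w => wick (fun x => fpsC (e x))
                        (fun x y => hbar * fpsC (contraction x y)) w p).

HB.instance Definition _ p := GRing.Additive.on (Phi p).

Lemma PhiZ p c u : Phi p (c *: u) = c * Phi p u.
Proof. exact: linZ. Qed.

Fact Phi_is_linear p : linear_for *%R (Phi p).
Proof. by move=> c u v; rewrite raddfD /= PhiZ. Qed.
HB.instance Definition _ p :=
  GRing.isLinear.Build (fps F) tens (fps F) *%R (Phi p) (Phi_is_linear p).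

Lemma Phi_word p w : Phi p (word F w) =
  wick (fun x => fpsC (e x)) (fun x y => hbar * fpsC (contraction x y)) w p.
Proof. exact: lin_word. Qed.

Lemma Phi_genM p x u : Phi p (gen F x * u) = fpsC (e x) * Phi p u
  + \sum_(y <- p) hbar * fpsC (contraction y x) * Phi (rem y p) u + Phi (x :: p) u.
Proof.
elim/tens_ind: u => [|c w u IH].
  by rewrite mulr0 !linear0 mulr0 add0r addr0 big1 // => y _; rewrite linear0 mulr0.
have -> : gen F x * (c *: word F w + u) = c *: word F (x :: w) + gen F x * u.
  by rewrite mulrDr -scalerAr -word_cons.
rewrite linearP /= IH Phi_word /= !linearP /= -!Phi_word.
under [X in _ = _ + X + _]eq_bigr => y _ do rewrite linearP /= mulrDr mulrCA.
by rewrite big_split /= -mulr_sumr; under eq_bigr => y _ do rewrite -Phi_word; ring.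
Qed.

(** Each contraction costs a factor [hbar], so nothing may be pending at
    order zero. *)
Lemma Phi_pending0 p u : Phi p u 0%N = (p == [::])%:R * chi idfun e u.
Proof.
elim/tens_ind: u => [|c w u IH]; first by rewrite !raddf0 coef_fps0 mulr0.
rewrite linearP /= coef_fpsD IH raddfD /= mulrDr; congr (_ + _).
rewrite coef_fpsM0 chiZ chi_word Phi_word /= mulrCA; congr (_ * _).
clear IH; elim: w p => [|x w IHw] p /=.
  rewrite big_nil mulr1; case: p => [|y p] /=.
    by rewrite -[1%:R]/(1 : fps F) -[1]/(fpsC 1) fpsCE.
  by rewrite mulr0n coef_fps0.
rewrite !coef_fpsD coef_fpsM0 !IHw fpsCE coef_fps_sum [X in _ + X + _ = _]big1 => [|y _].
  by rewrite big_cons /= addr0 mul0r addr0 mulrCA.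
by rewrite -mulrA coef_hbarM0.
Qed.

Lemma Phi_cst u : Phi [::] u 0%N = chi idfun e u.
Proof. by rewrite Phi_pending0 mul1r. Qed.

(** At order one a single pending letter is contracted with one letter of the
    word, and the others take their values: a directional derivative. *)
Lemma Phi_pending1 x u : Phi [:: x] u 1%N = dd idfun e (contraction x) u.
Proof.
have cst0 w y : Phi [:: y] (word F w) 0%N = 0 by rewrite Phi_pending0 mul0r.
have Phi2 w p : (1 < size p)%N -> Phi p (word F w) 1%N = 0.
  elim: w p => [|y w IH] p hp; first by rewrite Phi_word; case: p hp => [|? ?] //= _; rewrite mulr0n coef_fps0.
  rewrite word_cons Phi_genM !coef_fpsD coef_fpsCM !IH ?mulr0 ?add0r ?addr0 //; last exact: ltnW.
  rewrite coef_fps_sum; apply: big1_seq => z /andP[_ zp].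
  rewrite -mulrA coef_hbarMS coef_fpsCM Phi_pending0.
  suff /negbTE-> : rem z p != [::] by rewrite mul0r mulr0.
  by rewrite -size_eq0 size_rem //; case: (p) hp => [|? []].
elim/tens_ind: u => [|c w u IH]; first by rewrite !raddf0 coef_fps0.
rewrite linearP /= coef_fpsD IH raddfD /= ddZ dd_wordE; congr (_ + _).
rewrite coef_fpsM !big_ord_recl big_ord0 /= subnn cst0 mulr0 !addr0; congr (_ * _).
elim: w => [|y w IHw]; first by rewrite Phi_word /= mulr0n coef_fps0.
rewrite word_cons Phi_genM big_seq1 !coef_fpsD coef_fpsCM (Phi2 w [:: y; x]) // addr0 IHw /=.
by rewrite -mulrA coef_hbarMS coef_fpsCM eqxx Phi_cst chi_word addrC.
Qed.

(** The letters in a bracket carry a derivative, so they have no contractions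
    and act as scalars. *)
Lemma Phi_bracket s x y t p : Phi p (word F s * bracket F x y * word F t)
  = hbar * fpsC (contraction x y - contraction y x) * Phi p (word F (s ++ t)).
Proof.
have central z : match z with Igen _ q _ => (0 < q)%N | _ => true end ->
    Phi p (word F s * gen F z * word F t) = fpsC (e z) * Phi p (word F (s ++ t)).
  move=> zc; rewrite -!word_cat -catA !Phi_word wick_central // => y';
    rewrite [X in hbar * fpsC X](_ : _ = 0) ?rmorph0 ?mulr0 //.
    by case: z zc => // a [|q] m.
  by case: y' => // ? [|?] ?; case: z zc => // ? [].
case: x y => [a i m|i] [b j r|j]; rewrite /= ?(mulr0, mul0r) ?linear0 ?subrr ?rmorph0 ?mulr0 ?mul0r //; last 2 first.
- by case: i; rewrite ?(subrr, rmorph0, mulr0, mul0r).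
- by case: j; rewrite ?(subrr, rmorph0, mulr0, mul0r).
rewrite -scalerAr -scalerAl linearZ /= /affine mulrBr mulrBl linearB /=.
rewrite -!scalerAr -!scalerAl !linearZ /= central // (e_adm (x := kgen _)) //.
rewrite rmorph0 mul0r mulr0 subr0.
have -> : Phi p (word F s
      * (\sum_c fpsC (fstr F a b c) *: Iop F c (i + j).+1 (m + r)) * word F t)
    = fpsC (\sum_c fstr F a b c * e (Igen c (i + j).+1 (m + r))) * Phi p (word F (s ++ t)).
  rewrite mulr_sumr mulr_suml linear_sum rmorph_sum mulr_suml; apply: eq_bigr => c _ /=.
  by rewrite -scalerAr -scalerAl linearZ /= central // mulrA -rmorphM.
have [|] := boolP ((i == 0%N) && (j == 0%N)); last first.
  rewrite negb_and => ij; rewrite big1 => [|c _]; last first.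
    by rewrite e_adm ?mulr0 //= negb_and -ltnNge; apply/orP; right; case: i j ij => [|?] [].
  rewrite rmorph0 mul0r !mulr0.
  by case: i j ij => [|i] [|j] // _; rewrite subrr rmorph0 mulr0 mul0r.
case/andP=> /eqP-> /eqP->; rewrite invr1 mulr1.
have -> : \sum_c fstr F b a c * e (Igen c 1 (r + m))
        = - \sum_c fstr F a b c * e (Igen c 1 (m + r)).
  by rewrite -sumrN; apply: eq_bigr => c _; rewrite fstrC mulNr addrC.
set G := \sum_c _; rewrite !mulrA [_ * hbar]mulrC -![hbar * _ * _]mulrA; congr (hbar * (_ * _)).
rewrite -rmorphM; congr fpsC; rewrite !mulNr mulrN opprK mul1r -/G.
have [r0|r0] := leP 0 r; have [m0|m0] := leP 0 m; rewrite ?(mul0r, mul1r, oppr0, addr0, add0r, subr0) //.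
  rewrite /G big1 ?oppr0 // => c _; rewrite e_adm ?mulr0 //=.
  by rewrite negb_and -leNgt addr_ge0.
by rewrite -opprD -mulrDl -[2^-1]mul1r -splitr mul1r.
Qed.

(** Hence an identity between states holds between the values of [Phi]. As
    these are power series, on which [hbar] is injective, this replaces the freeness
    of the vacuum module over the power series. *)
Lemma Phi_vac_ideal u : vac_ideal u -> Phi [::] u = 0.
Proof.
elim=> [|c u1 v1 _ h1 _ h2|u1 x y v1|u1 a q m m0].
- exact: linear0.
- by rewrite linearP /= h1 h2 mulr0 addr0.
- elim/tens_ind: u1 => [|c s u1 IH]; first by rewrite !mul0r linear0.
  rewrite !mulrDl linearD /= IH addr0 -!scalerAl linearZ /=.
  suff -> : Phi [::] (word F s * (gen F x * gen F y - gen F y * gen F x - bracket F x y) * v1) = 0.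
    exact: mulr0.
  elim/tens_ind: v1 {IH} => [|c' t v1 IH]; first by rewrite !mulr0 linear0.
  rewrite mulrDr linearD /= IH addr0 -scalerAr linearZ /=.
  rewrite !mulrBr !mulrBl !linearB /= Phi_bracket -!mulrA -!word_cons -!word_cat !Phi_word.
  by rewrite wick_swap -mulrBr -rmorphB mulrA subrr mulr0.
- elim/tens_ind: u1 => [|c s u1 IH]; first by rewrite mul0r linear0.
  rewrite mulrDl linearD /= IH addr0 -scalerAl linearZ /= -word_cat cats1 Phi_word.
  rewrite wick_null ?mulr0 // => [|y]; first by rewrite e_adm ?rmorph0 //= negb_and -leNgt m0.
  case: y => [b [|j] r|j]; rewrite /= ?rmorph0 ?mulr0 //.
  by case: (q) => [|?]; rewrite ?m0 ?oppr0 ?mul0r rmorph0 mulr0.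
Qed.

Lemma Phi_state u v : state u = state v -> Phi [::] u = Phi [::] v.
Proof.
by move/state_eq/Phi_vac_ideal/eqP; rewrite linearB subr_eq0 => /eqP.
Qed.
End WickFunctional.

(** * The leading term and its derivatives *)

Section SecondDerivative.
Variables (F : numClosedFieldType) (A : comNzRingType) (iota : {rmorphism F -> A}).
Implicit Types (e g h : lgen -> A) (K : lgen -> lgen -> A) (u v : tens F) (w : seq lgen).

Fixpoint dd2_word e g h w : A :=
  if w is x :: w' then
    g x * dd_word e h w' + h x * dd_word e g w' + e x * dd2_word e g h w'
  else 0.

(** The second mixed derivative of the symbol. *)
Definition dd2 e g h : tens F -> A := lin (iota \o @cst_coef F) (dd2_word e g h).
HB.instance Definition _ e g h := GRing.Additive.on (dd2 e g h).

Fixpoint pairs_word e K w : A :=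
  if w is x :: w' then dd_word e (K x) w' + e x * pairs_word e K w' else 0.

(** The sum over the pairs of positions, in order, that arises when a letter
    is moved to the right end of a word and picks up one contraction. *)
Definition pairs e K : tens F -> A := lin (iota \o @cst_coef F) (pairs_word e K).
HB.instance Definition _ e K := GRing.Additive.on (pairs e K).

Lemma dd_word_rcons e h w x : dd_word e h (rcons w x)
  = dd_word e h w * e x + (\prod_(y <- w) e y) * h x.
Proof.
by rewrite -cats1 dd_word_cat /= big_seq1 big_nil mulr1 mulr0 addr0.
Qed.

Lemma dd_word_rev e h w : dd_word e h (rev w) = dd_word e h w.
Proof.
elim: w => [|x w IH] //=; rewrite rev_cons dd_word_rcons IH.
by rewrite (perm_big w) ?perm_rev //=; ring.
Qed.

Lemma pairs_word_rcons e K w x : pairs_word e K (rcons w x)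
  = dd_word e (K^~ x) w + e x * pairs_word e K w.
Proof.
elim: w => [|y w IH] /=; first by rewrite !mulr0.
by rewrite IH dd_word_rcons; ring.
Qed.

Lemma pairs_word_rev e K w : pairs_word e K (rev w) = pairs_word e (fun x y => K y x) w.
Proof.
by elim: w => [|x w IH] //=; rewrite rev_cons pairs_word_rcons IH dd_word_rev.
Qed.
End SecondDerivative.

Section SecondDerivativePoly.
Variables (F : numClosedFieldType) (A : comNzRingType) (iota : {rmorphism F -> A}).
Implicit Types (e g h : lgen -> A) (K : lgen -> lgen -> A) (u v : tens F) (w : seq lgen).
Local Notation iotaP := (polyC \o iota).

Definition line e h : lgen -> {poly A} := fun x => (e x)%:P + 'X * (h x)%:P.

Lemma line0 e h x : (line e h x).[0] = e x.
Proof. by rewrite !hornerE. Qed.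
Lemma deriv_line e h x : (line e h x)^`() = (h x)%:P.
Proof. by rewrite !derivE; ring. Qed.

Lemma dd_line e h u : dd iota e h u = ((chi iotaP (line e h) u)^`()).[0].
Proof.
rewrite chi_deriv_poly horner_dd; apply: eq_dd => x; first by rewrite line0.
by rewrite deriv_line hornerC.
Qed.

Lemma dd2_line e g h u :
  dd2 iota e g h u = ((dd iotaP (line e g) (fun x => (h x)%:P) u)^`()).[0].
Proof.
elim/tens_ind: u => [|c w u IH]; first by rewrite !raddf0 horner0.
rewrite !raddfD /= hornerD -IH ddZ derivM derivC mul0r add0r hornerM hornerC.
rewrite [dd2 _ _ _ _ _]linZ [lin _ _ _]lin_word dd_wordE; congr (_ * _ + _).
elim: w => [|x w IHw]; first by rewrite derivC horner0.
rewrite /= derivD !derivM derivC deriv_line mul0r add0r !hornerD !hornerM !hornerC line0 -IHw.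
have prodE : (\prod_(y <- w) line e g y).[0] = \prod_(y <- w) e y.
  by rewrite horner_prod; apply: eq_bigr => y _; rewrite line0.
have -> : (\prod_(y <- w) line e g y)^`().[0] = dd_word e g w.
  have := dd_line e g (word F w); rewrite dd_wordE chi_word => ->.
  by [].
have -> : (dd_word (line e g) (fun x0 => (h x0)%:P) w).[0] = dd_word e h w.
  elim: (w) => [|y s IHs] /=; first by rewrite horner0.
  rewrite hornerD !hornerM hornerC IHs line0 horner_prod.
  by congr (_ * _ + _); apply: eq_bigr => z _; rewrite line0.
by ring.
Qed.
End SecondDerivativePoly.

Section InvariantTensor.
Variable F : numClosedFieldType.

Definition pairing n (i : seq 'I_3) : F :=
  \prod_(l < n) (nth ord0 i l.*2 == nth ord0 i l.*2.+1)%:R.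

(** The components of the invariant tensor as scalars, the ring of series being
    needed only for the module structure. *)
Definition tinvF n (i : (n.*2).-tuple 'I_3) : F :=
  (n.*2)`!%:R^-1 * \sum_(s : 'S_(n.*2)) pairing n (tperm_tuple s i).

Lemma tinvE n (i : (n.*2).-tuple 'I_3) : tinv F i = fpsC (tinvF i).
Proof.
rewrite /tinv /symmetrize [LHS]/GRing.scale /= /tinvF rmorphM rmorph_sum; congr (_ * _).
apply: eq_bigr => s _; rewrite rmorph_prod; apply: eq_bigr => l _.
by rewrite rmorph_nat.
Qed.

Lemma tperm_tupleM m (s s' : 'S_m) (i : m.-tuple 'I_3) :
  tperm_tuple s' (tperm_tuple s i) = tperm_tuple (s' * s)%g i.
Proof. by apply: eq_from_tnth => l; rewrite !tnth_mktuple permM. Qed.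

Lemma tperm_tuple1 m (i : m.-tuple 'I_3) : tperm_tuple 1%g i = i.
Proof. by apply: eq_from_tnth => l; rewrite !tnth_mktuple perm1. Qed.

Lemma tperm_tuple_bij m (s : 'S_m) : bijective (@tperm_tuple m s).
Proof.
exists (@tperm_tuple m s^-1%g) => i; rewrite tperm_tupleM.
  by rewrite mulVg tperm_tuple1.
by rewrite mulgV tperm_tuple1.
Qed.

Lemma tperm_tuple_perm m (s : 'S_m) (i : m.-tuple 'I_3) : perm_eq (tperm_tuple s i) i.
Proof. by apply/tuple_permP; exists s. Qed.

Lemma tinvF_perm n (s : 'S_(n.*2)) i : tinvF (tperm_tuple s i) = tinvF i.
Proof.
rewrite /tinvF; congr (_ * _); rewrite [RHS](reindex_inj (mulIg s)).
by apply: eq_bigr => s' _; rewrite tperm_tupleM.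
Qed.

Lemma tinvF_rev n (i : (n.*2).-tuple 'I_3) : tinvF (rev_tuple i) = tinvF i.
Proof.
rewrite -(tinvF_perm (perm (@rev_ord_inj _)) i); congr tinvF.
apply: eq_from_tnth => l; rewrite tnth_mktuple permE !(tnth_nth ord0) /=.
by rewrite nth_rev size_tuple.
Qed.

Lemma big_tuple_cons (V : zmodType) m (G : m.+1.-tuple 'I_3 -> V) :
  \sum_i G i = \sum_b \sum_(i : m.-tuple 'I_3) G (cons_tuple b i).
Proof.
rewrite pair_bigA /= (reindex (fun bi : 'I_3 * m.-tuple 'I_3 => cons_tuple bi.1 bi.2)) //=.
exists (fun i => (thead i, behead_tuple i)) => [[b i] _|i _] /=.
  by rewrite theadE; congr (_, _); apply: val_inj.
by rewrite [RHS]tuple_eta.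
Qed.

Section Value.
Variables (A : comNzRingType) (iota : {rmorphism F -> A}) (x : 'I_3 -> A).

(** A pairing of the indices contracts consecutive factors, giving one factor
    [x . x] per pair. *)
Lemma sum_pairing n :
  \sum_(i : (n.*2).-tuple 'I_3) iota (pairing n i) * \prod_(b <- i) x b
  = (\sum_b x b ^+ 2) ^+ n.
Proof.
elim: n => [|n IH].
  rewrite (big_pred1 [tuple]) => [|i]; last by apply/esym/eqP; exact: tuple0.
  by rewrite /pairing big_ord0 rmorph1 big_nil mulr1.
rewrite exprS -IH mulr_suml.
rewrite (@big_tuple_cons A n.*2.+1 (fun i => iota (pairing n.+1 i) * \prod_(b <- i) x b)).
apply: eq_bigr => b _; rewrite big_tuple_cons (bigD1 b) //= [X in _ + X]big1 ?addr0; last first.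
  move=> b' bb'; apply: big1 => i _.
  by rewrite /pairing big_ord_recl /= eq_sym (negbTE bb') mul0r rmorph0 mul0r.
rewrite mulr_sumr; apply: eq_bigr => i _.
rewrite !big_cons /pairing big_ord_recl /= eqxx mul1r.
by ring.
Qed.

(** Each of the summands in the symmetrization contributes the same value
    since the factors [x b] commute. *)
Lemma sum_tinv n :
  \sum_(i : (n.*2).-tuple 'I_3) iota (tinvF i) * \prod_(b <- i) x b
  = (\sum_b x b ^+ 2) ^+ n.
Proof.
under eq_bigr => i _ do rewrite /tinvF rmorphM rmorph_sum -mulrA mulr_suml.
rewrite -mulr_sumr exchange_big /=.
rewrite (eq_bigr (fun=> (\sum_b x b ^+ 2) ^+ n)) => [|s _]; last first.
  rewrite -sum_pairing [RHS](reindex (tperm_tuple s)) /=; last first.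
    exact/onW_bij/tperm_tuple_bij.
  by apply: eq_bigr => i _; rewrite (perm_big _ (tperm_tuple_perm s i)).
rewrite sumr_const card_Sn mulrnAr -mulrnAl -(mulr_natr (iota _)) -(rmorph_nat iota) -rmorphM mulVf.
  by rewrite rmorph1 mul1r.
by rewrite pnatr_eq0 -lt0n fact_gt0.
Qed.
End Value.
End InvariantTensor.

Section LeadingTerm.
Variable F : numClosedFieldType.

Definition leading n : tens F :=
  \sum_(i : (n.*2).-tuple 'I_3) tinv F i *: Iprod F i.

(** The part of a point on which the leading term depends. *)
Definition I1 (T : Type) (e : lgen -> T) := fun b : 'I_3 => e (Igen b 0 (-1)).

Section Values.
Variables (A : comNzRingType) (iota : {rmorphism F -> A}).
Implicit Types (e g h : lgen -> A) (b : 'I_3).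

Definition dot (x y : 'I_3 -> A) := \sum_b x b * y b.

Lemma dotC x y : dot x y = dot y x.
Proof. by apply: eq_bigr => b _; rewrite mulrC. Qed.

Lemma lin_leading f n : lin (iota \o @cst_coef F) f (leading n) =
  \sum_(i : (n.*2).-tuple 'I_3) iota (tinvF F i) * f [seq Igen a 0 (-1) | a <- i].
Proof.
rewrite raddf_sum; apply: eq_bigr => i _ /=.
by rewrite linZ lin_word /= tinvE /cst_coef fpsCE.
Qed.

Lemma chi_leading e n : chi iota e (leading n) = dot (I1 e) (I1 e) ^+ n.
Proof.
rewrite [LHS]lin_leading -[dot _ _]/(\sum_b I1 e b ^+ 2) -(sum_tinv iota).
by apply: eq_bigr => i _; rewrite big_map.
Qed.
End Values.

(** The symbol of the leading term is [(x . x) ^ n], and its first two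
    derivatives are read off by differentiating along a line. *)
Lemma dd_leading (A : comNzRingType) (iota : {rmorphism F -> A}) e h n :
  dd iota e h (leading n)
  = n%:R * (2 * dot (I1 e) (I1 h)) * dot (I1 e) (I1 e) ^+ n.-1.
Proof.
rewrite dd_line chi_leading.
have -> : dot (I1 (line e h)) (I1 (line e h)) = (dot (I1 e) (I1 e))%:P
    + 2 * 'X * (dot (I1 e) (I1 h))%:P + 'X ^+ 2 * (dot (I1 h) (I1 h))%:P.
  rewrite /dot !rmorph_sum !mulr_sumr -!big_split /=; apply: eq_bigr => b _.
  by rewrite /I1 /line !rmorphM /=; ring.
rewrite deriv_exp hornerMn -mulr_natl hornerM !derivE !hornerE /= expr0n /=.
by rewrite mul0r !addr0 !mulrA.
Qed.

(** The invariant tensor is symmetric, in particular under reversal. *)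
Lemma pairs_leading_rev (e : lgen -> F) K n :
  pairs idfun e K (leading n) = pairs idfun e (fun x y => K y x) (leading n).
Proof.
rewrite [LHS]lin_leading [RHS]lin_leading (reindex_inj (h := @rev_tuple _ _)) /=.
  by apply: eq_bigr => i _; rewrite tinvF_rev map_rev pairs_word_rev.
by move=> i j /(congr1 val) /= ij; apply: val_inj; rewrite -(revK (val i)) ij revK.
Qed.

(** By the reversal only the symmetric part of [K] matters; once it is a sum
    of symmetrized products the ordered pairs assemble into second derivatives. *)
Lemma pairs_leading (I : finType) (e : lgen -> F) K g h n :
  (forall a b (x := Igen a 0 (-1)) (y := Igen b 0 (-1)),
     K x y + K y x = \sum_(j : I) (g j x * h j y + h j x * g j y)) ->
  2 * pairs idfun e K (leading n) = \sum_(j : I) dd2 idfun e (g j) (h j) (leading n).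
Proof.
move=> Kgh; rewrite -[2]/(1 + 1) mulrDl mul1r {2}pairs_leading_rev.
rewrite [X in X + _]lin_leading [X in _ + X]lin_leading.
under [RHS]eq_bigr => j _ do rewrite [dd2 _ _ _ _ _]lin_leading.
rewrite exchange_big -big_split /=; apply: eq_bigr => i _.
rewrite -mulrDr -mulr_sumr; congr (_ * _).
elim: (val i) => [|a s IH] /=; first by rewrite addr0 big1.
rewrite !big_split /= -[X in _ = _ + X]mulr_sumr -IH; set x := Igen a _ _; set w := map _ s.
suff E : dd_word e (K x) w + dd_word e (K^~ x) w
    = \sum_j (g j x * dd_word e (h j) w + h j x * dd_word e (g j) w).
  move: E; rewrite big_split /= => /(congr1 (fun c => c + e x * (pairs_word e K w
    + pairs_word e (fun x y => K y x) w))) E.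
  by rewrite -/w; rewrite -E; ring.
have E y : y \in w -> K x y + K y x = \sum_j (g j x * h j y + h j x * g j y).
  by case/mapP=> b _ ->; exact: Kgh.
elim: w E => [|y w IHw] E /=; first by rewrite addr0 big1 // => j _; rewrite !mulr0 addr0.
rewrite addrACA -mulrDl E ?mem_head // -mulrDr IHw => [|z zw]; last first.
  by apply: E; rewrite inE zw orbT.
rewrite mulr_suml mulr_sumr -big_split /=; apply: eq_bigr => j _.
by ring.
Qed.

Lemma dd2_leading (e g h : lgen -> F) n : dd2 idfun e g h (leading n)
  = 2 * n%:R * (dot (I1 g) (I1 h) * dot (I1 e) (I1 e) ^+ n.-1
      + 2 * n.-1%:R * dot (I1 e) (I1 g) * dot (I1 e) (I1 h) * dot (I1 e) (I1 e) ^+ n.-2).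
Proof.
rewrite dd2_line dd_leading.
have -> : dot (I1 (line e g)) (I1 (line e g)) = (dot (I1 e) (I1 e))%:P
    + 2 * 'X * (dot (I1 e) (I1 g))%:P + 'X ^+ 2 * (dot (I1 g) (I1 g))%:P.
  rewrite /dot !rmorph_sum !mulr_sumr -!big_split /=; apply: eq_bigr => b _.
  by rewrite /I1 /line !rmorphM /=; ring.
have -> : dot (I1 (line e g)) (I1 (fun x => (h x)%:P)) = (dot (I1 e) (I1 h))%:P
    + 'X * (dot (I1 g) (I1 h))%:P.
  rewrite /dot !rmorph_sum !mulr_sumr -!big_split /=; apply: eq_bigr => b _.
  by rewrite /I1 /line !rmorphM /=; ring.
rewrite -(rmorph_nat (@polyC F)) derivM derivM deriv_exp !derivE !hornerE hornerMn !hornerE /= expr0n /=.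
rewrite -[_ *+ n.-1]mulr_natl.
by rewrite !mul0r !addr0; ring.
Qed.
End LeadingTerm.

(** * Rotations of tensors *)

Section Rotation.
Variable F : numClosedFieldType.
Implicit Types (a b c d : 'I_3).

(** [Delta a m] divided by [hbar], which is possible on tensors. *)
Definition dX (a : 'I_3) (m : nat) (x : lgen) : tens F :=
  match x with
  | Igen b p r => \sum_c fpsC (fstr F a b c) *: Iop F c p (m%:Z + r)
      - (hbar * fpsC (r%:~R * (a == b)%:R * (m%:Z + r == 0)%:R)) *: kop F p
  | kgen _ => 0
  end.

Lemma dDeltaE a m x : dDelta F a m x = hbar *: dX a m x.
Proof.
case: x => [b p r|p]; last by rewrite scaler0.
by rewrite /dDelta /affine /dX scalerBr !scalerA expr2 mulrA.
Qed.

Lemma Delta_stateE a m u : Delta a m (state u) = hbar *: state (Defs.deriv (dX a m) u).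
Proof.
rewrite Delta_state -linearZ; congr state.
elim/tens_ind: u => [|c w u IH]; first by rewrite !linear0.
rewrite !linearP /= IH !derivW; congr (_ *: _ + _).
elim: w => [|x w IHw] /=; first by rewrite scaler0.
by rewrite IHw dDeltaE scalerDr scalerAl scalerAr.
Qed.

Lemma homog_dX a m x : homog (wt1 [:: x] - m%:Z) (wt2 [:: x] + 0) (nbI [:: x]) (dX a m x).
Proof.
rewrite addn0; case: x => [b p r|p]; last exact: homog0.
rewrite wt1_gen wt2_gen nbI_gen; apply: homogB.
  apply: homog_sum => c _; apply: homogZ.
  by rewrite -opprD addrC; exact: homog_Iop.
have [mr|_] := eqVneq (m%:Z + r) 0; last first.
  by rewrite mulr0 rmorph0 mulr0 scale0r; exact: homog0.
have -> : - r - m%:Z = 0 by rewrite -opprD addrC mr oppr0.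
rewrite -scalerA; apply: homog_hbar; apply: homogZ; exact: homog_kop.
Qed.

Definition replace m (i : m.-tuple 'I_3) (l : 'I_m) c : m.-tuple 'I_3 :=
  [tuple if k == l then c else tnth i k | k < m].

Lemma replace_cons0 m b (i : m.-tuple 'I_3) c :
  replace (cons_tuple b i) ord0 c = cons_tuple c i.
Proof.
apply: eq_from_tnth => k; rewrite tnth_mktuple.
by case: (unliftP ord0 k) => [j|] ->; rewrite ?tnthS ?tnth0 // eqxx.
Qed.

Lemma replace_consS m b (i : m.-tuple 'I_3) l c :
  replace (cons_tuple b i) (lift ord0 l) c = cons_tuple b (replace i l c).
Proof.
apply: eq_from_tnth => k; rewrite tnth_mktuple.
case: (unliftP ord0 k) => [j|] ->; rewrite ?tnthS ?tnth0 //.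
by rewrite tnth_mktuple (inj_eq lift_inj).
Qed.

Section Action.
Variables (V : lmodType (fps F)) (a : 'I_3).

Definition rot m (G : m.-tuple 'I_3 -> V) (i : m.-tuple 'I_3) : V :=
  \sum_l \sum_c fpsC (fstr F a (tnth i l) c) *: G (replace i l c).

Lemma rot_cons m (G : m.+1.-tuple 'I_3 -> V) b i :
  rot G (cons_tuple b i) = \sum_c fpsC (fstr F a b c) *: G (cons_tuple c i)
                         + rot (fun j => G (cons_tuple b j)) i.
Proof.
rewrite /rot big_ord_recl; congr (_ + _).
  by apply: eq_bigr => c _; rewrite replace_cons0 tnth0.
by apply: eq_bigr => l _; apply: eq_bigr => c _; rewrite replace_consS tnthS.
Qed.

Lemma rot_tperm m (s : 'S_m) (G : m.-tuple 'I_3 -> V) i :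
  rot (fun j => G (tperm_tuple s j)) i = rot G (tperm_tuple s i).
Proof.
rewrite /rot (reindex_inj (@perm_inj _ s)) /=; apply: eq_bigr => l _.
apply: eq_bigr => c _; rewrite tnth_mktuple; congr (_ *: G _).
by apply: eq_from_tnth => k; rewrite !tnth_mktuple (inj_eq perm_inj).
Qed.

Lemma rot_sum (I : finType) m (G : I -> m.-tuple 'I_3 -> V) (k : I -> fps F) i :
  rot (fun j => \sum_t k t *: G t j) i = \sum_t k t *: rot (G t) i.
Proof.
rewrite /rot; under [RHS]eq_bigr => t _ do rewrite scaler_sumr.
rewrite [RHS]exchange_big; apply: eq_bigr => l _ /=.
under [RHS]eq_bigr => t _ do rewrite scaler_sumr.
rewrite [RHS]exchange_big; apply: eq_bigr => c _ /=.
by rewrite scaler_sumr; apply: eq_bigr => t _; rewrite !scalerA mulrC.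
Qed.

Lemma rotZ m (k : fps F) (G : m.-tuple 'I_3 -> V) i :
  rot (fun j => k *: G j) i = k *: rot G i.
Proof.
rewrite /rot scaler_sumr; apply: eq_bigr => l _; rewrite scaler_sumr.
by apply: eq_bigr => c _; rewrite !scalerA mulrC.
Qed.

Lemma rot_symmetrize m (G : m.-tuple 'I_3 -> V) i :
  rot (symmetrize G) i = symmetrize (rot G) i.
Proof.
rewrite /symmetrize rotZ; congr (_ *: _).
transitivity (rot (fun j => \sum_(s : 'S_m) 1 *: G (tperm_tuple s j)) i).
  by apply: eq_bigr => l _; apply: eq_bigr => c _; congr (_ *: _); apply: eq_bigr => s _; rewrite scale1r.
by rewrite rot_sum; apply: eq_bigr => s _; rewrite scale1r rot_tperm.
Qed.
End Action.

(** For each position the substitution exchanging the replaced index with the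
    new one is an involution of the summation range, and [f] is antisymmetric. *)
Lemma sum_rot (V : lmodType (fps F)) a m (t : m.-tuple 'I_3 -> fps F) (G : m.-tuple 'I_3 -> V) :
  \sum_i t i *: rot a G i = - \sum_i rot (V := (fps F)^o) a t i *: G i.
Proof.
rewrite /rot -sumrN.
under eq_bigr => i _ do rewrite scaler_sumr.
under [RHS]eq_bigr => i _ do rewrite scaler_suml -sumrN.
rewrite exchange_big [RHS]exchange_big; apply: eq_bigr => l _ /=.
under eq_bigr => i _ do rewrite scaler_sumr.
under [RHS]eq_bigr => i _ do rewrite scaler_suml -sumrN.
rewrite !pair_bigA /=.
have replaceK (i : m.-tuple 'I_3) c : replace (replace i l c) l (tnth i l) = i.
  apply: eq_from_tnth => k; rewrite !tnth_mktuple; case: eqP => // ->.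
  by [].
have tnth_replace (i : m.-tuple 'I_3) c : tnth (replace i l c) l = c.
  by rewrite tnth_mktuple eqxx.
pose sw (p : m.-tuple 'I_3 * 'I_3) := (replace p.1 l p.2, tnth p.1 l).
have swK : cancel sw sw by case=> i c; rewrite /sw /= replaceK tnth_replace.
rewrite (reindex_inj (can_inj swK)) /=; apply: eq_bigr => -[i c] _ /=.
rewrite replaceK tnth_replace scalerA -scaleNr; congr (_ *: _).
by rewrite [fstr _ _ _ _](_ : _ = - fstr F a (tnth i l) c) ?rmorphN ?mulrN 1?mulrC // -fstr_rot fstrC -fstr_rot -fstr_rot.
Qed.
End Rotation.

(** * Exact invariance of the two terms *)

Section Invariance.
Variable F : numClosedFieldType.
Implicit Types (a b c d : 'I_3).
Local Notation rotS := (@rot F (fps F)^o).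

Lemma fstr_swapr a b c : fstr F a c b = - fstr F a b c.
Proof. by rewrite -fstr_rot fstrC -fstr_rot -fstr_rot. Qed.

(** The Jacobi identity, read as the invariance of the tensor [f]. *)
Lemma fstr_invariant a b c d :
  \sum_e (fstr F e c d * fstr F a e b + fstr F b e d * fstr F a e c
          + fstr F b c e * fstr F a e d) = 0.
Proof.
rewrite !big_ord_recl !big_ord0 /fstr /levi_civita.
by case: a b c d => -[|[|[|//]]] ? [[|[|[|//]]] ?] [[|[|[|//]]] ?]
   [[|[|[|//]]] ?]; rewrite /=; ring.
Qed.

(** The product of two Levi-Civita symbols; the factor is the square of
    [i sqrt 2]. *)
Lemma fstr_contract a b c d : \sum_e fstr F a b e * fstr F e c d
  = - 2 * ((a == c)%:R * (b == d)%:R - (a == d)%:R * (b == c)%:R).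
Proof.
have f2 : ('i * sqrtC 2) ^+ 2 = - 2 :> F by rewrite exprMn sqrCi sqrtCK mulN1r.
transitivity (('i * sqrtC 2) ^+ 2 * \sum_e levi_civita F a b e * levi_civita F e c d).
  by rewrite mulr_sumr; apply: eq_bigr => e _; rewrite /fstr; ring.
rewrite f2; congr (_ * _); rewrite !big_ord_recl !big_ord0 /levi_civita.
by case: a b c d => -[|[|[|//]]] ? [[|[|[|//]]] ?] [[|[|[|//]]] ?]
   [[|[|[|//]]] ?]; rewrite /=; ring.
Qed.

Lemma tuple_consP m (i : m.+1.-tuple 'I_3) : exists b j, i = cons_tuple b j.
Proof. by exists (thead i), (behead_tuple i); rewrite [LHS]tuple_eta; apply: val_inj. Qed.

(** The two indices of a pair give opposite contributions, [f] being
    antisymmetric. *)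
Lemma rot_pairing a n (i : (n.*2).-tuple 'I_3) :
  rotS a (fun j => fpsC (pairing F n j)) i = 0.
Proof.
elim: n i => [|n IH] i; first by rewrite /rot big_ord0.
have [b [i1 ->]] := @tuple_consP n.*2.+1 i; have [b' [{}i ->]] := tuple_consP i1.
have pairE b1 b2 (j : (n.*2).-tuple 'I_3) :
    fpsC (pairing F n.+1 (cons_tuple b1 (cons_tuple b2 j)))
    = fpsC (b1 == b2)%:R * fpsC (pairing F n j).
  by rewrite -rmorphM /pairing big_ord_recl.
rewrite (@rot_cons F _ a n.*2.+1 _ b (cons_tuple b' i)) rot_cons.
under eq_bigr => c _ do rewrite pairE.
under [X in _ + (X + _)]eq_bigr => c _ do rewrite pairE.
have -> : rotS a (fun j : n.*2.-tuple 'I_3 => fpsC (pairing F n.+1 (cons_tuple b (cons_tuple b' j)))) i = 0.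
  transitivity (fpsC (b == b')%:R *: rotS a (fun j => fpsC (pairing F n j)) i).
    rewrite -rotZ; apply: eq_bigr => l _; apply: eq_bigr => c _; congr (_ *: _).
    by rewrite pairE.
  by rewrite IH scaler0.
rewrite addr0.
have delta b1 b2 : \sum_c fpsC (fstr F a b1 c) *: (fpsC (c == b2)%:R * fpsC (pairing F n i) : (fps F)^o)
    = fpsC (fstr F a b1 b2) * fpsC (pairing F n i).
  rewrite (bigD1 b2) //= eqxx rmorph1 mul1r big1 ?addr0 // => c /negbTE->.
  by rewrite rmorph0 mul0r scaler0.
under [X in _ + X]eq_bigr => c _ do rewrite eq_sym.
by rewrite [X in X + _]delta [X in _ + X]delta fstr_swapr rmorphN mulNr addNr.
Qed.

Lemma rot_tinv a n (i : (n.*2).-tuple 'I_3) : rotS a (@tinv F n) i = 0.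
Proof.
transitivity (fpsC (n.*2)`!%:R^-1 *: rotS a (fun j =>
    \sum_(s : 'S_(n.*2)) (1 : fps F) *: (fpsC (pairing F n (tperm_tuple s j)) : (fps F)^o)) i).
  rewrite -rotZ; apply: eq_bigr => l _; apply: eq_bigr => c _; congr (_ *: _).
  rewrite tinvE /tinvF rmorphM rmorph_sum; congr (_ * _).
  by apply: eq_bigr => s _; rewrite scale1r.
rewrite rot_sum big1 ?scaler0 // => s _.
by rewrite (rot_tperm a s (fun j => fpsC (pairing F n j) : (fps F)^o)) rot_pairing scaler0.
Qed.

Lemma sum_tinv_rot (V : lmodType (fps F)) a n (G : (n.*2).-tuple 'I_3 -> V) :
  \sum_i tinv F i *: rot a G i = 0.
Proof. by rewrite sum_rot big1 ?oppr0 // => i _; rewrite rot_tinv scale0r. Qed.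

Lemma dX0_Iop a b p (r : int) :
  dX F a 0 (Igen b p r) = \sum_c fpsC (fstr F a b c) *: Iop F c p r.
Proof.
rewrite /dX add0r; have [->|_] := eqVneq r 0; first by rewrite !mul0r rmorph0 mulr0 scale0r subr0.
by rewrite mulr0 rmorph0 mulr0 scale0r subr0.
Qed.

Lemma Iprod_cons m b (i : m.-tuple 'I_3) :
  Iprod F (cons_tuple b i) = Iop F b 0 (-1) * Iprod F i.
Proof. exact: word_cons. Qed.

(** Zero modes have no central term, so they rotate the indices of a word
    exactly, with no reordering. *)
Lemma deriv_Iprod a m (i : m.-tuple 'I_3) :
  Defs.deriv (dX F a 0) (Iprod F i) = rot a (@Iprod F m) i.
Proof.
elim: m i => [|m IH] i.
  by rewrite /rot big_ord0 /Iprod tuple0 derivW.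
have [b [{}i ->]] := tuple_consP i.
rewrite rot_cons Iprod_cons Defs.derivM IH deriv_gen dX0_Iop mulr_suml; congr (_ + _).
  by apply: eq_bigr => c _; rewrite Iprod_cons scalerAl.
rewrite /rot mulr_sumr; apply: eq_bigr => l _; rewrite mulr_sumr; apply: eq_bigr => c _.
by rewrite Iprod_cons scalerAr.
Qed.

Lemma deriv_leading a n : Defs.deriv (dX F a 0) (leading F n) = 0.
Proof.
rewrite /leading linear_sum /= -[RHS](sum_tinv_rot a (@Iprod F n.*2)).
by apply: eq_bigr => i _; rewrite linearZ /= deriv_Iprod.
Qed.

(** The two indices contracted with [f] are those of the distinguished letters;
    [c] is the third index of [f]. *)
Definition symprod n c : tens F :=
  \sum_(i : (n.*2).-tuple 'I_3) tinv F i *: symmetrize (@Iprod F _) (cons_tuple c i).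

Definition subleading n : tens F := \sum_a \sum_b \sum_c
  fpsC (fstr F a b c) *: (Iop F a 0 (-2) * Iop F b 1 (-1) * symprod n c).

(** The indices [i] are contracted with an invariant tensor, so only the
    rotation of the free index is left. *)
Lemma deriv_symprod a n c : Defs.deriv (dX F a 0) (symprod n c)
  = \sum_d fpsC (fstr F a c d) *: symprod n d.
Proof.
rewrite /symprod linear_sum /=.
under eq_bigr => i _.
  rewrite linearZ /= [symmetrize _ _]/symmetrize linearZ linear_sum /=.
  under eq_bigr => s _ do rewrite deriv_Iprod.
  rewrite -[_ *: \sum_s _]/(symmetrize (rot a (@Iprod F _)) (cons_tuple c i)).
  rewrite -rot_symmetrize rot_cons scalerDr; over.
rewrite big_split /= sum_tinv_rot addr0.
under [RHS]eq_bigr => d _ do rewrite scaler_sumr.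
rewrite [RHS]exchange_big; apply: eq_bigr => i _ /=; rewrite scaler_sumr.
by apply: eq_bigr => d _; rewrite scalerA [RHS]scalerA [tinv F i * _]mulrC.
Qed.

Lemma deriv_subleading a n : Defs.deriv (dX F a 0) (subleading n) = 0.
Proof.
rewrite /subleading; move: (symprod n) (deriv_symprod a n) => S dS.
pose T b c d := Iop F b 0 (-2) * Iop F c 1 (-1) * S d.
have dT b c d : Defs.deriv (dX F a 0) (T b c d)
   = \sum_e (fpsC (fstr F a b e) *: T e c d + fpsC (fstr F a c e) *: T b e d
             + fpsC (fstr F a d e) *: T b c e).
  rewrite /T !Defs.derivM !deriv_gen !dX0_Iop dS.
  rewrite mulrDl !(mulr_suml, mulr_sumr) -!big_split /=.
  apply: eq_bigr => e _.
  by rewrite -!scalerAl -!scalerAr -!scalerAl.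
transitivity (\sum_b \sum_c \sum_d fpsC (fstr F b c d) *: Defs.deriv (dX F a 0) (T b c d)).
  rewrite linear_sum; apply: eq_bigr => b _; rewrite linear_sum; apply: eq_bigr => c _.
  by rewrite linear_sum; apply: eq_bigr => d _; rewrite linearZ.
pose f b c d e : fps F := fpsC (fstr F b c d) * fpsC (fstr F a b e).
pose g b c d e : fps F := fpsC (fstr F b c d) * fpsC (fstr F a c e).
pose h b c d e : fps F := fpsC (fstr F b c d) * fpsC (fstr F a d e).
transitivity (\sum_b \sum_c \sum_d \sum_e f b c d e *: T e c d
   + \sum_b \sum_c \sum_d \sum_e g b c d e *: T b e d
   + \sum_b \sum_c \sum_d \sum_e h b c d e *: T b c e).
  do 3 (rewrite -!big_split /=; apply: eq_bigr => ? _).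
  rewrite dT scaler_sumr -!big_split /=; apply: eq_bigr => e _.
  by rewrite !scalerDr !scalerA.
have -> : \sum_b \sum_c \sum_d \sum_e f b c d e *: T e c d
        = \sum_b \sum_c \sum_d \sum_e f e c d b *: T b c d.
  under eq_bigr => b _ do (under eq_bigr => c _ do rewrite exchange_big; rewrite exchange_big).
  rewrite exchange_big; apply: eq_bigr => e _ /=; rewrite exchange_big; apply: eq_bigr => c _ /=.
  by rewrite exchange_big.
have -> : \sum_b \sum_c \sum_d \sum_e g b c d e *: T b e d
        = \sum_b \sum_c \sum_d \sum_e g b e d c *: T b c d.
  apply: eq_bigr => b _; under eq_bigr => c _ do rewrite exchange_big.
  by rewrite exchange_big; apply: eq_bigr => e _ /=; rewrite exchange_big.
have -> : \sum_b \sum_c \sum_d \sum_e h b c d e *: T b c e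
        = \sum_b \sum_c \sum_d \sum_e h b c e d *: T b c d.
  by apply: eq_bigr => b _; apply: eq_bigr => c _; rewrite exchange_big.
rewrite -!big_split /=; apply: big1 => b _; rewrite -!big_split /=; apply: big1 => c _.
rewrite -!big_split /=; apply: big1 => d _; rewrite -!big_split /=.
have := congr1 (fun k => fpsC k *: T b c d) (fstr_invariant a b c d).
rewrite rmorph0 scale0r => invar; rewrite -[RHS]invar rmorph_sum scaler_suml.
by apply: eq_bigr => e _; rewrite -!scalerDl /f /g /h -!rmorphM -!rmorphD.
Qed.
End Invariance.

(** * The action of the modes to first order *)

Section Solution.
Variable F : numClosedFieldType.
Implicit Types (a b c d : 'I_3).

(** A representative of [varsigma] by an explicit tensor, on which weights and
    symbols can be computed. *)
Definition varsigma_tensor n : tens F :=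
  leading F n + (hbar * fpsC (varsigma_coef F n)) *: subleading F (n - 2).

Lemma varsigmaE n : varsigma F n = state (varsigma_tensor n).
Proof.
rewrite /varsigma /varsigma_tensor linearD linearZ /=; congr (_ + _ *: _).
  by rewrite linear_sum; apply: eq_bigr => i _; rewrite linearZ /= act_vac.
rewrite /subleading linear_sum exchange_big; apply: eq_bigr => a _ /=.
rewrite linear_sum exchange_big; apply: eq_bigr => b _ /=.
rewrite linear_sum exchange_big; apply: eq_bigr => c _ /=.
rewrite linearZ /= /symprod mulr_sumr linear_sum scaler_sumr; apply: eq_bigr => i _ /=.
by rewrite act_vac -(scalerAr (tinv F i)) [X in _ = _ *: X]linearZ /= mulrC scalerA.
Qed.

Lemma homog_Iprod m (i : m.-tuple 'I_3) : homog m%:Z m m (Iprod F i).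
Proof.
elim: m i => [|m IH] i; first by rewrite /Iprod tuple0 word_nil; exact: homog1.
have [b [j ->]] := tuple_consP i; rewrite Iprod_cons.
by rewrite intS; have := homogM (@homog_Iop F b 0 (-1)) (IH j); rewrite opprK.
Qed.

Lemma homog_symprod k c : homog k.*2.+1 k.*2.+1 k.*2.+1 (symprod F k c).
Proof.
apply: homog_sum => i _; rewrite tinvE; apply: homogZ; apply: homogZ.
by apply: homog_sum => s _; exact: homog_Iprod.
Qed.

Lemma homog_leading n : homog n.*2 n.*2 n.*2 (leading F n).
Proof. by apply: homog_sum => i _; rewrite tinvE; apply: homogZ; exact: homog_Iprod. Qed.

Lemma homog_subleading k : homog k.+2.*2 k.+2.*2 k.*2.+3 (subleading F k).
Proof.
apply: homog_sum => a _; apply: homog_sum => b _; apply: homog_sum => c _.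
apply: homogZ; have := homogM (homogM (@homog_Iop F a 0 (-2)) (@homog_Iop F b 1 (-1)))
  (@homog_symprod k c).
by rewrite !opprK (_ : 2 + 1 + _ = k.+2.*2%:Z) //; lia.
Qed.

(** The second term has one [I] less than the first, which the factor [hbar]
    makes up for; for [n = 1] its coefficient vanishes. *)
Lemma homog_varsigma n : (0 < n)%N -> homog n.*2 n.*2 n.*2 (varsigma_tensor n).
Proof.
case: n => // -[|k] _; apply: homogD; try exact: homog_leading.
  rewrite /varsigma_coef mulr1 subrr mulr0 mul0r rmorph0 mulr0 scale0r; exact: homog0.
rewrite -scalerA; apply: (@homog_hbar F _ _ k.*2.+3); apply: homogZ.
by rewrite subn2; exact: homog_subleading.
Qed.

Section Values.
Variables (A : comNzRingType) (iota : {rmorphism F -> A}).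
Implicit Types (e h : lgen -> A).

Lemma chi_symprod e k c :
  chi iota e (symprod F k c) = I1 e c * dot (I1 e) (I1 e) ^+ k.
Proof.
rewrite -[dot _ _]/(\sum_b I1 e b ^+ 2) -(sum_tinv iota) raddf_sum mulr_sumr /=.
apply: eq_bigr => i _; rewrite chiZ tinvE fpsCE chiZ fpsCE raddf_sum /= [RHS]mulrCA.
congr (_ * _); rewrite (eq_bigr (fun=> I1 e c * \prod_(b <- i) I1 e b)) => [|s _].
  rewrite sumr_const card_Sn -[X in _ * X]mulr_natl mulrA -(rmorph_nat iota) -rmorphM mulVf.
    by rewrite rmorph1 mul1r.
  by rewrite pnatr_eq0 -lt0n fact_gt0.
rewrite chi_word big_map (perm_big _ (tperm_tuple_perm s (cons_tuple c i))) /=.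
by rewrite big_cons.
Qed.

Lemma dd_word0 e h w : {in w, forall x, h x = 0} -> dd_word e h w = 0.
Proof.
elim: w => //= x w IH hw; rewrite hw ?mem_head // IH ?mul0r ?mulr0 ?addr0 // => y yw.
by rewrite hw // inE yw orbT.
Qed.

Lemma dd_symprod0 e h k c : I1 h =1 (fun=> 0) -> dd iota e h (symprod F k c) = 0.
Proof.
move=> h0; rewrite raddf_sum big1 // => i _; rewrite /= ddZ ddZ raddf_sum big1 ?mulr0 //= => s _.
by rewrite dd_wordE dd_word0 // => x /mapP[b _ ->]; exact: h0.
Qed.

Lemma dd_subleading e h k : I1 h =1 (fun=> 0) -> (forall b, h (Igen b 1 (-1)) = 0) ->
  dd iota e h (subleading F k) = \sum_a \sum_b \sum_c iota (fstr F a b c)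
    * (h (Igen a 0 (-2)) * e (Igen b 1 (-1)) * I1 e c * dot (I1 e) (I1 e) ^+ k).
Proof.
move=> h0 h0'; rewrite raddf_sum; apply: eq_bigr => a _; rewrite raddf_sum; apply: eq_bigr => b _.
rewrite raddf_sum; apply: eq_bigr => c _ /=; rewrite ddZ fpsCE; congr (_ * _).
rewrite !ddM !dd_gen h0' dd_symprod0 // chi_symprod rmorphM /= !chi_gen.
by rewrite !mulr0 !addr0 !mulrA.
Qed.
End Values.

Section FirstOrder.
Variables (e : lgen -> F) (a : 'I_3) (m : nat).
Hypotheses (e_adm : admissible e) (m_gt0 : (0 < m)%N).

(** What the central term in the action of a mode on [x] contributes at first
    order. *)
Definition central_part (x : lgen) : F := match x with
  | Igen b p r => - (r%:~R * (a == b)%:R * (m%:Z + r == 0)%:R) * e (kgen p)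
  | _ => 0 end.

(** The mode turns [x] into annihilating letters, which are then contracted
    with a letter further to the right. *)
Definition pair_part (x y : lgen) : F := match x with
  | Igen b p r => \sum_c fstr F a b c * contraction e (Igen c p (m%:Z + r)) y
  | _ => 0 end.

Definition is_I1 (x : lgen) := if x is Igen _ p r then (p == 0%N) && (r == -1) else false.

Lemma e_nonneg b p (r : int) : 0 <= r -> e (Igen b p r) = 0.
Proof. by move=> r0; apply: e_adm; rewrite /= negb_and -leNgt r0. Qed.

Let m1 : 0 <= m%:Z + -1. Proof. by lia. Qed.

Lemma chi_dX x : is_I1 x -> chi idfun e (dX F a m x) = 0.
Proof.
case: x => // b p r /andP[/eqP-> /eqP->]; rewrite /dX raddfB /= chiZ coef_hbarM0 mul0r subr0.
rewrite raddf_sum big1 // => c _.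
by rewrite /= chiZ chi_gen e_nonneg ?mulr0.
Qed.

Lemma dd_dX x y : is_I1 x -> dd idfun e (contraction e y) (dX F a m x) = 0.
Proof.
case: x => // b p r /andP[/eqP-> /eqP->]; rewrite /dX raddfB /= ddZ coef_hbarM0 mul0r subr0.
rewrite raddf_sum big1 // => c _; rewrite /= ddZ dd_gen.
by case: y => [d [|q] s|q] /=; rewrite ?m1 ?oppr0 ?mul0r mulr0.
Qed.

Lemma chi_deriv_word w : all is_I1 w -> chi idfun e (deriv_word (dX F a m) w) = 0.
Proof.
elim: w => [|x w IH] /=; first by rewrite raddf0.
by case/andP=> hx /IH hw; rewrite raddfD /= !rmorphM /= hw chi_dX // mul0r mulr0 addr0.
Qed.

Lemma dd_deriv_word w y : all is_I1 w ->
  dd idfun e (contraction e y) (deriv_word (dX F a m) w) = 0.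
Proof.
elim: w => [|x w IH] /=; first by rewrite raddf0.
case/andP=> hx hw; rewrite raddfD /= !ddM dd_dX // chi_dX // IH // chi_deriv_word //.
by rewrite !mul0r !mulr0 !addr0.
Qed.

(** To first order each letter is hit by the mode in turn. It becomes either a
    central letter, or an annihilating one that must be contracted once, with a
    letter to its right. Contractions between two creating letters leave an
    annihilating letter uncontracted, so they do not contribute. *)
Lemma Phi_deriv_word w : all is_I1 w ->
  Phi e [::] (deriv_word (dX F a m) w) 1%N
  = dd_word e central_part w + pairs_word e pair_part w.
Proof.
elim: w => [|x w IH] /=; first by rewrite linear0 coef_fps0 addr0.
case/andP=> hx hw; rewrite linearD /= coef_fpsD Phi_genM big_nil addr0 coef_fpsD coef_fpsCM IH //.
rewrite Phi_pending1 dd_deriv_word // addr0.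
suff -> : Phi e [::] (dX F a m x * word F w) 1%N
  = central_part x * \prod_(y <- w) e y + dd_word e (pair_part x) w by ring.
case: x hx => // b p r /andP[/eqP-> /eqP->].
rewrite /dX mulrBl linearB /= coef_fpsD coef_fpsN -scalerAl [Phi e [::] (_ *: _)]linearZ /= -(mulrA hbar) coef_hbarMS.
rewrite coef_fpsCM Phi_cst rmorphM /= chi_gen chi_word addrC; congr (_ + _).
  by rewrite mulrA !mulNr.
rewrite mulr_suml linear_sum coef_fps_sum -(@dd_wordE F F idfun).
rewrite (dd_sum idfun e (fstr F a b)
  (fun c => contraction e (Igen c 0 (m%:Z + -1)))).
apply: eq_bigr => c _ /=; rewrite -scalerAl linearZ /= coef_fpsCM; congr (_ * _).
by rewrite /Iop Phi_genM big_nil addr0 coef_fpsD coef_fpsCM e_nonneg // mul0r add0r Phi_pending1.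
Qed.

Lemma Phi_deriv_leading n :
  Phi e [::] (Defs.deriv (dX F a m) (leading F n)) 1%N
  = dd idfun e central_part (leading F n) + pairs idfun e pair_part (leading F n).
Proof.
rewrite [dd _ _ _ _]lin_leading [pairs _ _ _ _]lin_leading -big_split /=.
rewrite /leading [Defs.deriv _ _]linear_sum /= [Phi _ _ _]linear_sum coef_fps_sum; apply: eq_bigr => i _ /=.
rewrite !linearZ /= derivW tinvE coef_fpsCM -mulrDr Phi_deriv_word //.
by apply/allP => x /mapP[b _ ->].
Qed.

End FirstOrder.
End Solution.

(** * Closed forms of the first-order terms *)

Section Existence.
Variable F : numClosedFieldType.
Implicit Types (a b c d : 'I_3).

Definition axis a : 'I_3 -> F := fun b => (a == b)%:R.
Definition on_I (v : 'I_3 -> F) : lgen -> F := fun x => if x is Igen b _ _ then v b else 0.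

Lemma dot_axis a (x : 'I_3 -> F) : dot (axis a) x = x a.
Proof.
rewrite /dot (bigD1 a) //= /axis eqxx mul1r big1 ?addr0 // => b.
by rewrite eq_sym => /negbTE->; rewrite mul0r.
Qed.

Section FirstOrder.
Variables (e : lgen -> F) (a : 'I_3) (m : nat).
Hypotheses (e_adm : admissible e) (m_gt0 : (0 < m)%N).

Let x := I1 e.
Let q := dot x x.
Let xm c := e (Igen c 0 (m%:Z - 2)).
Let ym d := e (Igen d 1 (m%:Z - 2)).

Lemma dd_central k : dd idfun e (central_part e a m) (leading F k.+1)
  = (m == 1%N)%:R * e (kgen 0) * (2 * k.+1%:R * x a * q ^+ k).
Proof.
rewrite dd_leading -/x -/q [X in dot x X](_ : _ = fun b => (m == 1%N)%:R * e (kgen 0) * axis a b).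
  rewrite (_ : dot x _ = (m == 1%N)%:R * e (kgen 0) * x a); first by rewrite /=; ring.
  rewrite -(dot_axis a x) dotC /dot mulr_sumr; apply: eq_bigr => b _; ring.
apply/boolp.funext => b; rewrite /I1 /central_part /axis.
have -> : (m%:Z + -1 == 0) = (m == 1%N) by lia.
by ring.
Qed.

(** Both structure constants combine, so that the contraction produces the
    differentiated letter of mode [m - 2]. *)
Lemma pair_partE b b' : pair_part e a m (Igen b 0 (-1)) (Igen b' 0 (-1))
  = 2 * (axis a b' * ym b - (b == b')%:R * ym a).
Proof.
rewrite /pair_part.
have -> : \sum_c fstr F a b c * contraction e (Igen c 0 (m%:Z + -1)) (Igen b' 0 (-1))
    = - \sum_d (\sum_c fstr F a b c * fstr F c b' d) * ym d.
  rewrite -sumrN; under [RHS]eq_bigr => d _ do rewrite mulr_suml -sumrN.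
  rewrite [RHS]exchange_big; apply: eq_bigr => c _ /=.
  have -> : (0 <= m%:Z - 1) by lia.
  have -> : m%:Z - 1 - 1 = m%:Z - 2 by lia.
  by rewrite mulN1r mulrN mulr_sumr -sumrN; apply: eq_bigr => d _; rewrite mulrA.
under eq_bigr => d _ do rewrite fstr_contract -mulrA mulrBl -!mulrA.
rewrite -mulr_sumr sumrB -!mulr_sumr /axis.
have delta (g : 'I_3 -> F) z : \sum_d (z == d)%:R * g d = g z by exact: (dot_axis z g).
rewrite delta; have -> : \sum_d (a == d)%:R * ((b == b')%:R * ym d) = (b == b')%:R * ym a.
  exact: (delta (fun d => (b == b')%:R * ym d)).
by ring.
Qed.

(** The kernel splits as one symmetrized product of the axis with [ym] and
    minus [ym a] times the identity. The sum is therefore a mixed second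
    derivative of [q ^ n] minus [ym a] times its Laplacian. *)
Lemma pairs_value k : pairs idfun e (pair_part e a m) (leading F k.+1)
  = 2 * k.+1%:R * (- 2 * k.+1%:R * ym a * q ^+ k + 2 * k%:R * x a * dot x ym * q ^+ k.-1).
Proof.
(* The index set has one element for the mixed term and three for the identity. *)
pose g (j : 'I_1 + 'I_3) : lgen -> F := match j with
  | inl _ => on_I (fun b => 2 * axis a b) | inr c => on_I (fun b => - 2 * ym a * axis c b) end.
pose h (j : 'I_1 + 'I_3) : lgen -> F := match j with
  | inl _ => on_I ym | inr c => on_I (axis c) end.
have two : 2 != 0 :> F by rewrite pnatr_eq0.
apply: (mulfI two); rewrite (@pairs_leading F _ e _ g h); last first.
  move=> b b' X Y; rewrite {}/X {}/Y !pair_partE big_sumType big_ord1 /=.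
  have -> : \sum_c (- 2 * ym a * axis c b * axis c b' + axis c b * (- 2 * ym a * axis c b'))
      = - 4 * ym a * (b == b')%:R.
    rewrite (bigD1 b) //= big1 => [|c]; last first.
      by move=> /negbTE cb; rewrite /axis cb !(mulr0, mul0r) addr0.
    by rewrite /axis eqxx mulr1n; ring.
  by rewrite [b' == b]eq_sym /axis; ring.
have q_eq : k%:R * (q * q ^+ k.-1) = k%:R * q ^+ k.
  by case: k => [|k]; rewrite ?mul0r // exprS.
rewrite big_sumType big_ord1 /=.
under eq_bigr => c _ do rewrite dd2_leading.
rewrite dd2_leading /= -/x -/q.
have scal z (v w : 'I_3 -> F) : dot (I1 (on_I (fun b => z * v b))) w = z * dot v w.
  by rewrite /dot mulr_sumr; apply: eq_bigr => b _; rewrite /I1 /= mulrA.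
have scalr z (v w : 'I_3 -> F) : dot v (I1 (on_I (fun b => z * w b))) = z * dot v w.
  by rewrite dotC scal dotC.
have on_IK v : I1 (on_I v) = v by [].
under eq_bigr => c _ do rewrite scal scalr on_IK !(dotC x) !dot_axis {1}/axis eqxx mulr1.
rewrite scal scalr on_IK !dot_axis -mulr_sumr big_split /= sumr_const card_ord.
rewrite (dotC x (axis a)) dot_axis.
have -> : \sum_c 2 * k%:R * (- 2 * ym a * x c) * x c * q ^+ k.-1
   = - 4 * ym a * (k%:R * (q * q ^+ k.-1)).
  rewrite {2}/q /dot !(mulr_suml, mulr_sumr); apply: eq_bigr => c _; ring.
rewrite q_eq -[_ *+ 3]mulr_natl -[k.+1%:R]natr1; ring.
Qed.

(** Only the letter of mode [-2] survives the action of a positive mode; the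
    two tensors [f] contract. *)
Lemma dd_subleading_dX k :
  chi idfun e (Defs.deriv (dX F a m) (subleading F k))
  = - 2 * (dot xm (fun b => e (Igen b 1 (-1))) * x a - dot xm x * e (Igen a 1 (-1))) * q ^+ k.
Proof.
rewrite chi_deriv dd_subleading; first last.
- move=> b; rewrite /dX raddfB /= chiZ coef_hbarM0 mul0r subr0 raddf_sum big1 // => c _.
  by rewrite /= chiZ chi_gen e_nonneg ?mulr0 //; lia.
- by move=> b; rewrite /I1 chi_dX // /= !eqxx.
have hE b : chi idfun e (dX F a m (Igen b 0 (-2))) = \sum_c fstr F a b c * xm c.
  rewrite /dX raddfB /= chiZ coef_hbarM0 mul0r subr0 raddf_sum; apply: eq_bigr => c _ /=.
  by rewrite chiZ chi_gen fpsCE.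
under eq_bigr => b _ do under eq_bigr => c _ do under eq_bigr => d _ do rewrite hE.
transitivity (\sum_c \sum_d \sum_c' (\sum_b fstr F c d b * fstr F b c' a)
    * (xm c' * e (Igen c 1 (-1)) * x d * q ^+ k)).
  rewrite exchange_big; apply: eq_bigr => c _ /=; rewrite exchange_big; apply: eq_bigr => d _ /=.
  under [RHS]eq_bigr => c' _ do rewrite mulr_suml.
  rewrite [RHS]exchange_big; apply: eq_bigr => b _ /=.
  rewrite !mulr_suml mulr_sumr; apply: eq_bigr => c' _.
  by rewrite (fstr_rot _ b c d) (fstr_rot _ a b c') -/x -/q; ring.
under eq_bigr => c _ do under eq_bigr => d _ do under eq_bigr => c' _ do rewrite fstr_contract.
rewrite -/x -/q.
have delta (g : 'I_3 -> F) z : \sum_d (z == d)%:R * g d = g z by exact: (dot_axis z g).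
pose y c := e (Igen c 1 (-1)).
transitivity (\sum_c (- 2 * x a * q ^+ k * (xm c * y c)
    + (a == c)%:R * (2 * y c * q ^+ k * dot xm x))).
  apply: eq_bigr => c _.
  transitivity (\sum_d ((a == d)%:R * (- 2 * (xm c * y c * x d * q ^+ k))
      + (a == c)%:R * (2 * y c * q ^+ k) * (xm d * x d))).
    apply: eq_bigr => d _; rewrite -[xm c in RHS](delta xm c) -[xm d in RHS](delta xm d).
    rewrite !(mulr_suml, mulr_sumr) -big_split /=; apply: eq_bigr => c' _.
    rewrite [d == a]eq_sym [c == a]eq_sym -/(y c).
    have alg (n1 n2 n3 n4 t1 t2 t3 t4 : F) :
        - 2 * (n1 * n2 - n3 * n4) * (t1 * t2 * t3 * t4)
        = n2 * (- 2 * (n1 * t1 * t2 * t3 * t4)) + n3 * (2 * t2 * t4) * (n4 * t1 * t3) by ring.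
    exact: alg.
  rewrite big_split /= delta -mulr_sumr -/(dot xm x).
  have alg (n1 t1 t2 t3 t4 s : F) : - 2 * (t1 * t2 * t3 * t4) + n1 * (2 * t2 * t4) * s
      = - 2 * t3 * t4 * (t1 * t2) + n1 * (2 * t2 * t4 * s) by ring.
  exact: alg.
rewrite big_split /= delta -mulr_sumr -/(dot xm y).
have alg (t1 t2 t3 s1 s2 : F) : - 2 * t1 * t2 * s1 + 2 * t3 * t2 * s2
    = - 2 * (s1 * t1 - s2 * t3) * t2 by ring.
exact: alg.
Qed.
End FirstOrder.
End Existence.

(** * The explicit state is a solution *)

Section Compensation.
Variable F : numClosedFieldType.
Implicit Types (a b c d : 'I_3).

(** A tensor representing the twisted derivative. *)
Definition twist j (u : tens F) : tens F :=
  Defs.deriv (@dpartial F) u - fpsC (j%:R / 2) *: (kop F 0 * u).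

Lemma twisted_partial_state j u : twisted_partial j (state u) = state (twist j u).
Proof.
by rewrite /twisted_partial partial_state act_state /twist linearB /= stateZ.
Qed.

Lemma homog_twist j r p g u : homog r p g u -> homog r p.+1 g (twist j u).
Proof.
move=> hu; apply: homogB.
  rewrite -[r]subr0 -[p.+1]addn1; apply: homog_deriv => // x; rewrite subr0.
  case: x => [b q s|q]; rewrite wt1_gen wt2_gen nbI_gen addn1; first exact: homog_Iop.
  exact: homog_kop.
by apply: homogZ; have := homogM (@homog_kop F 0) hu; rewrite add0r; exact.
Qed.

Lemma chi_twist j (e : lgen -> F) u : chi idfun e (twist j u)
  = dd idfun e (fun x => chi idfun e (dpartial F x)) u - j%:R / 2 * e (kgen 0) * chi idfun e u.
Proof.
by rewrite raddfB /= chi_deriv chiZ fpsCE /kop [chi _ _ (_ * _)]rmorphM /= chi_gen mulrA.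
Qed.

(** By covariance under rotations, the state under the twisted derivative must
    have a multiple of [x_a q ^ k] as its symbol. *)
Definition companion a k : tens F := Iop F a 0 (-1) * leading F k.

Lemma homog_companion a k : homog k.*2.+1 k.*2.+1 k.*2.+1 (companion a k).
Proof.
by rewrite intS; have := homogM (@homog_Iop F a 0 (-1)) (@homog_leading F k); rewrite opprK; exact.
Qed.

Lemma chi_companion (e : lgen -> F) a k :
  chi idfun e (companion a k) = I1 e a * dot (I1 e) (I1 e) ^+ k.
Proof. by rewrite /companion /Iop rmorphM /= chi_gen chi_leading. Qed.

Lemma dd_companion (e : lgen -> F) a k (y := fun b => e (Igen b 1 (-1))) :
  dd idfun e (fun x => chi idfun e (dpartial F x)) (companion a k)
  = y a * dot (I1 e) (I1 e) ^+ k
    + 2 * k%:R * I1 e a * dot (I1 e) y * dot (I1 e) (I1 e) ^+ k.-1.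
Proof.
rewrite /companion /Iop ddM dd_gen chi_gen [dpartial _ _]/(gen F _) chi_gen chi_leading dd_leading.
have -> : I1 (fun x => chi idfun e (dpartial F x)) = y.
  by apply/boolp.funext => b; rewrite /I1 /= /Iop chi_gen.
rewrite -/(y a) -[e _]/(I1 e a).
have alg (t1 t2 t3 t4 s r : F) : t1 * t2 + t3 * (s * (2 * t4) * r)
   = t1 * t2 + 2 * s * t3 * t4 * r by ring.
exact: alg.
Qed.

Lemma varsigma_coefE k : varsigma_coef F k.+1
  = k.+1%:R * (2 * k.+1%:R + 1) * (2 * k%:R) / (2 * k%:R + 1).
Proof.
rewrite /varsigma_coef -natr1; have -> : 2 * (k%:R + 1) - 2 = 2 * k%:R :> F by ring.
by have -> : 2 * (k%:R + 1) - 1 = 2 * k%:R + 1 :> F by ring.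
Qed.

Definition compensator a m k : tens F :=
  if m == 1%N then fpsC (- (4 * k.+1%:R) / (2 * k%:R + 1)) *: companion a k else 0.

(** The crux of existence. For the mode one let [n = k.+1], [q = x . x], and let [y]
    and [z] be the values of the differentiated and of the central letters. The
    left-hand side is a combination of [z x_a q ^ k], [y_a q ^ k] and
    [x_a (x . y) q ^ (k - 1)]. The first fixes the coefficient of the compensator as
    [- 4 n / (2 n - 1)]; the two others then both hold for [varsigma_coef]. *)
Lemma chi_compensator (e : lgen -> F) a m k : admissible e -> (0 < m)%N ->
  Phi e [::] (Defs.deriv (dX F a m) (varsigma_tensor F k.+1)) 1%N
  = chi idfun e (twist k.*2.+1 (compensator a m k)).
Proof.
move=> e_adm m0.
rewrite /varsigma_tensor linearD linearD /= coef_fpsD Phi_deriv_leading // dd_central //.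
rewrite pairs_value // [Defs.deriv _ (_ *: _)]linearZ [Phi _ _ _]linearZ /= -(mulrA hbar) coef_hbarMS coef_fpsCM Phi_cst.
rewrite dd_subleading_dX // subSS.
have [m1|m1] := eqVneq m 1%N; last first.
  have e0 b p : e (Igen b p (m%:Z - 2)) = 0 by apply: e_nonneg => //; lia.
  rewrite /compensator (negbTE m1) chi_twist !raddf0 !mulr0 subr0 mul0r !mul0r add0r.
  have dot0 p (v : 'I_3 -> F) : dot (fun c => e (Igen c p (m%:Z - 2))) v = 0.
    by apply: big1 => b _; rewrite e0 mul0r.
  rewrite [dot (I1 e) (fun c => e (Igen c 1 _))]dotC !dot0 /= e0.
  by rewrite !(mulr0, mul0r, addr0, subr0).
rewrite /compensator {}m1 eqxx chi_twist ddZ chiZ !fpsCE dd_companion chi_companion.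
have -> : 1%:Z - 2 = -1 by [].
set x := I1 e; set y := fun b => e (Igen b 1 (-1)).
rewrite -[fun c => e _]/x -/(y a) -/x; set q := dot x x.
rewrite varsigma_coefE mul1r.
have nz : 2 * k%:R + 1 != 0 :> F by rewrite -natrM natr1 pnatr_eq0.
have -> : k.*2.+1%:R = 2 * k%:R + 1 :> F by rewrite -natr1 -mul2n natrM.
(* For [k = 0] the factor [k] makes up for the truncated exponent [k.-1]. *)
have q_eq : 2 * k%:R * q ^+ k = 2 * k%:R * (q * q ^+ k.-1).
  by case: (k) => [|k']; rewrite ?mulr0 ?mul0r // exprS.
rewrite subn1.
rewrite -[k.+1%:R]natr1.
have alg (K z xa ya xy qk qk1 q' : F) : 2 * K + 1 != 0 -> 2 * K * qk = 2 * K * (q' * qk1) ->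
    z * (2 * (K + 1) * xa * qk)
    + 2 * (K + 1) * (- 2 * (K + 1) * ya * qk + 2 * K * xa * xy * qk1)
    + (K + 1) * (2 * (K + 1) + 1) * (2 * K) / (2 * K + 1) * (- 2 * (xy * xa - q' * ya) * qk1)
  = - (4 * (K + 1)) / (2 * K + 1) * (ya * qk + 2 * K * xa * xy * qk1)
    - (2 * K + 1) / 2 * z * (- (4 * (K + 1)) / (2 * K + 1) * (xa * qk)).
  move=> {}nz {}q_eq; have two : 2 != 0 :> F by rewrite pnatr_eq0.
  have -> : (K + 1) * (2 * (K + 1) + 1) * (2 * K) / (2 * K + 1) * (- 2 * (xy * xa - q' * ya) * qk1)
    = (K + 1) * (2 * (K + 1) + 1) / (2 * K + 1)
      * (- 2 * (xy * xa * (2 * K * qk1) - ya * (2 * K * (q' * qk1)))) by field.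
  by rewrite -q_eq; field; rewrite nz.
exact: alg.
Qed.

(** The symbol of the action of a positive mode vanishes, so the action is
    divisible by [hbar]. The symbol of the quotient is the first coefficient of
    [Phi], which the twisted derivative of the compensator matches, so a second
    factor [hbar] comes out of the difference. *)
Lemma varsigma_solution a m k : exists u w,
  [/\ homog (k.+1.*2%:Z - m%:Z) k.*2.+1 k.*2.+1 u, homog (k.+1.*2%:Z - m%:Z) k.*2.+2 k.*2 w
    & Delta a m (state (varsigma_tensor F k.+1))
      = hbar ^+ 2 *: state (twist k.*2.+1 u) + hbar ^+ 3 *: state w].
Proof.
rewrite Delta_stateE; case: m => [|m].
  exists 0, 0; split; try exact: homog0.
  rewrite /varsigma_tensor [Defs.deriv _ _]linearD /= [Defs.deriv _ (_ *: _)]linearZ /=.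
  rewrite deriv_leading deriv_subleading scaler0 addr0.
  by rewrite /twist !(linear0, mulr0, scaler0, subrr, addr0).
set Y := Defs.deriv _ _; pose u := compensator a m.+1 k; exists u.
have hu : homog (k.+1.*2%:Z - m.+1%:Z) k.*2.+1 k.*2.+1 u.
  rewrite /u /compensator; case: eqP => [->|_]; last exact: homog0.
  apply: homogZ; rewrite (_ : _ - _ = k.*2.+1%:Z); first exact: homog_companion.
  by rewrite doubleS; lia.
have hY : homog (k.+1.*2%:Z - m.+1%:Z) k.*2.+2 k.*2.+2 Y.
  rewrite -[k.*2.+2 in X in homog _ X]addn0; apply: homog_deriv; first exact: homog_dX.
  exact: homog_varsigma.
have [||Y1 hY1 eY] := completeness hY; first by rewrite ltnW.
  move=> e e_adm; rewrite /Y /varsigma_tensor [Defs.deriv _ _]linearD /= [Defs.deriv _ (_ *: _)]linearZ raddfD /=.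
  rewrite chiZ.
  rewrite coef_hbarM0 mul0r addr0 /leading linear_sum raddf_sum big1 // => i _ /=.
  rewrite linearZ /= chiZ derivW chi_deriv_word ?mulr0 //.
  by apply/allP => x /mapP[b _ ->].
have : small (k.+1.*2%:Z - m.+1%:Z) k.*2.+2 k.*2 (Y1 - twist k.*2.+1 u).
  apply: completeness => //; first by apply: homogB => //; exact: homog_twist.
  move=> e e_adm; rewrite raddfB /= -chi_compensator // -/Y.
  have -> : Phi e [::] Y = hbar * Phi e [::] Y1.
    by rewrite -linearZ; apply: Phi_state => //; rewrite linearZ.
  by rewrite coef_hbarMS Phi_cst subrr.
case=> w hw ew; exists w; split=> //.
rewrite eY; have -> : Y1 = (Y1 - twist k.*2.+1 u) + twist k.*2.+1 u by rewrite subrK.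
rewrite linearD /= ew !scalerDr !scalerA addrC; congr (_ + _ *: _).
by rewrite -mulrA -expr2 -exprS.
Qed.
End Compensation.

(** * A differential equation and the cross product *)

Section Ode.
Variable F : numFieldType.
Implicit Types (g p q s : {poly F}).

Lemma poly0_by_induction g :
  (forall k, (forall j, (j < k)%N -> g`_j = 0) -> g`_k = 0) -> g = 0.
Proof.
move=> h; apply/polyP => k; rewrite coef0.
by have [n] := ubnP k; elim: n k => // n IH k kn; apply: h => j jk; apply: IH; lia.
Qed.

Lemma coefM_eq0 p g k : (forall j, (j <= k)%N -> g`_j = 0) -> (p * g)`_k = 0.
Proof.
by move=> g0; rewrite coefMr big1 // => j _; rewrite g0 ?mulr0 // -ltnS.
Qed.

(** Where the leading coefficient does not vanish the equation determines each
    coefficient of [g] from the preceding ones. *)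
Lemma ode_regular (q0 : F) q s g : q0 != 0 -> g.[0] = 0 ->
  (q0%:P + 'X * q) * g^`() = s * g -> g = 0.
Proof.
move=> nz g0 ode; apply: poly0_by_induction => -[_|k IH].
  by rewrite -horner_coef0.
have := congr1 (fun p : {poly F} => p`_k) ode.
rewrite mulrDl coefD coefCM coef_deriv -mulrA coefXM (coefM_eq0 s) // => e.
have : q0 * (g`_k.+1 *+ k.+1) = 0.
  rewrite -[RHS]e; case: (k) IH => [|k'] IH /=; first by rewrite addr0.
  by rewrite coefM_eq0 ?addr0 // => j jk; rewrite coef_deriv IH ?mul0rn //; lia.
by move/eqP; rewrite mulf_eq0 (negbTE nz) mulrn_eq0 /= => /eqP.
Qed.

(** At a simple zero of the leading coefficient a non-zero solution would
    vanish to order [d / 2], which is not an integer. *)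
Lemma ode_isotropic (q1 : F) q s g d : q1 != 0 -> odd d ->
  ('X * (q1%:P + 'X * q)) * g^`() = (d%:R * q1 / 2)%:P * g + 'X * s * g -> g = 0.
Proof.
move=> nz od ode; apply: poly0_by_induction => k IH.
have := congr1 (fun p : {poly F} => p`_k) ode.
rewrite coefD coefCM -!(mulrA 'X) !coefXM mulrDl.
have -> : (if k == 0%N then 0 else (s * g)`_k.-1) = 0.
  by case: (k) IH => [|k'] IH //=; rewrite coefM_eq0 // => j jk; apply: IH; lia.
rewrite addr0 => e.
have {}e : q1 * (2 * k%:R - d%:R) * g`_k = 0.
  have two : 2 != 0 :> F by rewrite pnatr_eq0.
  apply: (mulfI (invr_neq0 two)); rewrite mulr0.
  have -> : 2^-1 * (q1 * (2 * k%:R - d%:R) * g`_k) = q1 * (g`_k *+ k) - d%:R * q1 / 2 * g`_k.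
    by rewrite -[_ *+ k]mulr_natl; field.
  rewrite -e; case: (k) IH => [|k'] IH /=.
    by rewrite mulr0n mulr0 subrr.
  rewrite coefD coefCM coef_deriv -mulrA coefXM.
  case: k' IH => [|k''] IH /=; first by rewrite addr0 subrr.
  rewrite coefM_eq0 ?addr0 ?subrr // => j jk; rewrite coef_deriv IH ?mul0rn //; lia.
move/eqP: e; rewrite !mulf_eq0 (negbTE nz) subr_eq0 -natrM eqr_nat /=.
case/orP => [/eqP kd|/eqP //].
by move: od; rewrite -kd oddM.
Qed.
End Ode.

Section Cross.
Variable F : numClosedFieldType.
Implicit Types (x y z v alpha : 'I_3 -> F) (a b c : 'I_3).

(** The vector product, up to the factor [i sqrt 2], written with the structure
    constants. *)
Definition cross alpha v : 'I_3 -> F :=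
  fun b => \sum_a \sum_c fstr F a b c * alpha a * v c.

Lemma cross_axis a v b : cross (axis F a) v b = \sum_c fstr F a b c * v c.
Proof.
rewrite /cross (bigD1 a) //= [X in _ + X]big1 => [|a' a'a]; last first.
  by apply: big1 => c _; rewrite /axis eq_sym (negbTE a'a) mulr0 mul0r.
by rewrite addr0; apply: eq_bigr => c _; rewrite /axis eqxx mulr1.
Qed.

Lemma crossC x y b : cross x y b = - cross y x b.
Proof.
rewrite /cross exchange_big -sumrN; apply: eq_bigr => c _.
rewrite -sumrN; apply: eq_bigr => a _.
rewrite (_ : fstr F a b c = - fstr F c b a); first by ring.
by rewrite -fstr_rot fstrC fstr_rot.
Qed.

Lemma cross_self x b : cross x x b = 0.
Proof.
have two : 2 != 0 :> F by rewrite pnatr_eq0.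
apply: (mulfI two); rewrite mulr0 -[2]/(1 + 1) mulrDl mul1r {2}crossC.
exact: subrr.
Qed.

(** The triple product formula: a non-isotropic [x] splits any [z] into a
    multiple of [x] and a vector product with [x]. *)
Lemma cross_cross x z b :
  dot x x * z b = dot x z * x b + 2^-1 * cross x (cross x z) b.
Proof.
rewrite /cross.
have -> : \sum_a \sum_c fstr F a b c * x a * (\sum_a' \sum_c' fstr F a' c c' * x a' * z c')
   = \sum_a \sum_a' \sum_c' (\sum_c fstr F a b c * fstr F c c' a') * (x a * x a' * z c').
  apply: eq_bigr => a _.
  under eq_bigr => c _ do rewrite mulr_sumr.
  rewrite exchange_big; apply: eq_bigr => a' _ /=.
  under eq_bigr => c _ do rewrite mulr_sumr.
  rewrite exchange_big; apply: eq_bigr => c' _ /=.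
  rewrite mulr_suml; apply: eq_bigr => c _.
  by rewrite (fstr_rot _ a' c c'); ring.
have delta (g : 'I_3 -> F) u : \sum_d (u == d)%:R * g d = g u by exact: (dot_axis u g).
transitivity (dot x z * x b + 2^-1 * \sum_a (- 2 * x b * (x a * z a) + 2 * z b * (x a * x a))).
  rewrite big_split /= -!mulr_sumr -/(dot x z) -/(dot x x).
  have two : 2 != 0 :> F by rewrite pnatr_eq0.
  have alg (s t xb zb : F) : s * zb = t * xb + 2^-1 * (- 2 * xb * t + 2 * zb * s) by field.
  exact: alg.
congr (_ + _ * _); apply: eq_bigr => a _.
transitivity (\sum_a' ((b == a')%:R * (- 2 * (x a * x a' * z a))
    + (a == a')%:R * (2 * (x a * x a' * z b)))).
  by rewrite big_split /= !delta; ring.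
apply: eq_bigr => a' _.
transitivity (\sum_c' ((a == c')%:R * (- 2 * (b == a')%:R * (x a * x a' * z c'))
    + (b == c')%:R * (2 * (a == a')%:R * (x a * x a' * z c')))).
  by rewrite big_split /= !delta; congr (_ + _); rewrite mulrCA ?mulrA // mulNr; ring.
apply: eq_bigr => c' _; rewrite fstr_contract.
have alg (n1 n2 n3 n4 t : F) : n1 * (- 2 * n2 * t) + n3 * (2 * n4 * t)
    = - 2 * (n1 * n2 - n4 * n3) * t by ring.
exact: alg.
Qed.
End Cross.

(** * Commuting points and blocks of letters *)

Section Points.
Variable F : numClosedFieldType.
Implicit Types (g : lgen) (w : seq lgen) (u : tens F).

Section Point.
Variable A : nzRingType.
Implicit Types (x z y t : 'I_3 -> A) (kap : A).

(** A point that vanishes off the thirteen letters which can occur at first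
    order: [x] and [z] are the values at the letters without derivative of modes
    [-1] and [-2], [y] and [t] those with one derivative, [kap] the central one. *)
Definition point x z y t kap : lgen -> A := fun g =>
  match g with
  | Igen a 0 r => if r == -1 then x a else if r == -2 then z a else 0
  | Igen a 1 r => if r == -1 then y a else if r == -2 then t a else 0
  | kgen 0 => kap
  | _ => 0
  end.

Definition effective g := match g with
  | Igen _ p r => (p <= 1)%N && ((r == -1) || (r == -2)) | kgen p => p == 0%N end.

Definition depth2 g := if g is Igen _ _ r then r == -2 else false.
Definition order2 g := match g with Igen _ p _ => p == 1%N | kgen _ => true end.

Lemma point_effective x z y t kap g : ~~ effective g -> point x z y t kap g = 0.
Proof.
case: g => [a [|[|p]] r|[|p]] //=; rewrite negb_or => /andP[/negbTE-> /negbTE->] //.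
Qed.

Lemma point_admissible x z y t kap : admissible (point x z y t kap).
Proof.
move=> g ng; apply: point_effective; apply: contraNN ng.
by case: g => [a p r|p] //= /andP[-> /orP[]/eqP->].
Qed.
End Point.

(** In words of these letters, the excess of the weight over the number of
    [I] counts the letters of mode [-2]. *)
Lemma count_depth2 w : all effective w ->
  (count depth2 w)%:Z = wt1 w - (nbI w)%:Z.
Proof.
elim: w => [|g w IH]; first by rewrite /wt1 big_nil.
rewrite wt1_cons nbI_cons wt1_gen nbI_gen /= => /andP[eg /IH]; rewrite !PoszD => ->.
by case: g eg => [a p r|p] /= => [/andP[_ /orP[]/eqP->]|_] /=; lia.
Qed.

(** Likewise the excess of the second weight counts the letters with one
    derivative and the central ones. *)
Lemma count_order2 w : all effective w -> (count order2 w + nbI w = wt2 w)%N.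
Proof.
elim: w => [|g w IH]; first by rewrite /wt2 big_nil.
rewrite wt2_cons nbI_cons wt2_gen nbI_gen /= => /andP[eg /IH <-].
case: g eg => [a p r|p] /= => [/andP[p1 _]|/eqP->] /=; last by lia.
by case: p p1 => [|[|p]] //= _; lia.
Qed.

Section Supported.
Variables (A : comNzRingType) (iota : {rmorphism F -> A}).
Implicit Types (e h : lgen -> A).

Lemma eq_chi_supp e e' u : (forall w, tcoef w u 0%N != 0 ->
    \prod_(g <- w) e g = \prod_(g <- w) e' g) -> chi iota e u = chi iota e' u.
Proof.
move=> ee'; apply: eq_bigr => w _ /=; have [w0|/ee' -> //] := eqVneq (tcoef w u 0%N) 0.
by rewrite /cst_coef w0 rmorph0 !mul0r.
Qed.

Lemma prod0 e w g : g \in w -> e g = 0 -> \prod_(h <- w) e h = 0.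
Proof. by move=> gw eg; rewrite (big_rem g) //= eg mul0r. Qed.

Lemma dd_prod0 e h w g : g \in w -> e g = 0 -> h g = 0 -> dd_word e h w = 0.
Proof.
elim: w => // g' w IH; rewrite inE /= => /orP[/eqP <-|gw] eg hg.
  by rewrite eg hg !mul0r addr0.
by rewrite IH // mulr0 addr0 (prod0 gw eg) mulr0.
Qed.

(** The symbol is then linear in the values taken on [P], so that it equals
    its derivative in their direction. *)
Lemma dd_word_single (P : pred lgen) e e' w : count P w = 1%N ->
  (forall g, ~~ P g -> e g = e' g) ->
  dd_word e (fun g => if P g then e' g else 0) w = \prod_(g <- w) e' g.
Proof.
move=> + ee'; elim: w => //= g w IH; rewrite big_cons.
case: (boolP (P g)) => Pg /=; last by move=> /IH->; rewrite mul0r add0r ee'.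
case=> c0; have nP : forall g, g \in w -> ~~ P g.
  move=> g' gw; apply/negP => Pg'; have : has P w by apply/hasP; exists g'.
  by rewrite has_count -[count P w]/(0 + count P w)%N c0.
have -> : dd_word e (fun g => if P g then e' g else 0) w = 0.
  elim: (w) nP => //= g' s IHs nP; rewrite (negbTE (nP _ (mem_head _ _))) IHs.
    by rewrite mul0r mulr0 addr0.
  by move=> g2 g2s; apply: nP; rewrite inE g2s orbT.
by rewrite mulr0 addr0; congr (_ * _); apply: eq_big_seq => g' /nP/ee'.
Qed.

Lemma dd_single (P : pred lgen) e e' u :
  (forall g, ~~ effective g -> e g = 0 /\ e' g = 0) ->
  (forall w, all effective w -> tcoef w u 0%N != 0 -> count P w = 1%N) ->
  (forall g, ~~ P g -> e g = e' g) ->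
  dd iota e (fun g => if P g then e' g else 0) u = chi iota e' u.
Proof.
move=> ne cP ee'; apply: eq_bigr => w _ /=.
have [w0|w0] := eqVneq (tcoef w u 0%N) 0.
  by rewrite /cst_coef w0 rmorph0 !mul0r.
congr (_ * _); have [/cP cw|/allPn[g gw ng]] := boolP (all effective w).
  by rewrite dd_word_single // cw.
have [eg e'g] := ne g ng.
by rewrite (dd_prod0 gw) ?e'g ?if_same // (prod0 gw).
Qed.
End Supported.
End Points.

(** * Symbols invariant under rotations *)

Section Invariants.
Variable F : numClosedFieldType.
Implicit Types (g : lgen) (w : seq lgen) (u : tens F) (x v : 'I_3 -> F).

Definition invariant u :=
  forall a (e : lgen -> F), admissible e -> chi idfun e (Defs.deriv (dX F a 0) u) = 0.

Lemma dot_addl (x y z : 'I_3 -> F) t : dot (fun c => x c + t * y c) z = dot x z + t * dot y z.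
Proof.
rewrite /dot mulr_sumr -big_split /=; apply: eq_bigr => c _.
by rewrite mulrDl mulrA.
Qed.

Lemma dot_addr (x y z : 'I_3 -> F) t : dot z (fun c => x c + t * y c) = dot z x + t * dot z y.
Proof. by rewrite dotC dot_addl ![dot _ z]dotC. Qed.

Lemma chi_dX_gen (e : lgen -> F) a (m : nat) b p r :
  chi idfun e (dX F a m (Igen b p r)) = cross (axis F a) (fun c => e (Igen c p (m%:Z + r))) b.
Proof.
rewrite cross_axis /dX raddfB /= chiZ coef_hbarM0 mul0r subr0 raddf_sum; apply: eq_bigr => c _ /=.
by rewrite chiZ chi_gen fpsCE.
Qed.

(** [dd] is linear in the direction, so the axis of the rotation may be any
    vector, and in particular may depend on the point. *)
Lemma dd_invariant u (alpha x z y t : 'I_3 -> F) kap : invariant u ->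
  dd idfun (point x z y t kap)
    (point (cross alpha x) (cross alpha z) (cross alpha y) (cross alpha t) 0) u = 0.
Proof.
move=> inv; set e := point x z y t kap.
have inv_a a : dd idfun e (fun g => chi idfun e (dX F a 0 g)) u = 0.
  by rewrite -chi_deriv; apply: inv; exact: point_admissible.
transitivity (\sum_a alpha a * dd idfun e (fun g => chi idfun e (dX F a 0 g)) u); last first.
  by apply: big1 => a _; rewrite inv_a mulr0.
rewrite -dd_sum; apply: eq_dd => // -[b p r|p]; last first.
  by rewrite /= big1 => [|a _]; rewrite ?raddf0 ?mulr0 //; case: p.
under eq_bigr => a _ do rewrite chi_dX_gen cross_axis add0r mulr_sumr.
have crossE (s : 'I_3 -> F) : cross alpha s b
    = \sum_a \sum_c alpha a * (fstr F a b c * s c).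
  by apply: eq_bigr => a _; apply: eq_bigr => c _; rewrite mulrA [alpha a * _]mulrC.
have zero : \sum_a \sum_c alpha a * (fstr F a b c * 0) = 0.
  by apply: big1 => a' _; apply: big1 => c _; rewrite !mulr0.
case: p => [|[|p]] /=; last by rewrite zero.
  by case: (r == -1); [rewrite crossE | case: (r == -2); [rewrite crossE | by rewrite zero]].
by case: (r == -1); [rewrite crossE | case: (r == -2); [rewrite crossE | by rewrite zero]].
Qed.

(** Euler's identity for the gradation by the number of [I]. *)
Lemma dd_euler (e : lgen -> F) d u : (forall w, tcoef w u 0%N != 0 -> nbI w = d) ->
  dd idfun e (fun g => if g is Igen _ _ _ then e g else 0) u = d%:R * chi idfun e u.
Proof.
move=> hd; rewrite /dd /chi /lin mulr_sumr; apply: eq_bigr => w _ /=.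
have [w0|/hd <-] := eqVneq (tcoef w u 0%N) 0.
  by rewrite /cst_coef w0 !mul0r mulr0.
rewrite mulrCA; congr (_ * _); elim: w => [|g w IH]; first by rewrite mul0r.
by rewrite nbI_cons nbI_gen natrD /= IH big_cons; case: g => *; ring.
Qed.

Section Pattern.
Variables (b1 b2 b3 b4 : F).

(** All the vectors of the point are multiples of a single one: rotations then
    act by rotating that vector, and the central letter is fixed. *)
Definition diagonal v kap : lgen -> F := point
  (fun c => b1 * v c) (fun c => b2 * v c) (fun c => b3 * v c) (fun c => b4 * v c) kap.

Lemma diagonalD x v kap t g :
  diagonal (fun c => x c + t * v c) kap g = diagonal x kap g + t * diagonal v 0 g.
Proof.
case: g => [a [|[|p]] r|[|p]] /=; try (by rewrite mulr0 addr0).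
all: by case: ifP => _; [|case: ifP => _]; rewrite ?mulr0 ?addr0 // mulrDr mulrCA.
Qed.

Lemma eq_diagonal x v kap : x =1 v -> diagonal x kap =1 diagonal v kap.
Proof. by move=> xv [a [|[|p]] r|[|p]] //=; rewrite !xv. Qed.

Variables (kap : F) (d : nat) (u : tens F).
Hypothesis nbI_u : forall w, tcoef w u 0%N != 0 -> nbI w = d.
Hypothesis inv_u : invariant u.

(** [(x . x) v] is [(x . v) x] plus an infinitesimal rotation of [x]. Along the
    first Euler's identity applies, along the second the symbol is constant. *)
Lemma dd_diagonal x v :
  dot x x * dd idfun (diagonal x kap) (diagonal v 0) u
  = dot x v * d%:R * chi idfun (diagonal x kap) u.
Proof.
(* The part of [v] orthogonal to [x] is a rotation of [x], about their vector product. *)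
have rot0 : dd idfun (diagonal x kap) (diagonal (cross (cross x v) x) 0) u = 0.
  rewrite -[RHS](@dd_invariant u (cross x v) (fun c => b1 * x c) (fun c => b2 * x c)
    (fun c => b3 * x c) (fun c => b4 * x c) kap inv_u).
  apply: eq_dd => // g.
  have crossZ (b : F) : cross (cross x v) (fun c => b * x c) =1 fun c => b * cross (cross x v) x c.
    move=> c; rewrite {1 3}/cross mulr_sumr; apply: eq_bigr => a _.
    by rewrite mulr_sumr; apply: eq_bigr => c' _; rewrite mulrCA.
  by case: g => [a [|[|p]] r|[|p]] //=; rewrite !crossZ.
transitivity (dd idfun (diagonal x kap) (fun g => dot x v * diagonal x 0 g
    + (- 2^-1 * diagonal (cross (cross x v) x) 0 g + 0)) u); last first.
  rewrite dd_linear dd_linear dd_0 rot0 mulr0 !addr0 -mulrA; congr (_ * _).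
  rewrite -dd_euler //; apply: eq_dd => // g.
  by case: g => [a p r|p] //=; case: p.
transitivity (dd idfun (diagonal x kap) (fun g => dot x x * diagonal v 0 g + 0) u).
  by rewrite dd_linear dd_0 addr0.
apply: eq_dd => // g.
have E c : dot x x * v c = dot x v * x c + - 2^-1 * cross (cross x v) x c.
  by rewrite cross_cross crossC mulrN mulNr.
rewrite !addr0; case: g => [a p r|p]; last by case: p => [|p]; rewrite /diagonal /= !mulr0 addr0.
by case: p => [|[|p]] /=; try (case: ifP => _; [|case: ifP => _]);
  rewrite ?mulr0 ?addr0 // mulrCA E; ring.
Qed.

Let path x v := chi (polyC \o idfun) (line (diagonal x kap) (diagonal v 0)) u.

Lemma horner_path x v t : (path x v).[t] = chi idfun (diagonal (fun c => x c + t * v c) kap) u.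
Proof.
rewrite horner_chi; apply: eq_chi => g; rewrite diagonalD !hornerE.
by [].
Qed.

(** Restricted to the line through [x] along [v], an invariant symbol satisfies
    [q g' = d (q' / 2) g], where [q] is the square of the moving vector. *)
Lemma path_ode x v :
  ((dot x x)%:P + 'X * ((2 * dot x v)%:P + 'X * (dot v v)%:P)) * (path x v)^`()
  = (d%:R * dot x v)%:P * path x v + 'X * (d%:R * dot v v)%:P * path x v.
Proof.
apply/eqP; rewrite -subr_eq0; apply/eqP; apply: poly_fun0 => t.
pose X c := x c + t * v c.
have dE : (path x v)^`().[t] = dd idfun (diagonal X kap) (diagonal v 0) u.
  rewrite chi_deriv_poly horner_dd; apply: eq_dd => g.
    by rewrite diagonalD !hornerE.
  by rewrite deriv_line hornerC.
have e := dd_diagonal X v.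
rewrite hornerD hornerN [X in X - _]hornerM dE [X in _ - X]hornerD !hornerM horner_path -/X.
rewrite !hornerE /=.
have -> : dot x x + t * (2 * dot x v + t * dot v v) = dot X X.
  by rewrite /X dot_addl !dot_addr [dot v x]dotC; ring.
rewrite e /X dot_addl.
move: (dot x v) (dot v v) (chi _ _ _) => *; ring.
Qed.

(** An invariant is determined by its value at one non-isotropic vector,
    because any vector is joined to it by a line. *)
Lemma invariant_regular x : dot x x != 0 -> chi idfun (diagonal x kap) u = 0 ->
  forall v, chi idfun (diagonal v kap) u = 0.
Proof.
move=> xx x0 v; pose y c := v c - x c.
have path0 : path x y = 0.
  apply: (ode_regular (q := (2 * dot x y)%:P + 'X * (dot y y)%:P)
    (s := (d%:R * dot x y)%:P + 'X * (d%:R * dot y y)%:P) xx).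
    by rewrite horner_path -[RHS]x0; apply: eq_chi; apply: eq_diagonal => c; rewrite mul0r addr0.
  by rewrite path_ode mulrDl.
have := horner_path x y 1; rewrite path0 horner0 => ->; apply: eq_chi; apply: eq_diagonal => c.
by rewrite mul1r /y addrC subrK.
Qed.

(** The isotropic vectors span the whole space. *)
Lemma exists_isotropic v : (exists c, v c != 0) -> exists2 x, dot x x = 0 & dot x v != 0.
Proof.
move=> [c vc].
pose o (i j : F) (k : F) : 'I_3 -> F := fun c => if c == ord0 then i else if c == 1 then j else k.
have oE i j k v' : dot (o i j k) v' = i * v' 0 + j * v' 1 + k * v' 2.
  rewrite /dot !big_ord_recl big_ord0 addr0 /o /= addrA.
  by congr (_ * v' _ + _ * v' _ + _ * v' _); apply: val_inj.
have iso i j k : i ^+ 2 + j ^+ 2 + k ^+ 2 = 0 -> dot (o i j k) (o i j k) = 0.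
  by rewrite oE /o /= !expr2.
have [n1|] := boolP (dot (o 1 'i 0) v != 0).
  by exists (o 1 'i 0) => //; apply: iso; rewrite sqrCi; ring.
have [n2|] := boolP (dot (o 1 (- 'i) 0) v != 0).
  by exists (o 1 (- 'i) 0) => //; apply: iso; rewrite sqrrN sqrCi; ring.
rewrite !negbK !oE => /eqP e1 /eqP e2.
have two : 2 != 0 :> F by rewrite pnatr_eq0.
have v0 : v 0 = 0.
  apply: (mulfI two); rewrite mulr0.
  transitivity ((1 * v 0 + - 'i * v 1 + 0 * v 2) + (1 * v 0 + 'i * v 1 + 0 * v 2)); first by ring.
  by rewrite e1 e2 addr0.
have v1 : v 1 = 0.
  apply: (mulfI (mulf_neq0 two (neq0Ci F))); rewrite mulr0.
  transitivity ((1 * v 0 + 'i * v 1 + 0 * v 2) - (1 * v 0 + - 'i * v 1 + 0 * v 2)); first by ring.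
  by rewrite e1 e2 subr0.
exists (o 0 1 'i); first by apply: iso; rewrite sqrCi; ring.
rewrite oE v0 v1 !mulr0 !add0r mulf_neq0 ?neq0Ci //.
apply: contraNneq vc => v2; have : c \in [:: 0; 1; 2].
  by case: c => -[|[|[|//]]].
by rewrite !inE => /or3P[]/eqP->; rewrite ?v0 ?v1 ?v2.
Qed.

(** The line to [v] is started at an isotropic vector not orthogonal to [v]. *)
Lemma invariant_odd v : odd d -> (exists c, v c != 0) -> chi idfun (diagonal v kap) u = 0.
Proof.
move=> od /exists_isotropic[x xx xv]; pose y c := v c - x c.
have xy : 2 * dot x y != 0.
  have -> : dot x y = dot x v.
    have -> : y = (fun c => v c + - 1 * x c) by apply/boolp.funext => c; rewrite mulN1r.
    by rewrite dot_addr xx mulr0 addr0.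
  by rewrite mulf_neq0 // pnatr_eq0.
have path0 : path x y = 0.
  apply: (ode_isotropic (q := (dot y y)%:P) (s := (d%:R * dot y y)%:P) xy od).
  rewrite -[X in X * _](add0r _) -[0 in LHS](polyC0 F) -{1}xx path_ode.
  congr (_%:P * _ + _); rewrite mulrCA mulrAC divff ?mul1r // ?pnatr_eq0 //.
have := horner_path x y 1; rewrite path0 horner0 => ->; apply: eq_chi; apply: eq_diagonal => c.
by rewrite mul1r /y addrC subrK.
Qed.
End Pattern.
End Invariants.

(** * Vanishing of the first-order symbol *)

Section Uniqueness.
Variable F : numClosedFieldType.
Implicit Types (g : lgen) (w : seq lgen) (x z y t alpha : 'I_3 -> F) (kap s : F).
Local Notation vec0 := (fun _ : 'I_3 => 0 : F).

Lemma point_linear s x z y t kap x' z' y' t' kap' g :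
  point (fun c => s * x c + x' c) (fun c => s * z c + z' c) (fun c => s * y c + y' c)
        (fun c => s * t c + t' c) (s * kap + kap') g
  = s * point x z y t kap g + point x' z' y' t' kap' g.
Proof.
by case: g => [a [|[|p]] r|[|p]] /=; try (case: (r == -1); [|case: (r == -2)]);
  rewrite ?mulr0 ?addr0.
Qed.

Lemma eq_point x z y t kap x' z' y' t' kap' :
  x =1 x' -> z =1 z' -> y =1 y' -> t =1 t' -> kap = kap' ->
  point x z y t kap =1 point x' z' y' t' kap'.
Proof. by move=> ex ez ey et -> [a [|[|p]] r|[|p]] //=; rewrite ?ex ?ez ?ey ?et. Qed.

Lemma cross0 x : cross x vec0 =1 vec0.
Proof. by move=> b; apply: big1 => a _; apply: big1 => c _; rewrite mulr0. Qed.

Lemma point0 g : point vec0 vec0 vec0 vec0 0 g = 0 :> F.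
Proof. by case: g => [a [|[|p]] r|[|p]] //=; rewrite !if_same. Qed.

Lemma leq_nbI_wt1 w : all normal_gen w -> (nbI w)%:Z <= wt1 w.
Proof.
elim: w => [|g w IH]; first by rewrite /wt1 big_nil.
rewrite wt1_cons nbI_cons wt1_gen nbI_gen /= => /andP[ng /IH].
by case: g ng => [a p r|p] /=; [move=> /andP[r0 _]|]; lia.
Qed.

Lemma all_rem (P : pred lgen) g w : all P w -> all P (rem g w).
Proof. by move=> /allP Pw; apply/allP => h /mem_rem/Pw. Qed.

(** A word with as many [I] as both its weights consists, if it is normal, of
    letters of mode [-1] without derivative, so the symbol depends on one vector. *)
Lemma leading_vanishes N (u : tens F) : homog N%:Z N N u -> invariant u ->
  chi idfun (point (axis F 0) vec0 vec0 vec0 0) u = 0 ->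
  forall e, admissible e -> chi idfun e u = 0.
Proof.
move=> hu u_inv u0 e e_adm.
have supp w : tcoef w u 0%N != 0 -> [/\ wt1 w = N%:Z, wt2 w = N & nbI w = N] by exact: hu.
have diag x : diagonal 1 0 0 0 x 0 =1 point x vec0 vec0 vec0 0.
  by apply: eq_point => // c; rewrite ?mul1r ?mul0r.
have -> : chi idfun e u = chi idfun (diagonal 1 0 0 0 (I1 e) 0) u.
  rewrite (eq_chi _ _ (diag _)); apply: eq_chi_supp => w /supp[w1 w2 wN].
  have [nw|/allPn[g gw ng]] := boolP (all normal_gen w); last first.
    by rewrite !(prod0 gw) ?e_adm // point_admissible.
  apply: eq_big_seq => g gw; have pe := perm_to_rem gw.
  have := leq_nbI_wt1 (all_rem g nw); have := leq_nbI_wt2 (rem g w).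
  have := wt1_perm pe; have := wt2_perm pe; have := nbI_perm pe.
  rewrite w1 w2 wN wt1_cons wt2_cons nbI_cons wt1_gen wt2_gen nbI_gen.
  have := allP nw _ gw; case: g {gw pe} => [a p r|p] /=; last by lia.
  move=> /andP[r0 p1] e1 e2 e3 le2 le1.
  have -> : p = 0%N by lia.
  by have -> : r = -1 by lia.
apply: (@invariant_regular _ 1 0 0 0 0 N u _ u_inv (axis F 0)).
- by move=> w /supp[].
- by rewrite dot_axis /axis eqxx oner_eq0.
- by rewrite (eq_chi _ _ (diag _)).
Qed.

Section FirstOrderTerm.
Variables (d : nat) (u : tens F).
Hypothesis d_odd : odd d.
Hypothesis u_supp : forall w, tcoef w u 0%N != 0 ->
  [/\ wt1 w = d.+1%:Z, wt2 w = d.+1 & nbI w = d].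
Hypothesis u_inv : invariant u.

Let G x z y t kap := chi idfun (point x z y t kap) u.

(** The symbol is linear in [(z, t)], the weight of a word exceeding its number
    of [I] by one. *)
Lemma dd_depth x z0 y t0 kap z t :
  dd idfun (point x z0 y t0 kap) (point vec0 z vec0 t 0) u = G x z y t kap.
Proof.
rewrite /G -(dd_single idfun (P := depth2) (e := point x z0 y t0 kap)).
- apply: eq_dd => // -[a [|[|p]] r|[|p]] //=; last by rewrite if_same.
    by have [->|_] := eqVneq r (-1) => //; case: (r == -2).
  by have [->|_] := eqVneq r (-1) => //; case: (r == -2).
- by move=> g ng; rewrite !point_effective.
- move=> w /count_depth2 e /u_supp[w1 _ wd]; apply/eqP; rewrite -eqz_nat e w1 wd.
  by rewrite intS addrK.
- by move=> [a [|[|p]] r|[|p]] //= /negbTE ->.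
Qed.

(** The symbol is linear in [(y, t, kap)] for the same reason, with the second
    weight. *)
Lemma dd_order x z y0 t0 kap0 y t kap :
  dd idfun (point x z y0 t0 kap0) (point vec0 vec0 y t kap) u = G x z y t kap.
Proof.
rewrite /G -(dd_single idfun (P := order2) (e := point x z y0 t0 kap0)).
- by apply: eq_dd => // -[a [|[|p]] r|[|p]] //=; rewrite !if_same.
- by move=> g ng; rewrite !point_effective.
- move=> w /count_order2 e /u_supp[_ w2 wd]; apply/eqP.
  by rewrite -(eqn_add2r (nbI w)) e w2 wd add1n.
- by move=> [a [|[|p]] r|p].
Qed.

Lemma depth_linear x z y t kap s z' t' :
  G x (fun c => s * z c + z' c) y (fun c => s * t c + t' c) kap
  = s * G x z y t kap + G x z' y t' kap.
Proof.
rewrite -!(dd_depth x vec0 y vec0) -dd_linear; apply: eq_dd => // g.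
rewrite -point_linear; apply: eq_point => // [c|c|]; by rewrite mulr0 addr0.
Qed.

Lemma order_linear x z y t kap s y' t' kap' :
  G x z (fun c => s * y c + y' c) (fun c => s * t c + t' c) (s * kap + kap')
  = s * G x z y t kap + G x z y' t' kap'.
Proof.
rewrite -!(dd_order x z vec0 vec0 0) -dd_linear; apply: eq_dd => // g.
by rewrite -point_linear; apply: eq_point => // c; rewrite mulr0 addr0.
Qed.

Lemma eq_G x z y t kap x' z' y' t' :
  x =1 x' -> z =1 z' -> y =1 y' -> t =1 t' -> G x z y t kap = G x' z' y' t' kap.
Proof. by move=> *; apply: eq_chi; apply: eq_point. Qed.

Lemma depth0 x y kap : G x vec0 y vec0 kap = 0.
Proof.
by rewrite -(dd_depth x vec0 y vec0) -[RHS](dd_0 idfun (point x vec0 y vec0 kap) u);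
  apply: eq_dd => // g; rewrite point0.
Qed.

Lemma order0 x z : G x z vec0 vec0 0 = 0.
Proof.
by rewrite -(dd_order x z vec0 vec0 0) -[RHS](dd_0 idfun (point x z vec0 vec0 0) u);
  apply: eq_dd => // g; rewrite point0.
Qed.

(** Being linear both in [(z, t)] and in [(y, t, kap)], the symbol is a sum of
    three blocks, in which [z] is paired with [kap], [z] is paired with [y], and [t]
    stands alone. *)
Lemma G_split x z y t kap :
  G x z y t kap = kap * G x z vec0 vec0 1 + G x z y vec0 0 + G x vec0 vec0 t 0.
Proof.
have -> : G x z y t kap = kap * G x z vec0 vec0 1 + G x z y t 0.
  rewrite -order_linear; apply: eq_chi; apply: eq_point => // [c|c|].
  - by rewrite mulr0 add0r.
  - by rewrite mulr0 add0r.
  - by rewrite mulr1 addr0.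
rewrite -addrA; congr (_ + _).
have -> : G x z y t 0 = 1 * G x z y vec0 0 + G x z vec0 t 0.
  rewrite -order_linear; apply: eq_chi; apply: eq_point => // [c|c|].
  - by rewrite mul1r addr0.
  - by rewrite mulr0 add0r.
  - by rewrite mulr0 addr0.
rewrite mul1r; congr (_ + _).
have -> : G x z vec0 t 0 = 1 * G x z vec0 vec0 0 + G x vec0 vec0 t 0.
  rewrite -depth_linear; apply: eq_G => // c; first by rewrite mul1r addr0.
  by rewrite mulr0 add0r.
by rewrite order0 mulr0 add0r.
Qed.

(** The rotation with axis [x] fixes [x], so it only moves the other vectors. *)
Lemma inv_self x z y t kap :
  dd idfun (point x z y t kap) (point vec0 (cross x z) (cross x y) (cross x t) 0) u = 0.
Proof.
rewrite -[RHS](@dd_invariant F u x x z y t kap u_inv); apply: eq_dd => //.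
by apply: eq_point => // c; rewrite cross_self.
Qed.

Lemma nonisotropic_neq0 x : dot x x != 0 -> exists c, x c != 0.
Proof.
move=> nz; apply/existsP; apply: contraNT nz; rewrite negb_exists => /forallP x0.
by apply/eqP/big1 => c _; have := x0 c; rewrite negbK => /eqP->; rewrite mulr0.
Qed.

(** There is an odd number of factors [I]. *)
Lemma G_diagonal b1 b2 b3 b4 kap x : dot x x != 0 ->
  G (fun c => b1 * x c) (fun c => b2 * x c) (fun c => b3 * x c) (fun c => b4 * x c) kap = 0.
Proof.
move=> xx; apply: (invariant_odd b1 b2 b3 b4 kap (d := d)) => //.
  by move=> w /u_supp[].
exact: nonisotropic_neq0.
Qed.

Lemma double_cross x z : dot x x != 0 ->
  (fun c => dot x x * z c + 0) =1
  (fun c => dot x z * x c + (2^-1 * cross x (cross x z) c + 0)).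
Proof. by move=> _ c; rewrite !addr0 cross_cross. Qed.

Lemma central_cross x z : G x (cross x z) vec0 vec0 1 = 0.
Proof.
rewrite -(dd_depth x z vec0 vec0) -[RHS](inv_self x z vec0 vec0 1).
by apply: eq_dd => //; apply: eq_point => // c; rewrite cross0.
Qed.

(** In the first block [z] may be replaced by [x] or by a vector product with
    [x]: the former vanishes by parity, the latter by rotation about [x]. *)
Lemma central_block x z : dot x x != 0 -> G x z vec0 vec0 1 = 0.
Proof.
move=> xx; apply: (mulfI xx); rewrite mulr0.
have A2 : G x x vec0 vec0 1 = 0.
  by rewrite -[RHS](@G_diagonal 1 1 0 0 1 x xx); apply: eq_G => c; rewrite ?mul1r ?mul0r.
transitivity (dot x x * G x z vec0 vec0 1 + G x vec0 vec0 vec0 1); first by rewrite depth0 addr0.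
rewrite -depth_linear.
transitivity (dot x z * G x x vec0 vec0 1
  + (2^-1 * G x (cross x (cross x z)) vec0 vec0 1 + G x vec0 vec0 vec0 1)).
  rewrite -!depth_linear; apply: eq_G => // c; first exact: double_cross.
  by rewrite !mulr0 !addr0.
by rewrite central_cross A2 depth0 !mulr0 !addr0.
Qed.

Lemma second_block x t : dot x x != 0 -> G x vec0 vec0 t 0 = 0.
Proof.
move=> xx; apply: (mulfI xx); rewrite mulr0.
have B1 t' : G x vec0 vec0 (cross x t') 0 = 0.
  rewrite -(dd_depth x vec0 vec0 t') -[RHS](inv_self x vec0 vec0 t' 0).
  by apply: eq_dd => //; apply: eq_point => // c; rewrite cross0.
have B2 : G x vec0 vec0 x 0 = 0.
  by rewrite -[RHS](@G_diagonal 1 0 0 1 0 x xx); apply: eq_G => c; rewrite ?mul1r ?mul0r.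
transitivity (dot x x * G x vec0 vec0 t 0 + G x vec0 vec0 vec0 0); first by rewrite depth0 addr0.
rewrite -depth_linear.
transitivity (dot x t * G x vec0 vec0 x 0
  + (2^-1 * G x vec0 vec0 (cross x (cross x t)) 0 + G x vec0 vec0 vec0 0)).
  rewrite -!depth_linear; apply: eq_G => // c; last exact: double_cross.
  by rewrite !mulr0 !addr0.
by rewrite B1 B2 depth0 !mulr0 !addr0.
Qed.

(** The same argument in the second block, when [z] is [x]. *)
Lemma mixed_block_radial x y : dot x x != 0 -> G x x y vec0 0 = 0.
Proof.
move=> xx; apply: (mulfI xx); rewrite mulr0.
have C1 y' : G x x (cross x y') vec0 0 = 0.
  rewrite -(dd_order x x y' vec0 0) -[RHS](inv_self x x y' vec0 0).
  apply: eq_dd => //; apply: eq_point => // c; [by rewrite cross_self|by rewrite cross0].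
have C2 : G x x x vec0 0 = 0.
  by rewrite -[RHS](@G_diagonal 1 1 1 0 0 x xx); apply: eq_G => c; rewrite ?mul1r ?mul0r.
transitivity (dot x x * G x x y vec0 0 + G x x vec0 vec0 0); first by rewrite order0 addr0.
rewrite -order_linear.
transitivity (dot x y * G x x x vec0 0
  + (2^-1 * G x x (cross x (cross x y)) vec0 0 + G x x vec0 vec0 0)).
  rewrite -!order_linear; apply: eq_chi; apply: eq_point => // [c|c|].
  - exact: double_cross.
  - by rewrite !mulr0 !addr0.
  - by rewrite !mulr0 !addr0.
by rewrite C1 C2 order0 !mulr0 !addr0.
Qed.

Section FirstMode.
Variable ua : 'I_3 -> tens F.
Hypothesis ua_supp : forall a w, tcoef w (ua a) 0%N != 0 -> wt1 w = d%:Z /\ wt2 w = d.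
Hypothesis first_mode : forall a (e : lgen -> F), admissible e ->
  chi idfun e (Defs.deriv (dX F a 1) u) = chi idfun e (twist d (ua a)).

Let U a x := chi idfun (point x vec0 vec0 vec0 1) (ua a).

(** The weights leave no room for letters other than those of mode [-1] without
    derivative. *)
Lemma chi_ua a x y kap : chi idfun (point x vec0 y vec0 kap) (ua a) = U a x.
Proof.
apply: eq_chi_supp => w /ua_supp[w1 w2].
pose shallow g := effective g && ~~ depth2 g.
have [sw|/allPn[g gw ng]] := boolP (all shallow w); last first.
  have pt0 y' kap' : point x vec0 y' vec0 kap' g = 0 :> F.
    case: g ng {gw} => [b [|[|p]] r|[|p]] //=; rewrite /shallow /=;
      by have [->|_] := eqVneq r (-1) => //=; rewrite if_same.
  by rewrite !(prod0 gw) // pt0.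
have ew : all effective w by apply: sub_all sw => g /andP[].
have := count_order2 ew; have := count_depth2 ew.
have -> : count depth2 w = 0%N.
  apply/eqP; rewrite -leqn0 leqNgt -has_count; apply/negP => /hasP[g gw dg].
  by have /andP[_] := allP sw _ gw; rewrite dg.
rewrite w1 w2 => /eqP; rewrite eq_sym subr_eq0 => /eqP[<-] c0.
have {}c0 : count order2 w = 0%N by lia.
apply: eq_big_seq => g gw; have /andP[eg dg] := allP sw _ gw.
have : ~~ order2 g.
  by apply: contraT; rewrite negbK => og; have : has order2 w by [apply/hasP; exists g];
     rewrite has_count c0.
by case: g eg dg {gw} => [b [|[|p]] r|p].
Qed.

(** At a point with [z = t = 0] the action of the first mode replaces [z] and
    [t] by the rotated [x] and [y], while the derivative replaces [x] by [y]. *)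
Lemma first_mode_point a x y kap :
  G x (cross (axis F a) x) y (cross (axis F a) y) kap
  = dd idfun (point x vec0 y vec0 kap) (point y vec0 vec0 vec0 0) (ua a) - d%:R / 2 * kap * U a x.
Proof.
have := first_mode a (@point_admissible F x vec0 y vec0 kap).
rewrite chi_twist chi_ua chi_deriv -[point _ _ _ _ _ (kgen 0)]/kap.
rewrite [X in _ = dd _ _ X _ - _ -> _](_ : _ = point y vec0 vec0 vec0 0); last first.
  apply/boolp.funext => -[b p r|p]; rewrite [dpartial _ _]/(gen F _) chi_gen.
    by case: p => [|[|p]] //=; rewrite !if_same.
  by case: p.
move=> <-; rewrite -(dd_depth x vec0 y vec0); apply: eq_dd => // -[b p r|p]; last first.
  by rewrite /= raddf0; case: p.
rewrite chi_dX_gen; have c0 := cross0 (axis F a) b.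
(* The letter of mode [-3] also becomes one of mode [-2], where the point vanishes. *)
have shift (c : 'I_3) : (1%:Z + r == -1) = (r == -2) by lia.
case: p => [|[|p]] /=; rewrite ?c0 //.
  have [->|r1] := eqVneq r (-1); first by rewrite -[LHS]c0.
  rewrite (shift b); case: (r == -2) => //.
  by rewrite -[LHS]c0 /cross; apply: eq_bigr => *; apply: eq_bigr => *; rewrite if_same.
have [->|r1] := eqVneq r (-1); first by rewrite -[LHS]c0.
rewrite (shift b); case: (r == -2) => //.
by rewrite -[LHS]c0 /cross; apply: eq_bigr => *; apply: eq_bigr => *; rewrite if_same.
Qed.

(** With [y = 0] the equation of the first mode equates [U], up to a non-zero
    factor, with the first block at a vector product with [x]. *)
Lemma U_eq0 a x : U a x = 0.
Proof.
have := first_mode_point a x vec0 1.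
have -> : G x (cross (axis F a) x) vec0 (cross (axis F a) vec0) 1 = 0.
  transitivity (-1 * G x (cross x (axis F a)) vec0 vec0 1 + G x vec0 vec0 vec0 1).
    rewrite -depth_linear; apply: eq_G => // c; first by rewrite addr0 mulN1r -crossC.
    by rewrite cross0 mulr0 addr0.
  by rewrite central_cross depth0 mulr0 addr0.
rewrite [dd _ _ _ _](_ : _ = 0); last first.
  by rewrite -[RHS](dd_0 idfun (point x vec0 vec0 vec0 1) (ua a)); apply: eq_dd => // g; rewrite point0.
rewrite sub0r mulr1 => /esym/eqP; rewrite oppr_eq0 mulf_eq0 => /orP[|/eqP //].
rewrite mulf_eq0 invr_eq0 !pnatr_eq0 orbF => /eqP d0.
by move: d_odd; rewrite d0.
Qed.

(** As [U] vanishes identically so does its derivative along [y], which is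
    the other side of the equation of the first mode. *)
Lemma mixed_block_basis a x y : dot x x != 0 -> G x (cross (axis F a) x) y vec0 0 = 0.
Proof.
move=> xx; have := G_split x (cross (axis F a) x) y (cross (axis F a) y) 0.
rewrite second_block // mul0r add0r addr0 => <-.
rewrite first_mode_point mulr0 mul0r subr0 dd_line.
set p := chi _ _ _; suff -> : p = 0 by rewrite deriv0 horner0.
apply: poly_fun0 => t; rewrite horner_chi -[RHS](U_eq0 a (fun c => t * y c + x c)).
rewrite -(chi_ua a _ y 0); apply: eq_chi => g; rewrite /line !hornerE.
transitivity (t * point y vec0 vec0 vec0 0 g + point x vec0 y vec0 0 g); first exact: addrC.
by rewrite -point_linear; apply: eq_point => // [c|c|c|]; rewrite mulr0 add0r.
Qed.

(** The vector products with [x] are now covered as well as [x] itself. *)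
Lemma mixed_block x z y : dot x x != 0 -> G x z y vec0 0 = 0.
Proof.
move=> xx; have mixed_cross alpha : G x (cross alpha x) y vec0 0 = 0.
  rewrite -(dd_depth x vec0 y vec0).
  transitivity (\sum_a alpha a * dd idfun (point x vec0 y vec0 0)
      (point vec0 (cross (axis F a) x) vec0 vec0 0) u); last first.
    by apply: big1 => a _; rewrite dd_depth mixed_block_basis // mulr0.
  rewrite -dd_sum; apply: eq_dd => // -[b [|[|p]] r|[|p]] /=; rewrite ?if_same.
  - have [_|_] := eqVneq r (-1); first by rewrite big1 // => a _; rewrite mulr0.
    case: (r == -2); last by rewrite big1 // => a _; rewrite mulr0.
    apply: eq_bigr => a _; rewrite cross_axis mulr_sumr; apply: eq_bigr => c _.
    by rewrite mulrA [alpha a * _]mulrC.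
  - by rewrite big1 // => a _; rewrite ?if_same mulr0.
  - by rewrite big1 // => a _; rewrite mulr0.
  - by rewrite big1 // => a _; rewrite mulr0.
  - by rewrite big1 // => a _; rewrite mulr0.
apply: (mulfI xx); rewrite mulr0.
transitivity (dot x x * G x z y vec0 0 + G x vec0 y vec0 0); first by rewrite depth0 addr0.
rewrite -depth_linear.
transitivity (dot x z * G x x y vec0 0
  + (- 2^-1 * G x (cross (cross x z) x) y vec0 0 + G x vec0 y vec0 0)).
  rewrite -!depth_linear; apply: eq_G => // c; last by rewrite !mulr0 !addr0.
  by rewrite double_cross // crossC mulrN mulNr.
by rewrite mixed_cross mixed_block_radial // depth0 !mulr0 !addr0.
Qed.

(** The condition [x . x != 0] is removed by moving [x] along a line: the symbol
    is polynomial on it, and vanishes off the zeros of a non-zero polynomial. *)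
Lemma G_eq0 x z y t kap : G x z y t kap = 0.
Proof.
have G0 x' : dot x' x' != 0 -> G x' z y t kap = 0.
  by move=> xx; rewrite G_split central_block // mixed_block // second_block // mulr0 !addr0.
pose e0 := axis F 0; pose p := chi (polyC \o idfun)
  (line (point x z y t kap) (point e0 vec0 vec0 vec0 0)) u.
have pE s : p.[s] = G (fun c => s * e0 c + x c) z y t kap.
  rewrite horner_chi; apply: eq_chi => g; rewrite /line !hornerE.
  transitivity (s * point e0 vec0 vec0 vec0 0 g + point x z y t kap g); first exact: addrC.
  by rewrite -point_linear; apply: eq_point => // [c|c|c|]; rewrite mulr0 add0r.
pose q : {poly F} := 'X^2 + (2 * x 0) *: 'X + (dot x x)%:P.
have qE s : q.[s] = dot (fun c => s * e0 c + x c) (fun c => s * e0 c + x c).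
  have -> : (fun c => s * e0 c + x c) = (fun c => x c + s * e0 c).
    by apply/boolp.funext => c; rewrite addrC.
  rewrite dot_addl !dot_addr dot_axis [dot x e0]dotC !dot_axis /e0 /axis eqxx mulr1n.
  by rewrite /q !hornerE; ring.
have qp0 : q * p = 0.
  apply: poly_fun0 => s; rewrite hornerM pE; have [->|nz] := eqVneq q.[s] 0; first by rewrite mul0r.
  by rewrite G0 ?mulr0 // -qE.
have q_neq0 : q != 0.
  apply/eqP => /(congr1 (fun r : {poly F} => r`_2)).
  rewrite /q !coefD coefZ coefXn coefX coefC coef0 /= mulr0 !addr0 => /eqP.
  by rewrite oner_eq0.
move/eqP: qp0; rewrite mulf_eq0 (negbTE q_neq0) /= => /eqP p0.
have := pE 0; rewrite p0 horner0 => ->; apply: eq_G => // c.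
by rewrite mul0r add0r.
Qed.

(** The weights leave only the thirteen letters of [point]. *)
Lemma first_order_vanishes (e : lgen -> F) : admissible e -> chi idfun e u = 0.
Proof.
move=> e_adm.
rewrite -(G_eq0 (I1 e) (fun a => e (Igen a 0 (-2))) (fun a => e (Igen a 1 (-1)))
  (fun a => e (Igen a 1 (-2))) (e (kgen 0))).
apply: eq_chi_supp => w /u_supp[w1 w2 wd].
have [nw|/allPn[g gw ng]] := boolP (all normal_gen w); last first.
  by rewrite (prod0 gw (e_adm g ng)) (prod0 gw (point_admissible _ _ _ _ _ ng)).
apply: eq_big_seq => g gw; have pe := perm_to_rem gw.
have := leq_nbI_wt1 (all_rem g nw); have := wt1_perm pe; have := nbI_perm pe.
rewrite w1 wd wt1_cons nbI_cons wt1_gen nbI_gen.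
have := allP nw _ gw; case: g {gw pe} => [a p r|p] /=; last by move/eqP->.
move=> /andP[r0 p1] e1 e2 le1; have {e1 e2 le1} : (r == -1) || (r == -2) by lia.
by case: p p1 => [|[|p]] // _ /orP[]/eqP->.
Qed.

End FirstMode.
End FirstOrderTerm.
End Uniqueness.

(** * Rigidity of solutions, and the theorem *)

Section Conclusion.
Variables (F : numClosedFieldType) (k : nat).
Local Notation n := k.+1.
Local Notation vec0 := (fun _ : 'I_3 => 0 : F).

Lemma twist_linear j (c : fps F) u v : twist j (c *: u + v) = c *: twist j u + twist j v.
Proof.
rewrite /twist linearP mulrDr -scalerAr scalerDr scalerBr !scalerA opprD addrACA.
by rewrite [fpsC _ * c]mulrC.
Qed.

Lemma twist0 j : twist j (0 : tens F) = 0.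
Proof. by rewrite /twist linear0 mulr0 scaler0 subrr. Qed.

Lemma twist_sum (I : finType) j (c : I -> fps F) u :
  twist j (\sum_i c i *: u i) = \sum_i c i *: twist j (u i).
Proof.
elim: (index_enum I) => [|i s IH]; first by rewrite !big_nil twist0.
by rewrite !big_cons twist_linear IH.
Qed.

Lemma Delta0_varsigma a : Delta a 0 (varsigma F n) = 0.
Proof.
rewrite varsigmaE Delta_stateE /varsigma_tensor [Defs.deriv _ _]linearD /=.
by rewrite [Defs.deriv _ (_ *: _)]linearZ /= deriv_leading deriv_subleading scaler0 addr0 linear0 scaler0.
Qed.

Lemma chi_varsigma (e : lgen -> F) : chi idfun e (varsigma_tensor F n) = dot (I1 e) (I1 e) ^+ n.
Proof. by rewrite raddfD /= chiZ coef_hbarM0 mul0r addr0 chi_leading. Qed.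

Lemma chi_hbar2 (e : lgen -> F) u w : admissible e ->
  state u = hbar ^+ 2 *: state w -> chi idfun e u = 0.
Proof.
move=> e_adm; rewrite -linearZ => /(Phi_state e_adm).
rewrite linearZ /= -Phi_cst => ->.
by rewrite expr2 -mulrA coef_hbarM0.
Qed.

(** A point at which the symbol of [varsigma] is one. It serves to normalize. *)
Definition base_point : lgen -> F := point (axis F 0) vec0 vec0 vec0 0.

Lemma chi_base_point : chi idfun base_point (varsigma_tensor F n) = 1.
Proof.
rewrite chi_varsigma (_ : dot _ _ = 1) ?expr1n //.
by rewrite -[I1 _]/(axis F 0) dot_axis /axis eqxx.
Qed.

(** A state divisible by [hbar ^+ 2] has zero symbol. *)
Lemma varsigma_neq0 : ~ eq_mod_hbar2 n.*2 (varsigma F n) 0.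
Proof.
case=> w [w' _ ->]; rewrite subr0 varsigmaE => /(chi_hbar2 (@point_admissible F _ _ _ _ _)) e.
by have /eqP := e (axis F 0) vec0 vec0 vec0 0; rewrite chi_base_point oner_eq0.
Qed.

(** The conditions that determine a solution. They are linear, so they pass to
    differences. *)
Definition solves_first_modes (v : vmod F) := forall a, Delta a 0 v = 0 /\
  exists u w : tens F, [/\ forall t, tcoef t u != 0 -> wt1 t = k.*2.+1%:Z /\ wt2 t = k.*2.+1
    & Delta a 1 v = hbar ^+ 2 *: state (twist k.*2.+1 u) + hbar ^+ 3 *: state w].

(** The powers of [hbar] cancel in the values of [Phi]. *)
Lemma invariant_of_Delta0 i (u : tens F) :
  (forall a, Delta a 0 (hbar ^+ i *: state u) = 0) -> invariant u.
Proof.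
move=> inv a e e_adm; have := inv a; rewrite linearZ /= Delta_stateE -(stateZ hbar) -(stateZ (hbar ^+ i)).
rewrite -[0](linear0 (@state F)) => /(Phi_state e_adm).
rewrite linear0 !PhiZ mulrA -exprSr => h0; rewrite -(Phi_cst e).
suff -> : Phi e [::] (Defs.deriv (dX F a 0) u) = 0 by exact: coef_fps0.
elim: i.+1 h0 => [|j IH]; first by rewrite expr0 mul1r.
by rewrite exprS -mulrA => e0; apply: IH; apply: hbar_inj; rewrite e0 mulr0.
Qed.

(** A normalized difference of solutions loses two factors [hbar] in turn.
    The symbol vanishes by invariance, which gives the first; the symbol of the
    quotient vanishes by invariance and the equation of the first mode, which
    gives the second. *)
Lemma first_modes_rigid (u : tens F) : homog n.*2 n.*2 n.*2 u ->
  solves_first_modes (state u) -> chi idfun base_point u = 0 ->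
  exists2 w, Vbi n.*2 n.*2 w & state u = hbar ^+ 2 *: w.
Proof.
move=> hu sol u0.
have inv_u : invariant u.
  by apply: (@invariant_of_Delta0 0) => a; rewrite expr0 scale1r; case: (sol a).
have [||u1 hu1 e1] := completeness (g := k.*2.+1) hu; first exact: ltnW.
  exact: leading_vanishes hu inv_u u0.
have inv_u1 : invariant u1.
  by apply: (@invariant_of_Delta0 1) => a; rewrite expr1 -e1; case: (sol a).
have /fin_all_exists[ua hua] a : exists ua : tens F,
    (forall t, tcoef t ua 0%N != 0 -> wt1 t = k.*2.+1%:Z /\ wt2 t = k.*2.+1)
    /\ forall e : lgen -> F, admissible e ->
      chi idfun e (Defs.deriv (dX F a 1) u1) = chi idfun e (twist k.*2.+1 ua).
  have [_ [ua [w [supp eq1]]]] := sol a; exists ua; split=> [t nz|e e_adm].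
    by apply: supp; apply: contraNneq nz => ->; rewrite coef_fps0.
  move: eq1; rewrite e1 linearZ /= Delta_stateE -(stateZ hbar (Defs.deriv _ _)) -(stateZ hbar) -(stateZ (hbar ^+ 2)) -(stateZ (hbar ^+ 3)) -linearD /= => /(Phi_state e_adm).
  rewrite linearD /= !PhiZ !exprS expr0 mulr1 -!mulrA -!mulrDr => /hbar_inj/hbar_inj e2.
  by rewrite -!(Phi_cst e) e2 coef_fpsD coef_hbarM0 addr0.
have supp1 w : tcoef w u1 0%N != 0 -> [/\ wt1 w = n.*2%:Z, wt2 w = n.*2 & nbI w = k.*2.+1].
  exact: hu1.
have [||u2 hu2 e2] := completeness (g := k.*2) hu1; first exact: leqnn.
  apply: (@first_order_vanishes F k.*2.+1 u1 _ supp1 inv_u1 ua) => [|a|a].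
  - by rewrite /= odd_double.
  - by case: (hua a).
  - by case: (hua a).
exists (state u2); first exact: homog_Vbi hu2.
by rewrite e1 e2 scalerA expr2.
Qed.
End Conclusion.

Theorem proposition5p0p1 (R : realType) (B : 3.-tuple 'M[R[i]]_2)
    (hB : orthonormal_sl2_basis B) (n : nat) (hn : (1 <= n)%N) :
  let is_solution (v : vmod R[i]) : Prop :=
    Vtilde_sl2 n.*2 v /\
    forall (x : 'M[R[i]]_2) (m : nat), x \in sl2 R[i] ->
      exists u w : vmod R[i],
        [/\ Vbi (n.*2%:Z - m%:Z) n.*2.-1 u,
            Vbi (n.*2%:Z - m%:Z) n.*2 w
          & Delta_sl2 B x m v
            = hbar ^+ 2 *: twisted_partial n.*2.-1 u + hbar ^+ 3 *: w] in
  exists v : vmod R[i],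
    [/\ is_solution v,
        ~ eq_mod_hbar2 n.*2 v 0,
        forall v', is_solution v' ->
          exists c : R[i], eq_mod_hbar2 n.*2 v' (fpsC c *: v)
      & eq_mod_hbar2 n.*2 v (varsigma R[i] n)].
Proof.
case: n hn => // k _ is_solution; set F : numClosedFieldType := R[i].
have [B_basis _ _] := hB.
have first_modes v : is_solution v -> solves_first_modes k v.
  move=> [[_ inv] mode] a; split; first exact: inv.
  have Ba : tnth B a \in sl2 R[i].
    by apply: (basis_mem B_basis); exact: mem_tnth.
  have [u [w [[u' hu' eu] [w' _ ew] eq1]]] := mode (tnth B a) 1%N Ba.
  exists u', w'; split.
    by move=> t /hu'[-> ->]; rewrite doubleS; split=> //; lia.
  rewrite -twisted_partial_state -eu -ew -eq1 /Delta_sl2 (bigD1 a) //= big1 => [|b ba].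
    by rewrite (tnth_nth 0) coord_free ?(basis_free B_basis) // eqxx rmorph1 scale1r addr0.
  by rewrite (tnth_nth 0) coord_free ?(basis_free B_basis) // eq_sym (negbTE ba) rmorph0 scale0r.
have sol_varsigma : is_solution (varsigma F k.+1).
  split; first (split=> [|a]; last exact: Delta0_varsigma).
    by exists (varsigma_tensor F k.+1); [exact: homog_varsigma|exact: varsigmaE].
  move=> x m _; have /fin_all_exists[uw uwP] a : exists uw : tens F * tens F,
      [/\ homog (k.+1.*2%:Z - m%:Z) k.*2.+1 k.*2.+1 uw.1,
          homog (k.+1.*2%:Z - m%:Z) k.*2.+2 k.*2 uw.2
        & Delta a m (varsigma F k.+1)
          = hbar ^+ 2 *: state (twist k.*2.+1 uw.1) + hbar ^+ 3 *: state uw.2].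
    by have [u [w uwP]] := varsigma_solution F a m k; exists (u, w); rewrite varsigmaE.
  exists (state (\sum_a fpsC (coord B a x) *: (uw a).1)).
  exists (state (\sum_a fpsC (coord B a x) *: (uw a).2)); split.
  - by apply: (homog_Vbi (g := k.*2.+1)); apply: homog_sum => a _; apply: homogZ; case: (uwP a).
  - by apply: (homog_Vbi (g := k.*2)); apply: homog_sum => a _; apply: homogZ; case: (uwP a).
  rewrite twisted_partial_state twist_sum !linear_sum -big_split /=.
  apply: eq_bigr => a _; case: (uwP a) => _ _ ->.
  by rewrite scalerDr !linearZ /= !scalerA ![fpsC _ * _]mulrC.
exists (varsigma F k.+1); split=> //; first exact: varsigma_neq0; last first.
  exists (state 0); last by rewrite subrr linear0 scaler0.
  by apply: (homog_Vbi (g := 0)); exact: homog0.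
move=> v' sol; have [[[u' hu' ev'] _] _] := sol.
pose c := chi idfun (base_point F) u'; exists c.
have ey : v' - fpsC c *: varsigma F k.+1 = state (u' - fpsC c *: varsigma_tensor F k.+1).
  by rewrite ev' varsigmaE -stateZ -raddfB.
suff [w hw ew] : exists2 w, Vbi k.+1.*2 k.+1.*2 w
    & v' - fpsC c *: varsigma F k.+1 = hbar ^+ 2 *: w by exists w.
rewrite ey; apply: first_modes_rigid.
- by apply: homogB => //; apply: homogZ; exact: homog_varsigma.
- rewrite -ey => a.
  have [i1 [u1 [w1 [s1 e1]]]] := first_modes _ sol a.
  have [i2 [u2 [w2 [s2 e2]]]] := first_modes _ sol_varsigma a.
  split; first by rewrite linearB linearZ /= i1 i2 scaler0 subrr.
  exists (- fpsC c *: u2 + u1), (- fpsC c *: w2 + w1); split.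
    move=> t; rewrite linearP /=; have [->|nz _] := eqVneq (tcoef t u2) 0; last exact: s2.
    by rewrite mulr0 add0r; exact: s1.
  rewrite linearB linearZ /= e1 e2 twist_linear.
  have stateP (t t' : tens F) : state (- fpsC c *: t + t') = - fpsC c *: state t + state t'.
    exact: linearP.
  rewrite !stateP; move: (state _) (state _) (state _) (state _) => t t' w w'.
  rewrite !scalerDr !scalerA opprD addrACA !mulrN !scaleNr ![fpsC c * _]mulrC.
  by congr (_ + _); exact: addrC.
- by rewrite raddfB /= chiZ fpsCE chi_base_point mulr1 subrr.
Qed.
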